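(* Let $0\le p\le n$ be integers, let $M$ be a connected $(n+1)$-dimensional manifold, and let $\nabla$ be a torsion-free connection on $TM$. Then $\nabla$ is a Weyl connection of a $1$-degenerate metric $g$ on $M$ of signature $(0,p,n-p)$ if and only if the holonomy group $Hol(\nabla)$ is, up to conjugation in $GL(n+1,\mathbb R)$, a subgroup of $$\mathbb R^{n}\rtimes\left[\mathbb R^{\star}\times\left(\mathbb R^{\star}\cdot O(p,n-p)\right)\right].$$
   Context: All objects are smooth. A $1$-degenerate metric $g$ on $M$ is a symmetric $(0,2)$-tensor field whose rank is everywhere $n=\dim M-1$, so that its kernel (the radical distribution) is a line subbundle of $TM$. It has signature $(0,p,n-p)$ if the nondegenerate form it induces on the quotient of $TM$ by the radical distribution has signature $(p,n-p)$ at each point, i.e. has $O(p,n-p)$ as its isometry group in a suitable basis. A torsion-free connection $\nabla$ is a Weyl connection of $g$ if there is a smooth $1$-form $\theta$ on $M$ such that $\nabla g=\theta\otimes g$, i.e. $(\nabla_Xg)(Y,Z)=\theta(X)g(Y,Z)$ for all vector fields $X,Y,Z$ on $M$. $\mathbb R^\star=\mathbb R\setminus\{0\}$. $\mathbb R^\star\cdot O(p,n-p)=\{\lambda C:\lambda\in\mathbb R^\star,\ C\in O(p,n-p)\}\subset GL(n,\mathbb R)$. The group $\mathbb R^{n}\rtimes[\mathbb R^{\star}\times(\mathbb R^{\star}\cdot O(p,n-p))]$ denotes the subgroup of $GL(n+1,\mathbb R)$ consisting of all block matrices $$\begin{pmatrix}\alpha & {}^tB\\ 0&\lambda C\end{pmatrix},\qquad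 \alpha\in\mathbb R^\star,\ B\in\mathbb R^n,\ \lambda\in\mathbb R^\star,\ C\in O(p,n-p).$$ $Hol(\nabla)$ is the (full) holonomy group of $\nabla$ at a point of $M$, viewed as a subgroup of $GL(n+1,\mathbb R)$ via a basis of the tangent space; it is well defined up to conjugation. *)

(* Defs.v *)
From mathcomp Require Import all_boot all_order all_algebra.
From mathcomp Require Import all_classical all_reals all_analysis.
Import Order.TTheory GRing.Theory Num.Theory.
Import numFieldNormedType.Exports.

Set Implicit Arguments.
Unset Strict Implicit.
Unset Printing Implicit Defensive.

Local Open Scope classical_set_scope.
Local Open Scope ring_scope.

(** * Smooth maps between finite-dimensional spaces *)

Section Smooth.
Context {R : realType} {V W : normedModType R}.

(* All iterated directional derivatives of order at most k exist and those of
   order k are continuous.  Only used with V finite-dimensional and U open,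
   where this is the usual class C^k on U. *)
Fixpoint Ck (k : nat) (U : set V) (f : V -> W) : Prop :=
  match k with
  | 0 => forall x, U x -> {for x, continuous f}
  | k'.+1 => (forall x v, U x -> derivable f x v) /\
             (forall v, Ck k' U (fun x => 'D_v f x))
  end.

Definition smooth (U : set V) (f : V -> W) : Prop := forall k, Ck k U f.

End Smooth.

(** * Smooth manifolds of dimension n.+1 *)

(* [psi i] is the inverse of the chart [phi i : dom i -> R^(n+1)]; outside of
   [dom i] and [phi i @` dom i] the values of [phi i] and [psi i] are junk.
   [chart_at x] is a distinguished chart around x, see [tcoord] below. *)
Record smooth_manifold (R : realType) (n : nat) (M : topologicalType) := {
  idx : Type;
  dom : idx -> set M;
  phi : idx -> M -> 'cV[R]_n.+1;
  psi : idx -> 'cV[R]_n.+1 -> M;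
  chart_at : M -> idx;
  mfd_hausdorff : hausdorff_space M;
  mfd_second_countable : @second_countable M;
  dom_open : forall i, open (dom i);
  img_open : forall i, open (phi i @` dom i);
  phiK : forall i x, dom i x -> psi i (phi i x) = x;
  phi_continuous : forall i x, dom i x -> {for x, continuous (phi i)};
  psi_continuous : forall i p, (phi i @` dom i) p -> {for p, continuous (psi i)};
  mem_chart_at : forall x, dom (chart_at x) x;
  transition_smooth : forall i j,
    smooth (phi i @` (dom i `&` dom j)) (phi j \o psi i)
}.

Section Manifold.
Context {R : realType} {n : nat} {M : topologicalType}.
Variable S : smooth_manifold R n M.

Local Notation E := 'cV[R]_n.+1.

Definition img (i : idx S) : set E := phi i @` dom i.

(* The tangent space T_x M is represented by R^(n+1) through the distinguished
   chart at x: a vector v : E at x stands for the tangent vector whose components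
   in the chart [chart_at S x] are v.  [tcoord i x v] are the components of that
   tangent vector in the chart i, and [tvec i x u] is the tangent vector whose
   components in the chart i are u; both are meaningful when [dom i x].
   Since [chart_at] varies arbitrarily with x, smoothness of fields is always
   expressed through their components in a fixed chart. *)
Definition tcoord (i : idx S) (x : M) (v : E) : E :=
  'D_v (phi i \o psi (chart_at S x)) (phi (chart_at S x) x).

Definition tvec (i : idx S) (x : M) (u : E) : E :=
  'D_u (phi (chart_at S x) \o psi i) (phi i x).

(** ** Functions, vector fields, 1-forms and (0,2)-tensor fields *)

Definition smooth_fun (f : M -> R) : Prop :=
  forall i, smooth (img i) (f \o psi i).

Definition smooth_vfield (X : M -> E) : Prop :=
  forall i, smooth (img i) (fun p => tcoord i (psi i p) (X (psi i p))).

Definition form1 (theta : M -> 'rV[R]_n.+1) (X : M -> E) (x : M) : R :=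
  (theta x *m X x) 0 0.

Definition smooth_form1 (theta : M -> 'rV[R]_n.+1) : Prop :=
  forall i (u : E),
    smooth (img i) (fun p => form1 theta (fun x => tvec i x u) (psi i p)).

(* [g x] is the Gram matrix of the tensor in the standard basis of T_x M. *)
Definition form2 (g : M -> 'M[R]_n.+1) (X Y : M -> E) (x : M) : R :=
  ((X x)^T *m g x *m Y x) 0 0.

Definition smooth_form2 (g : M -> 'M[R]_n.+1) : Prop :=
  forall i (u v : E),
    smooth (img i)
      (fun p => form2 g (fun x => tvec i x u) (fun x => tvec i x v) (psi i p)).

(* X . f *)
Definition lie_fun (X : M -> E) (f : M -> R) (x : M) : R :=
  let c := chart_at S x in 'D_(X x) (f \o psi c) (phi c x).

(* [X, Y]^k = X^j d_j Y^k - Y^j d_j X^k, computed in the chart [chart_at S x]. *)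
Definition lie_bracket (X Y : M -> E) (x : M) : E :=
  let c := chart_at S x in
  let loc Z p := tcoord c (psi c p) (Z (psi c p)) in
  'D_(X x) (loc Y) (phi c x) - 'D_(Y x) (loc X) (phi c x).

(** ** Linear connections on TM *)

(* A connection is only constrained on smooth vector fields. *)
Record connection := {
  nabla :> (M -> E) -> (M -> E) -> M -> E;
  nabla_smooth : forall X Y,
    smooth_vfield X -> smooth_vfield Y -> smooth_vfield (nabla X Y);
  nablaDl : forall X X' Y,
    smooth_vfield X -> smooth_vfield X' -> smooth_vfield Y ->
    forall x, nabla (fun y => X y + X' y) Y x = nabla X Y x + nabla X' Y x;
  nablaZl : forall f X Y,
    smooth_fun f -> smooth_vfield X -> smooth_vfield Y ->
    forall x, nabla (fun y => f y *: X y) Y x = f x *: nabla X Y x;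
  nablaDr : forall X Y Y',
    smooth_vfield X -> smooth_vfield Y -> smooth_vfield Y' ->
    forall x, nabla X (fun y => Y y + Y' y) x = nabla X Y x + nabla X Y' x;
  nablaZr : forall f X Y,
    smooth_fun f -> smooth_vfield X -> smooth_vfield Y ->
    forall x, nabla X (fun y => f y *: Y y) x =
              lie_fun X f x *: Y x + f x *: nabla X Y x
}.

Definition torsion_free (D : connection) : Prop :=
  forall X Y, smooth_vfield X -> smooth_vfield Y ->
  forall x, D X Y x - D Y X x = lie_bracket X Y x.

(** ** Parallel transport and holonomy *)

(* w^k = Gamma^k_ab u^a v^b at x in the chart i: these are the components of
   (nabla_X Y)(x) when X has components u at x and Y has constant components v
   near x. *)
Definition christoffel (D : connection) (i : idx S) (x : M) (u v w : E) : Prop :=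
  exists X Y : M -> E,
    [/\ smooth_vfield X, smooth_vfield Y, tcoord i x (X x) = u,
        (\forall y \near x, tcoord i y (Y y) = v) &
        tcoord i x (D X Y x) = w].

(* For J open. *)
Definition smooth_curve (J : set R) (gamma : R -> M) : Prop :=
  (forall t, J t -> {for t, continuous gamma}) /\
  (forall i : idx S, smooth (J `&` gamma @^-1` dom i) (phi i \o gamma)).

(* V t is a vector at [gamma t]; in every chart, V' = - Gamma(gamma', V). *)
Definition parallel (D : connection) (J : set R) (gamma : R -> M) (V : R -> E)
    : Prop :=
  forall t i, J t -> dom i (gamma t) ->
  let v s := tcoord i (gamma s) (V s) in
  exists2 w, christoffel D i (gamma t) ('D_1 (phi i \o gamma) t) (v t) w &
             is_derive t 1 v (- w).

(* [transport D x y A]: A is the matrix of the parallel transport from T_x M to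
   T_y M along some piecewise smooth curve, i.e. along a finite concatenation of
   smooth curves, each parametrized by [0, 1].  A smooth curve on [0, 1] is one
   which is smooth on an open interval containing [0, 1]. *)
Inductive transport (D : connection) : M -> M -> 'M[R]_n.+1 -> Prop :=
| transport_smooth (a b : R) (gamma : R -> M) (A : 'M[R]_n.+1) :
    a < 0 -> 1 < b -> smooth_curve `]a, b[ gamma ->
    (forall v : E, exists V : R -> E,
       [/\ parallel D `]a, b[ gamma V, V 0 = v & V 1 = A *m v]) ->
    transport D (gamma 0) (gamma 1) A
| transport_concat (x y z : M) (A B : 'M[R]_n.+1) :
    transport D x y A -> transport D y z B -> transport D x z (B *m A).

Definition holonomy (D : connection) (x : M) : set 'M[R]_n.+1 :=
  [set A | transport D x x A].

End Manifold.

(** * Signatures and Weyl connections *)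

Section Weyl.
Context {R : realType} {n : nat}.

(* diag(1, .., 1, -1, .., -1) with p ones *)
Definition Ipq (p : nat) : 'M[R]_n :=
  diag_mx (\row_(i < n) if (i < p)%N then 1 else - 1).

Definition in_Opq (p : nat) (C : 'M[R]_n) : Prop := C^T *m Ipq p *m C = Ipq p.

(* The columns of P form a basis whose first vector spans the radical of G and
   whose other vectors induce a pseudo-orthonormal basis, with p positive and
   n - p negative vectors, of the quotient by the radical. *)
Definition has_signature (p : nat) (G : 'M[R]_n.+1) : Prop :=
  exists2 P : 'M[R]_(1 + n), P \in unitmx &
    P^T *m (G : 'M[R]_(1 + n)) *m P = block_mx 0 0 0 (Ipq p).

(* R^n x| [R* x (R* . O(p, n - p))] *)
Definition weyl_group (p : nat) : set 'M[R]_n.+1 :=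
  [set A | exists (alpha lambda : R) (B : 'cV[R]_n) (C : 'M[R]_n),
    [/\ alpha != 0, lambda != 0, in_Opq p C &
        A = block_mx alpha%:M B^T 0 (lambda *: C) :> 'M[R]_(1 + n)]].

Context {M : topologicalType}.
Variable S : smooth_manifold R n M.

(* A 1-degenerate metric of signature (0, p, n - p) *)
Record degenerate_metric (p : nat) (g : M -> 'M[R]_n.+1) : Prop := {
  degmetric_smooth : smooth_form2 S g;
  degmetric_sym : forall x, (g x)^T = g x;
  degmetric_rank : forall x, \rank (g x) = n;
  degmetric_signature : forall x, has_signature p (g x)
}.

(* (nabla_X g)(Y, Z) = theta(X) g(Y, Z) *)
Definition weyl_connection (D : connection S) (g : M -> 'M[R]_n.+1) : Prop :=
  exists2 theta : M -> 'rV[R]_n.+1, smooth_form1 S theta &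
    forall X Y Z, smooth_vfield S X -> smooth_vfield S Y -> smooth_vfield S Z ->
    forall x,
      lie_fun S X (form2 g Y Z) x - form2 g (D X Y) Z x - form2 g Y (D X Z) x =
      form1 theta X x * form2 g Y Z x.

End Weyl.

(* Main.v *)
Require Import Defs.
From HB Require Import structures.
From mathcomp Require Import all_boot all_order all_algebra.
From mathcomp Require Import all_classical all_reals all_analysis.
From mathcomp Require Import ring lra.
Import Order.TTheory GRing.Theory Num.Theory.
Import numFieldNormedType.Exports.

(** If [nabla g = theta (x) g], and [V], [W] are parallel along a curve, then
    [f = g (V, W)] satisfies [f' = theta (gamma') f].  This scalar equation does not
    depend on [V] and [W], so parallel transport multiplies [g] by the positive
    number [exp (int theta (gamma'))].  It is also injective, since parallel fields
    solve linear equations.  Hence, in a basis adapted to [g] at [x0], the holonomy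
    consists of invertible matrices [A] with [A^T J A = c J], where [c > 0] and
    [J = diag (0, I_(p, n - p))].  Such an [A] preserves the kernel of [J], that is,
    it is block triangular, and its lower right block is [sqrt c] times an isometry
    ([transport_conformal], [conformal_weyl_group]).

    Conversely, elements of the given group multiply [J] by positive numbers.
    Carrying [J] from [x0] to another point [x] by parallel transport therefore
    gives a form on [T_x M] that depends on the curve only up to a positive factor:
    a ray of forms, nonempty because [M] is connected, and invariant under all
    transports ([ray_unique], [ray_transport]).  Its members have the required
    signature.  Any smooth section [g] of the rays is a metric as wanted: by
    invariance [nabla_u g] is proportional to [g], and the factors form a smooth
    1-form ([ray_metric_weyl], [proportional_weyl]).

    The point is to find a smooth section.  In a chart, let [N] be the
    representative of Frobenius norm [1].  Comparing [N] with its transports along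
    short coordinate segments gives
      [D_u N = T_u (N) - <T_u (N), N> N],  [T_u (N) = Gam_u^T N + N Gam_u]
    ([unit_form_derive]).  The right-hand side is polynomial in the entries of [N],
    with smooth coefficients.  As [N] has norm [1], its partial derivatives are
    bounded, so [N] is continuous; then all its derivatives exist and are
    continuous by induction ([smooth_unit_form]).  The forms [N] of the various
    charts differ by positive factors, and since a ray is convex they can be added
    with the weights of a locally finite family of bump functions
    ([smooth_ray_metric]).  In dimension [1] the metric is [0].

    The rest builds the tools: Christoffel matrices extracted from a connection
    that acts on global fields only, by means of bump functions, and the
    existence of parallel transport along segments, by Picard iteration. *)

Set Implicit Arguments.
Unset Strict Implicit.
Unset Printing Implicit Defensive.
Local Open Scope classical_set_scope.
Local Open Scope ring_scope.

(** * Smooth functions of vectors *)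

Section Continuity.

Lemma near_all (T : topologicalType) (I : finType) (x : T) (P : I -> T -> Prop) :
  (forall i, \forall y \near x, P i y) -> \forall y \near x, forall i, P i y.
Proof. by move=> H; apply: filter_forall. Qed.

Lemma continuous_at_sum (R : realType) (T : topologicalType) (I : Type)
    (r : seq I) (F : I -> T -> R) (x : T) :
  (forall i, {for x, continuous (F i)}) ->
  {for x, continuous (fun y => \sum_(i <- r) F i y)}.
Proof.
move=> H; elim: r => [|i r IH].
  by rewrite (_ : (fun _ => _) = cst 0); [exact: cst_continuous|
    apply/funext => y; rewrite big_nil].
rewrite (_ : (fun _ => _) = F i + (fun y => \sum_(i <- r) F i y)).
  by apply: continuousD => //; exact: H.
by apply/funext => y; rewrite big_cons.
Qed.

Lemma continuous_atP (R : realType) (T : topologicalType) (W : normedModType R)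
    (f : T -> W) (x : T) :
  {for x, continuous f} <->
  forall e : R, 0 < e -> \forall y \near x, `|f y - f x| <= e.
Proof.
split=> [/cvgrPdist_le H e e0|H].
  by have := H e e0; apply: filterS => y; rewrite distrC.
by apply/cvgrPdist_le => e e0; have := H e e0; apply: filterS => y; rewrite distrC.
Qed.

End Continuity.

Section DirectionalDerivative.
Context {R : realType} {V W : normedModType R}.

Lemma is_derive_line (f : V -> W) (x v : V) (t : R) :
  derivable f (x + t *: v) v ->
  is_derive t 1 (fun s => f (x + s *: v)) ('D_v f (x + t *: v)).
Proof.
rewrite /derivable /derive => df.
have E : (fun h : R => h^-1 *: (((fun s => f (x + s *: v)) \o shift t) (h *: 1) -
    f (x + t *: v))) =
  (fun h => h^-1 *: ((f \o shift (x + t *: v)) (h *: v) - f (x + t *: v))).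
  apply/funext => h /=; congr (_ *: (f _ - _)).
  by rewrite [h%:A]mulr1 scalerDl addrCA.
by split; rewrite /derivable /derive E.
Qed.

Lemma derive_line0 (f : V -> W) (x v : V) :
  'D_v f x = 'D_1 (fun h : R => f (h *: v + x)) 0.
Proof.
rewrite /derive.
have -> : (fun h : R => h^-1 *: ((f \o shift x) (h *: v) - f x)) =
    fun h => h^-1 *: (((fun s : R => f (s *: v + x)) \o shift 0) (h *: 1)
      - f (0 *: v + x)).
  by apply/funext => h; rewrite /= scale0r add0r addr0 [h%:A]mulr1.
by [].
Qed.

Lemma is_derive_of_line (f : V -> W) (x v : V) (d : W) :
  is_derive (0 : R) 1 (fun h : R => f (x + h *: v)) d -> is_derive x v f d.
Proof.
rewrite /derivable => -[d1 d2].
have E : (fun h : R => f (h *: v + x)) = (fun h => f (x + h *: v)).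
  by apply/funext => h; rewrite addrC.
by split; [apply/derivable1P; rewrite E|rewrite derive_line0 E].
Qed.

Lemma deriveZdir (f : V -> W) (x v : V) (a : R) :
  derivable f x v -> is_derive x (a *: v) f (a *: 'D_v f x).
Proof.
have [->|a0] := eqVneq a 0.
  by rewrite !scale0r => _; split; [exact: derivable0|exact: derive0].
move=> df.
suff c : (fun h => h^-1 *: ((f \o shift x) (h *: (a *: v)) - f x)) @ 0^' -->
    a *: 'D_v f x.
  by split; [apply/cvg_ex; exists (a *: 'D_v f x)|apply: cvg_lim].
have c0 : (fun h => h^-1 *: ((f \o shift x) (h *: v) - f x)) @ 0^' --> 'D_v f x.
  exact: df.
have c1 : (fun h : R => h * a) @ 0^' --> (0 : R)^'.
  move=> A [e /= e0 Ae]; exists (e / `|a|) => /=.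
    by rewrite divr_gt0 // normr_gt0.
  move=> h /=; rewrite !sub0r !normrN ltr_pdivlMr ?normr_gt0 // => he h0.
  by apply: Ae; rewrite /= ?sub0r ?normrN ?normrM // mulf_neq0.
have c2 := cvg_comp _ _ c1 c0.
apply: cvg_trans (cvgZ (cvg_cst a) c2); apply: near_eq_cvg; near=> h => /=.
rewrite scalerA invfM mulrCA divff // mulr1 scalerA //.
Unshelve. all: by end_near. Qed.

End DirectionalDerivative.

Section MVT.
Context {R : realType} {V : normedModType R}.

Lemma mvt_direction (f : V -> R) (x v : V) :
  (forall t : R, 0 <= t <= 1 -> derivable f (x + t *: v) v) ->
  exists2 t : R, 0 <= t <= 1 & f (x + v) - f x = 'D_v f (x + t *: v).
Proof.
move=> df.
have dline (t : R) : t \in `[0, 1]%R ->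
    is_derive t 1 (fun s => f (x + s *: v)) ('D_v f (x + t *: v)).
  by rewrite in_itv /= => /df; exact: is_derive_line.
have D (t : R) : t \in `]0, 1[%R ->
    is_derive t 1 (fun s => f (x + s *: v)) ('D_v f (x + t *: v)).
  by rewrite in_itv /= => /andP[/ltW a /ltW b]; apply: dline; rewrite in_itv /= a b.
have C : {within `[0, 1], continuous (fun s : R => f (x + s *: v))}.
  by apply: derivable_within_continuous => t /dline[].
have [t t01 E] := MVT_segment ler01 D C; exists t; first by move: t01; rewrite in_itv.
by move: E; rewrite scale1r scale0r addr0 subr0 mulr1.
Qed.

End MVT.

Section Partials.
Context {R : realType} {m : nat}.
Implicit Types (f : 'cV[R]_m -> R) (x h : 'cV[R]_m).

Local Notation e_ k := (delta_mx k 0 : 'cV[R]_m).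

Lemma normc_le (h : 'cV[R]_m) k : `|h k 0| <= `|h|.
Proof.
rewrite [leRHS]/Num.Def.normr/= mx_normrE.
by apply: (le_bigmax _ (fun ij => `|h ij.1 ij.2|) (k, 0)).
Qed.

Lemma normc_leP (h : 'cV[R]_m) (r : R) : 0 <= r ->
  (forall k, `|h k 0| <= r) -> `|h| <= r.
Proof.
move=> r0 hr; rewrite [leLHS]/Num.Def.normr/= mx_normrE.
by apply: bigmax_le => // -[i j] _ /=; rewrite (ord1 j).
Qed.

(** Moving from [x] to [x + h] one coordinate at a time, the mean value theorem
    controls each step by one partial derivative. *)
Lemma partials_increment f x (r K : R) (a : 'I_m -> R) :
  (forall y k, `|y - x| < r -> derivable f y (e_ k)) ->
  (forall y k, `|y - x| < r -> `|'D_(e_ k) f y - a k| <= K) ->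
  forall h, `|h| < r ->
    `|f (x + h) - f x - \sum_k h k 0 * a k| <= m%:R * K * `|h|.
Proof.
move=> df Df h hr.
pose tr (j : nat) : 'cV[R]_m := \col_k (if (k < j)%N then h k 0 else 0).
have trle (j : nat) (s : R) : `|s| <= 1 -> forall k : 'I_m, j = k ->
    `|(x + tr j + s *: (h k 0 *: e_ k)) - x| < r.
  move=> s1 k jk; apply: le_lt_trans hr; apply: normc_leP => // l.
  rewrite addrAC (addrAC x) subrr add0r !mxE.
  case: ltnP => [lj|kj].
    have /negbTE -> : l != k by apply/eqP => lk; rewrite jk lk ltnn in lj.
    by rewrite !mulr0 addr0 normc_le.
  rewrite add0r eqxx andbT; case: eqP => _; last by rewrite !mulr0 normr0.
  rewrite mulr1 normrM; apply: le_trans (normc_le h k).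
  by rewrite ler_piMl.
suff H j : (j <= m)%N ->
    `|f (x + tr j) - f x - \sum_(k < m | (k < j)%N) h k 0 * a k|
      <= j%:R * K * `|h|.
  have := H m (leqnn m); have -> : tr m = h.
    by apply/matrixP => k l; rewrite (ord1 l) mxE ltn_ord.
  by rewrite (eq_bigl xpredT) // => k; rewrite ltn_ord.
elim: j => [_|j IH jm].
  have -> : tr 0 = 0 by apply/matrixP => k l; rewrite !mxE.
  by rewrite addr0 subrr big_pred0 // subr0 normr0 mulr0n !mul0r.
pose k := Ordinal jm.
have trS : tr j.+1 = tr j + h k 0 *: e_ k.
  apply/matrixP => l l'; rewrite !mxE (ord1 l') eqxx andbT ltnS leq_eqVlt.
  have -> : (l == k) = (val l == j) by [].
  case: eqP => [lj|_] /=; last by rewrite mulr0 addr0.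
  have -> : l = k by apply/val_inj.
  by rewrite /= ltnn add0r mulr1.
have bigS : \sum_(l < m | (l < j.+1)%N) h l 0 * a l =
    \sum_(l < m | (l < j)%N) h l 0 * a l + h k 0 * a k.
  rewrite (bigD1 k) //= addrC; congr (_ + _); apply: eq_bigl => l.
  have -> : (l != k) = (val l != j) by [].
  by rewrite ltnS andbC -ltn_neqAle.
have [|t t01 ft] := @mvt_direction R _ f (x + tr j) (h k 0 *: e_ k).
  move=> t /andP[t0 t1]; apply: ex_derive; apply: deriveZdir; apply: df.
  by apply: trle => //; rewrite ger0_norm.
have {}t01 : `|t| <= 1 by case/andP: t01 => t0 t1; rewrite ger0_norm.
have yr := trle j t t01 k erefl.
have := @derive_val _ _ _ _ _ _ _ (deriveZdir (h k 0) (df _ k yr)).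
rewrite -ft trS addrA bigS => E.
rewrite -{}[f (x + tr j + h k 0 *: e_ k)](subrK (f (x + tr j))) E.
rewrite (_ : _ - _ = (f (x + tr j) - f x - \sum_(l < m | (l < j)%N) h l 0 * a l)
  + h k 0 * ('D_(e_ k) f (x + tr j + t *: (h k 0 *: e_ k)) - a k)); last first.
  by rewrite mulrBr /GRing.scale /=; ring.
rewrite -natr1 !mulrDl mul1r; apply: le_trans (ler_normD _ _) _.
apply: lerD; first exact/IH/ltnW.
rewrite normrM mulrC; apply: ler_pM => //; [exact: Df|exact: normc_le].
Qed.

Lemma near0_lt (r : R) : 0 < r -> \forall h \near (0 : 'cV[R]_m), `|h| < r.
Proof.
move=> r0; apply/nbhs_normP; exists r => // h /=.
by rewrite /ball_ /= sub0r normrN.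
Qed.

Lemma near_radius (P : 'cV[R]_m -> Prop) x :
  (\forall y \near x, P y) -> exists2 r, 0 < r & forall y, `|y - x| < r -> P y.
Proof.
move=> /nbhs_normP[r r0 H]; exists r => // y yr; apply: H.
by rewrite /ball_ /= distrC.
Qed.

Lemma radius_near (P : 'cV[R]_m -> Prop) x r : 0 < r ->
  (forall y, `|y - x| < r -> P y) -> \forall y \near x, P y.
Proof.
move=> r0 H; apply/nbhs_normP; exists r => // y yr; apply: H.
by rewrite distrC.
Qed.

Lemma differentiable_of_increment f x (a : 'I_m -> R) :
  (forall e, 0 < e -> \forall h \near (0 : 'cV[R]_m),
    `|f (x + h) - f x - \sum_k h k 0 * a k| <= e * `|h|) ->
  differentiable f x.
Proof.
move=> H.
pose d (h : 'cV[R]_m) := \sum_k h k 0 * a k.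
have dl : linear d.
  move=> c u v; rewrite /d /GRing.scale /= mulr_sumr -big_split /=.
  by apply: eq_bigr => k _; rewrite !mxE mulrDl mulrA.
pose dM := GRing.isLinear.Build _ _ _ _ _ dl.
pose dL : {linear _ -> _} := HB.pack d dM.
have dc : continuous d.
  move=> u; rewrite /d; apply: continuous_at_sum => k.
  by apply: (@continuousM R _ (fun y : 'cV[R]_m => y k 0) (fun=> a k));
    [exact: coord_continuous|exact: cst_continuous].
have Hd : f \o shift x = cst (f x) + dL +o_ (0 : 'cV[R]_m) id.
  apply/eqaddoP => e e0; have := H e e0; apply: filterS => h /=.
  by rewrite /= opprD addrA (addrC x).
by apply/diff_locallyP; rewrite (@diff_unique _ _ _ f dL x dc Hd).
Qed.

Lemma differentiable_of_partials f x :
  (\forall y \near x, forall k, derivable f y (e_ k)) ->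
  (forall k, {for x, continuous ('D_(e_ k) f)}) -> differentiable f x.
Proof.
move=> df cf; apply: (@differentiable_of_increment f x (fun k => 'D_(e_ k) f x)).
move=> e e0; pose K := e / m.+1%:R.
have K0 : 0 < K by rewrite divr_gt0.
have : \forall y \near x, (forall k, derivable f y (e_ k)) /\
    (forall k, `|'D_(e_ k) f y - 'D_(e_ k) f x| <= K).
  apply: filterI => //; apply: (@near_all 'cV[R]_m 'I_m x
    (fun k y => `|'D_(e_ k) f y - 'D_(e_ k) f x| <= K)) => k.
  by move/continuous_atP : (cf k) => /(_ K K0).
move=> /near_radius[r r0 Hr]; apply: filterS (near0_lt r0) => h hr.
apply: le_trans (@partials_increment f x r K _ _ _ h hr) _.
- by move=> y k /Hr[].
- by move=> y k /Hr[].
apply: ler_wpM2r => //; rewrite /K mulrCA ler_piMr //; first exact: ltW.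
by rewrite ler_pdivrMr // mul1r ler_nat.
Qed.

(** Needed for functions whose derivatives are known only in terms of
    themselves, where the continuity of the partial derivatives is not available
    in advance. *)
Lemma continuous_of_bounded_partials f x (K : R) :
  (\forall y \near x, forall k, derivable f y (e_ k) /\ `|'D_(e_ k) f y| <= K) ->
  {for x, continuous f}.
Proof.
move=> /near_radius[r r0 Hr].
have K0 : 0 <= m%:R * K.
  case: (posnP m) => [->|m0]; first by rewrite mul0r.
  have xx : `|x - x| < r by rewrite subrr normr0.
  by have [_ /(le_trans _) H] := Hr x xx (Ordinal m0); rewrite mulr_ge0 // H.
apply/continuous_atP => e e0.
apply: (@radius_near _ _ (Num.min r (e / (m%:R * K + 1)))).
  by rewrite lt_min r0 divr_gt0 // ltr_wpDl.
move=> y; rewrite lt_min => /andP[yr ye].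
have := @partials_increment f x r K (fun=> 0) _ _ (y - x) yr.
rewrite [x + _]addrC subrK big1 ?subr0; last by move=> k _; rewrite mulr0.
move=> H; apply: le_trans (H _ _) _.
- by move=> z k /Hr/(_ k)[].
- by move=> z k /Hr/(_ k)[_]; rewrite subr0.
move: ye; rewrite ltr_pdivlMr; last by rewrite ltr_wpDl.
move=> /ltW; apply: le_trans; rewrite mulrC ler_wpM2l // lerDl //.
Qed.

Lemma deriveE_partials f x v : differentiable f x ->
  is_derive x v f (\sum_k v k 0 * 'D_(e_ k) f x).
Proof.
move=> df; apply: DeriveDef; first exact: diff_derivable.
rewrite deriveE // [in LHS](_ : v = \sum_k v k 0 *: e_ k).
  by rewrite linear_sum; apply: eq_bigr => k _; rewrite linearZ -deriveE.
apply/matrixP => i j; rewrite (ord1 j) summxE (bigD1 i) //= big1.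
  by rewrite !mxE !eqxx mulr1 addr0.
by move=> k ki; rewrite !mxE eq_sym (negbTE ki) mulr0.
Qed.

End Partials.

Section Chain.
Context {R : realType} {V : normedModType R} {m : nat}.

(** The definition of smoothness speaks of directional derivatives, which do
    not compose; the outer function has to be differentiable. *)
Lemma derive_chain (f : V -> 'cV[R]_m) (g : 'cV[R]_m -> R) (x v : V) w :
  is_derive x v f w -> differentiable g (f x) ->
  is_derive x v (g \o f) ('D_w g (f x)).
Proof.
move=> [df <-] dg.
have df1 := (derivable1P f x v).1 df.
have dfl : differentiable (fun h : R => f (h *: v + x)) 0 by exact/derivable1_diffP.
have dgl : differentiable g (f (0 *: v + x)) by rewrite scale0r add0r.
have dgf := differentiable_comp dfl dgl.
split; first by apply/derivable1P/derivable1_diffP.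
rewrite derive_line0 [RHS]deriveE //.
rewrite deriveE //.
have -> : (fun h : R => (g \o f) (h *: v + x)) = g \o (fun h : R => f (h *: v + x)).
  by [].
rewrite diff_comp //= scale0r add0r; congr ('d _ _ _).
by rewrite derive_line0 deriveE.
Qed.

End Chain.

Section SmoothCalculus.
Context {R : realType} {V : normedModType R}.
Implicit Types U : set V.

(** As a property of single points, [Ck] can be transported along equalities
    that hold only near a point. *)
Lemma Ck_pointwise (W : normedModType R) k U (f : V -> W) :
  Ck k U f <-> forall x, U x -> Ck k [set x] f.
Proof.
elim: k f => [|k IH] f /=.
  by split=> H x Ux; [move=> _ ->; exact: H|exact: (H x Ux x)].
split=> [[df Df] x Ux|H].
  split=> [_ v ->|v]; first exact: df.
  by have /IH := Df v; exact.
split=> [x v Ux|v]; first by have [+ _] := H x Ux; exact.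
by apply/IH => x Ux; have [_] := H x Ux; exact.
Qed.

Lemma Ck_near_eq (W : normedModType R) k (x : V) (f g : V -> W) :
  (\near x, f x = g x) -> Ck k [set x] f -> Ck k [set x] g.
Proof.
elim: k f g => [|k IH] f g fg /=.
  move=> H _ ->; have Hx := H x erefl.
  rewrite /prop_for /continuous_at -(nbhs_singleton fg).
  by apply: cvg_trans Hx; apply: near_eq_cvg; exact: fg.
move=> [df Df]; split=> [_ v ->|v].
  by apply: near_eq_derivable fg _; exact: df.
apply: (IH ('D_v f)) => //.
have := nbhs_interior fg; apply: filterS => y; exact: near_eq_derive.
Qed.

(** The neighbourhood makes this property stable under differentiation of
    functions that are only defined, or only understood, near [x]. *)
Definition smooth_at (W : normedModType R) (x : V) (f : V -> W) :=
  \forall y \near x, forall k, Ck k [set y] f.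

Variable W : normedModType R.
Implicit Types f g : V -> W.

Lemma smoothP U f : open U -> smooth U f <-> forall x, U x -> smooth_at x f.
Proof.
move=> oU; split=> [H x Ux|H k].
  have : nbhs x U by exact: open_nbhs_nbhs.
  apply: filterS => y Uy k; have /Ck_pointwise := H k; exact.
by apply/Ck_pointwise => x /H /nbhs_singleton.
Qed.

Lemma smooth_at_open x f :
  smooth_at x f -> exists U, [/\ open U, U x & smooth U f].
Proof.
rewrite /smooth_at => H; exists (interior [set y | forall k, Ck k [set y] f]).
split; [exact: open_interior|exact: H|].
by move=> k; apply/Ck_pointwise => y /interior_subset; exact.
Qed.

Lemma open_smooth_at U x f : open U -> U x -> smooth U f -> smooth_at x f.
Proof. by move=> oU Ux /smoothP H; apply: H. Qed.

Lemma smooth_at_near x f : smooth_at x f -> \forall y \near x, smooth_at y f.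
Proof. exact: nbhs_interior. Qed.

Lemma smooth_at_near_eq x f g :
  (\near x, f x = g x) -> smooth_at x f -> smooth_at x g.
Proof.
move=> /nbhs_interior fg sf; near=> y => k; apply: (@Ck_near_eq _ k y f g).
  by near: y.
by move: k; near: y.
Unshelve. all: by end_near. Qed.

Lemma smooth_at_continuous x f : smooth_at x f -> {for x, continuous f}.
Proof. by move=> /nbhs_singleton /(_ 0); exact. Qed.

Lemma smooth_at_derivable x v f : smooth_at x f -> derivable f x v.
Proof. by move=> /nbhs_singleton /(_ 1) [+ _]; exact. Qed.

Lemma smooth_at_derive x v f : smooth_at x f -> smooth_at x ('D_v f).
Proof. by rewrite /smooth_at; apply: filterS => y H k; have [_] := H k.+1; exact. Qed.

Lemma smooth_at_is_derive x v f : smooth_at x f -> is_derive x v f ('D_v f x).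
Proof. by move=> sf; apply/derivableP/smooth_at_derivable. Qed.

Lemma smooth_derive U v f : smooth U f -> smooth U ('D_v f).
Proof. by move=> H k; have [_] := H k.+1; exact. Qed.

Lemma Ck_eq_open k U f g : open U -> (forall x, U x -> f x = g x) ->
  Ck k U f -> Ck k U g.
Proof.
move=> oU fg /Ck_pointwise H; apply/Ck_pointwise => x Ux.
apply: (@Ck_near_eq _ k x f g); last exact: H.
have : nbhs x U by exact: open_nbhs_nbhs.
exact: filterS.
Qed.

Lemma Ck_cst k U (a : W) : Ck k U (fun=> a).
Proof.
elim: k a => [|k IH] a /=; first by move=> x _; exact: cst_continuous.
split=> [x v _|v]; first exact: derivable_cst.
by rewrite (_ : 'D_v _ = fun=> 0) //; apply/funext => x; exact: derive_cst.
Qed.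

Lemma Ck_add k U f g : open U -> Ck k U f -> Ck k U g ->
  Ck k U (fun x => f x + g x).
Proof.
move=> oU; elim: k f g => [|k IH] f g /=.
  by move=> cf cg x Ux; apply: cvgD; [exact: cf|exact: cg].
move=> [df Df] [dg Dg]; split=> [x v Ux|v].
  by apply: derivableD; [exact: df|exact: dg].
apply: (@Ck_eq_open _ _ (fun x => 'D_v f x + 'D_v g x)) => //; last exact: IH.
by move=> x Ux; rewrite deriveD //; [exact: df|exact: dg].
Qed.

End SmoothCalculus.

Section SmoothSum.
Context {R : realType} {V W : normedModType R}.
Implicit Types f g : V -> W.

Lemma smooth_at2 (W1 W2 : normedModType R) x (f1 : V -> W1) (f2 : V -> W2) g :
  (forall U, open U -> smooth U f1 -> smooth U f2 -> smooth U g) ->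
  smooth_at x f1 -> smooth_at x f2 -> smooth_at x g.
Proof.
move=> H sf1 sf2; have [A [oA x1 s1]] := smooth_at_open sf1.
have [B [oB x2 s2]] := smooth_at_open sf2.
have o12 : open (A `&` B) by exact: openI.
apply: (@open_smooth_at _ _ _ (A `&` B)) => //; apply: H => // k; apply/Ck_pointwise.
  by move=> y [y1 _]; have /Ck_pointwise := s1 k; exact.
by move=> y [_ y2]; have /Ck_pointwise := s2 k; exact.
Qed.

Lemma smooth_at_cst (x : V) (a : W) : smooth_at x (fun=> a).
Proof. by near=> y => k; exact: Ck_cst. Unshelve. all: by end_near. Qed.

Lemma smooth_at_add x f g : smooth_at x f -> smooth_at x g ->
  smooth_at x (fun y => f y + g y).
Proof. by apply: smooth_at2 => U oU sf sg k; exact: Ck_add. Qed.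

End SmoothSum.

Lemma smooth_at_id (R : realType) (V : normedModType R) (x : V) :
  smooth_at x (id : V -> V).
Proof.
near=> y => -[|k] /=; first by move=> z _; exact: cvg_id.
split=> [z v _|v]; first exact: derivable_id.
by rewrite (_ : 'D_v id = fun=> v);
  [exact: Ck_cst|apply/funext => z; exact: derive_id].
Unshelve. all: by end_near. Qed.

Section SmoothScalars.
Context {R : realType} {V : normedModType R}.
Implicit Types (U : set V) (x : V) (f g : V -> R).

(** [G] will be a set of functions whose derivatives are polynomials in members
    of [G], with smooth coefficients. *)
Inductive alg U (G : (V -> R) -> Prop) : (V -> R) -> Prop :=
| alg_smooth f : smooth U f -> alg U G f
| alg_gen f : G f -> alg U G f
| alg_add f g : alg U G f -> alg U G g -> alg U G (fun x => f x + g x)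
| alg_mul f g : alg U G f -> alg U G g -> alg U G (fun x => f x * g x).

Lemma alg_sum U G (I : Type) (r : seq I) (F : I -> V -> R) :
  (forall a, alg U G (F a)) -> alg U G (fun x => \sum_(a <- r) F a x).
Proof.
move=> H; elim: r => [|a r IH].
  rewrite (_ : (fun _ => _) = (fun=> 0)).
    by apply: alg_smooth => k; exact: Ck_cst.
  by apply/funext => y; rewrite big_nil.
rewrite (_ : (fun _ => _) = fun y => F a y + \sum_(a <- r) F a y).
  exact: alg_add.
by apply/funext => y; rewrite big_cons.
Qed.

(** Differentiation maps the algebra into itself and all its members are
    continuous, so the iterated derivatives exist and are continuous.  Products,
    inverses, compositions, flat functions and the normalized forms below are all
    treated in this way. *)
Lemma smooth_alg U (G : (V -> R) -> Prop) : open U ->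
  (forall f x, G f -> U x -> {for x, continuous f}) ->
  (forall f v, G f -> exists2 g, alg U G g &
     forall x, U x -> is_derive x v f (g x)) ->
  forall f, alg U G f -> smooth U f.
Proof.
move=> oU cG dG.
have cA f x : alg U G f -> U x -> {for x, continuous f}.
  move=> af Ux; elim: af => {f} [f sf|f|f g _ cf _ cg|f g _ cf _ cg].
  - exact: (sf 0).
  - by move=> /cG; exact.
  - exact: cvgD.
  - exact: cvgM.
have dA f v : alg U G f -> exists2 g, alg U G g &
    forall x, U x -> is_derive x v f (g x).
  elim=> {f} [f sf|f /(dG _ v)|f g _ [f' af df] _ [g' ag dg]|f g af [f' af' df] ag [g' ag' dg]] //.
  - exists ('D_v f); first exact/alg_smooth/smooth_derive.
    by move=> x Ux; apply/derivableP; have [+ _] := sf 1; exact.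
  - exists (fun x => f' x + g' x); first exact: alg_add.
    by move=> x Ux; have ? := df x Ux; have ? := dg x Ux; apply: is_deriveD.
  - exists (fun x => f x * g' x + g x * f' x).
      by apply: alg_add; apply: alg_mul.
    by move=> x Ux; have ? := df x Ux; have ? := dg x Ux; apply: is_deriveM.
move=> f af k; elim: k f af => [|k IH] f af /=.
  by move=> x; exact: cA.
split=> [x v Ux|v]; have [g ag dg] := dA f v af; first by case: (dg x Ux).
by apply: (@Ck_eq_open _ _ _ _ _ g) => //; [move=> x /dg[]|exact: IH].
Qed.

Lemma smooth_at_mul x f g : smooth_at x f -> smooth_at x g ->
  smooth_at x (fun y => f y * g y).
Proof.
apply: smooth_at2 => U oU sf sg.
apply: (@smooth_alg U (fun=> False)) => //.
by apply: alg_mul; exact: alg_smooth.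
Qed.

Lemma smooth_at_opp x f : smooth_at x f -> smooth_at x (fun y => - f y).
Proof.
move=> sf; rewrite (_ : (fun _ => _) = (fun y => -1 * f y)).
  by apply: smooth_at_mul => //; exact: smooth_at_cst.
by apply/funext => y; rewrite mulN1r.
Qed.

Lemma smooth_at_sum x (I : Type) (r : seq I) (F : I -> V -> R) :
  (forall i, smooth_at x (F i)) -> smooth_at x (fun y => \sum_(i <- r) F i y).
Proof.
move=> H; elim: r => [|i r IH].
  rewrite (_ : (fun _ => _) = (fun=> 0)); first exact: smooth_at_cst.
  by apply/funext => y; rewrite big_nil.
rewrite (_ : (fun _ => _) = fun y => F i y + \sum_(i <- r) F i y).
  exact: smooth_at_add.
by apply/funext => y; rewrite big_cons.
Qed.

Lemma smooth_at_prod x (I : Type) (r : seq I) (F : I -> V -> R) :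
  (forall i, smooth_at x (F i)) -> smooth_at x (fun y => \prod_(i <- r) F i y).
Proof.
move=> H; elim: r => [|i r IH].
  rewrite (_ : (fun _ => _) = (fun=> 1)); first exact: smooth_at_cst.
  by apply/funext => y; rewrite big_nil.
rewrite (_ : (fun _ => _) = fun y => F i y * \prod_(i <- r) F i y).
  exact: smooth_at_mul.
by apply/funext => y; rewrite big_cons.
Qed.

Lemma smooth_at_exp x f k : smooth_at x f -> smooth_at x (fun y => f y ^+ k).
Proof.
move=> sf; elim: k => [|k IH].
  rewrite (_ : (fun _ => _) = (fun=> 1)); first exact: smooth_at_cst.
  by apply/funext => y; rewrite expr0.
rewrite (_ : (fun _ => _) = fun y => f y * f y ^+ k); first exact: smooth_at_mul.
by apply/funext => y; rewrite exprS.
Qed.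

Lemma smooth_at_inv x f : smooth_at x f -> f x != 0 ->
  smooth_at x (fun y => (f y)^-1).
Proof.
move=> sf f0.
have : \forall y \near x, f y != 0.
  have := smooth_at_continuous sf; move=> /(cvgr_neq0 (f x)); exact.
have [U [oU Ux sU]] := smooth_at_open sf.
move=> /nbhs_interior fN; pose U' := U `&` interior [set y | f y != 0].
have oU' : open U' by apply: openI => //; exact: open_interior.
have fU' y : U' y -> f y != 0 by case=> _ /nbhs_singleton.
have sU' : smooth U' f.
  by apply/smoothP => // y [Uy _]; move/smoothP : sU; exact.
apply: (@open_smooth_at _ _ _ U') => //; first by split=> //; exact: nbhs_singleton fN.
apply: (@smooth_alg U' (fun g => g = fun y => (f y)^-1)) => //.
- move=> _ y -> U'y; apply: continuousV; first exact: fU'.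
  exact: (sU' 0).
- move=> _ v ->; exists (fun y => (-1 * 'D_v f y) * ((f y)^-1 * (f y)^-1)).
    apply: alg_mul; first apply: alg_mul; last by apply: alg_mul; exact: alg_gen.
      by apply: alg_smooth; move=> k; exact: Ck_cst.
    by apply/alg_smooth/smooth_derive.
  move=> y U'y; have [df _] := sU' 1; have dfy := df y v U'y.
  split; first by apply: derivableV => //; exact: fU'.
  rewrite deriveV ?fU' //.
  by rewrite /GRing.scale /= expr2 invfM mulN1r !mulNr mulrC.
- exact: alg_gen.
Qed.

End SmoothScalars.

Section SmoothMatrices.
Context {R : realType} {V : normedModType R}.

Lemma continuous_mxP m n (F : V -> 'M[R]_(m, n)) x :
  {for x, continuous F} <-> forall i j, {for x, continuous (fun y => F y i j)}.
Proof.
split=> [cF i j|cF].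
  apply: (@continuous_comp _ _ _ F (fun M : 'M[R]_(m, n) => M i j)) => //.
  exact: coord_continuous.
apply/continuous_atP => e e0.
have : \forall y \near x, forall ij : 'I_m * 'I_n, `|F y ij.1 ij.2 - F x ij.1 ij.2| <= e.
  by apply: near_all => -[i j]; move/continuous_atP : (cF i j) => /(_ e e0).
apply: filterS => y H; rewrite [leLHS]/Num.Def.normr/= mx_normrE.
by apply: bigmax_le => [|ij _]; [exact: ltW|rewrite !mxE].
Qed.

Lemma derive_mxE m n (F : V -> 'M[R]_(m, n)) x v i j :
  derivable F x v -> 'D_v (fun y => F y i j) x = 'D_v F x i j.
Proof. by move=> /derive_mx ->; rewrite mxE. Qed.

Lemma is_derive_mxP m n (F : V -> 'M[R]_(m, n)) x v (D : 'M[R]_(m, n)) :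
  is_derive x v F D <-> forall i j, is_derive x v (fun y => F y i j) (D i j).
Proof.
split=> [[dF <-] i j|H].
  split; first by move/derivable_mxP : dF.
  exact: derive_mxE.
have dF : derivable F x v by apply/derivable_mxP => i j; case: (H i j).
split=> //; apply/matrixP => i j; rewrite -derive_mxE //.
by case: (H i j).
Qed.

Lemma smooth_at_mxP m n (x : V) (F : V -> 'M[R]_(m, n)) :
  smooth_at x F <-> forall i j, smooth_at x (fun y => F y i j).
Proof.
have H j : forall (U : set V), open U -> forall F : V -> 'M[R]_(m, n),
  Ck j U F <-> forall a b, Ck j U (fun z => F z a b).
  move=> U oU; elim: j => [|j IH] {}F /=.
    split=> [H a b y /H/continuous_mxP|H y Uy]; first exact.
    by apply/continuous_mxP => a b; exact: H.
  split=> [[dF DF] a b|H].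
    split=> [y v Uy|v]; first by have /derivable_mxP := dF y v Uy; exact.
    apply: (@Ck_eq_open _ _ _ _ _ (fun y => 'D_v F y a b)) => //.
      by move=> y Uy; rewrite derive_mxE //; exact: dF.
    by have /IH := DF v; exact.
  have dF y v : U y -> derivable F y v.
    by move=> Uy; apply/derivable_mxP => a b; have [+ _] := H a b; exact.
  split=> // v; apply/IH => a b.
  apply: (@Ck_eq_open _ _ _ _ _ ('D_v (fun y => F y a b))) => //.
    by move=> y Uy; rewrite derive_mxE //; exact: dF.
  by have [_] := H a b; exact.
split=> [sF a b|sF].
  have [U [oU Ux sU]] := smooth_at_open sF.
  by apply: (@open_smooth_at _ _ _ U) => // j; have /(H j U oU) := sU j; exact.
have {}sF : \forall y \near x, forall ab : 'I_m * 'I_n, smooth_at y (fun z => F z ab.1 ab.2).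
  by apply: near_all => -[a b]; apply: smooth_at_near; exact: sF.
move: sF => /nbhs_interior sF.
apply: (@open_smooth_at _ _ _ (interior [set y | forall ab : 'I_m * 'I_n,
    smooth_at y (fun z => F z ab.1 ab.2)])) => //; first exact: open_interior.
  exact: nbhs_singleton sF.
move=> j; apply/H; first exact: open_interior.
move=> a b; apply/Ck_pointwise => y /nbhs_singleton /(_ (a, b)) /= /nbhs_singleton.
exact.
Qed.

Lemma is_derive_trmx m n (F : V -> 'M[R]_(m, n)) x v D :
  is_derive x v F D -> is_derive x v (fun y => (F y)^T) D^T.
Proof.
move=> /is_derive_mxP dF; apply/is_derive_mxP => i j; rewrite mxE.
by rewrite (_ : (fun _ => _) = fun y => F y j i) //; apply/funext => y; rewrite mxE.
Qed.

Lemma is_derive_mulmx a b c (F : V -> 'M[R]_(a, b)) (G : V -> 'M[R]_(b, c))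
    x v F' G' :
  is_derive x v F F' -> is_derive x v G G' ->
  is_derive x v (fun y => F y *m G y) (F x *m G' + F' *m G x).
Proof.
move=> /is_derive_mxP dF /is_derive_mxP dG; apply/is_derive_mxP => i j.
rewrite (_ : (fun _ => _) = \sum_k (fun y => F y i k * G y k j)); last first.
  by apply/funext => y; rewrite mxE fct_sumE.
have H k : is_derive x v (fun y => F y i k * G y k j)
    (F x i k * G' k j + F' i k * G x k j).
  have := is_deriveM (dF i k) (dG k j); rewrite /GRing.scale /= [G x k j * _]mulrC.
  exact.
by apply: is_derive_eq (is_derive_sum H) _; rewrite !mxE big_split.
Qed.

End SmoothMatrices.

Section SmoothComposition.
Context {R : realType} {V : normedModType R} {m : nat}.

Lemma smooth_at_differentiable (g : 'cV[R]_m -> R) x :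
  smooth_at x g -> differentiable g x.
Proof.
move=> sg; apply: differentiable_of_partials.
  by have := smooth_at_near sg; apply: filterS => y sy k; exact: smooth_at_derivable.
by move=> k; apply: smooth_at_continuous; exact: smooth_at_derive.
Qed.

Lemma smooth_at_comp (f : V -> 'cV[R]_m) (g : 'cV[R]_m -> R) x :
  smooth_at x f -> smooth_at (f x) g -> smooth_at x (g \o f).
Proof.
move=> sf sg.
have [B [oB Bf sB]] := smooth_at_open sg.
have sfB : \forall y \near x, smooth_at y f /\ B (f y).
  apply: filterI; first exact: smooth_at_near.
  by apply: (smooth_at_continuous sf); exact: open_nbhs_nbhs.
pose U := interior [set y | smooth_at y f /\ B (f y)].
have oU : open U by exact: open_interior.
have UP y : U y -> smooth_at y f /\ B (f y) by move/interior_subset.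
have sU : smooth U f by apply/smoothP => // y /UP[].
apply: (@open_smooth_at _ _ _ U) => //.
apply: (@smooth_alg _ _ U (fun h => exists2 g, smooth B g & h = g \o f)) => //.
- move=> _ y [h sh ->] /UP[sy Bfy]; apply: continuous_comp.
    exact: smooth_at_continuous.
  exact: (sh 0).
- move=> _ v [h sh ->].
  exists (fun y => \sum_k 'D_v f y k 0 * ('D_(delta_mx k 0) h \o f) y).
    apply: alg_sum => k; apply: alg_mul.
      apply: alg_smooth; apply/smoothP => // y /UP[sy _].
      by move/smooth_at_mxP : (smooth_at_derive v sy); exact.
    by apply: alg_gen; exists ('D_(delta_mx k 0) h) => //; exact: smooth_derive.
  move=> y /UP[sy Bfy].
  have dh : differentiable h (f y).
    by apply: smooth_at_differentiable; move/smoothP : sh => /(_ oB); exact.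
  have dfy := smooth_at_is_derive v sy.
  have [dc vc] := derive_chain dfy dh.
  split => //; rewrite vc; have [_ ->] := deriveE_partials ('D_v f y) dh.
  by [].
- by apply: alg_gen; exists g.
Qed.

End SmoothComposition.

Section Flat.
Context {R : realType}.

(** The powers of [1 / t] make the family closed under differentiation: the
    derivative of [flat k] is a combination of [flat k.+1] and [flat k.+2]. *)
Definition flat (k : nat) (t : R) : R :=
  if 0 < t then t^-1 ^+ k * expR (- t^-1) else 0.

Lemma flat_gt0 k t : 0 < t -> 0 < flat k t.
Proof. by move=> t0; rewrite /flat t0 mulr_gt0 ?expR_gt0 // exprn_gt0 // invr_gt0. Qed.

Lemma flat_le0 k t : t <= 0 -> flat k t = 0.
Proof. by move=> t0; rewrite /flat ltNge t0. Qed.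

Lemma flat_ge0 k t : 0 <= flat k t.
Proof. by case: (ltP 0 t) => [/(flat_gt0 k)/ltW //|/flat_le0 ->]. Qed.

Lemma flatS k t : t * flat k.+1 t = flat k t.
Proof.
case: (ltP 0 t) => [t0|t0]; last by rewrite !flat_le0 // mulr0.
by rewrite /flat t0 exprS !mulrA divff ?mul1r // gt_eqF.
Qed.

(** From [exp(1/t) >= t^-(k+1) / (k+1)!] and [flat k t = t * flat k.+1 t]; at
    [0] it gives both the continuity and the vanishing of the derivative. *)
Lemma flat_bound k : exists2 C : R, 0 < C & forall t, flat k t <= C * `|t|.
Proof.
exists (k.+1)`!%:R; first by rewrite ltr0n fact_gt0.
move=> t; case: (ltP 0 t) => [t0|t0]; last by rewrite flat_le0 // mulr_ge0.
rewrite -(flatS k) (gtr0_norm t0) mulrC ler_pM2r //.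
rewrite /flat t0 expRN ler_pdivrMr ?expR_gt0 // mulrC -ler_pdivrMr ?ltr0n ?fact_gt0 //.
have := @expR_ge1Dxn R t^-1 k; rewrite invr_ge0 (ltW t0) => /(_ isT).
by apply: le_trans; rewrite lerDr.
Qed.

Lemma is_derive_flat k (t : R) :
  is_derive t 1 (flat k) (flat k.+2 t - k%:R * flat k.+1 t).
Proof.
have [t0|t0|->] := ltgtP t 0.
- rewrite !flat_le0 ?ltW // mulr0 subr0.
  apply: near_eq_is_derive (is_derive_cst (0 : R) t 1).
  near=> s; rewrite /= flat_le0 //; apply: ltW; near: s; exact: lt_nbhsl.
- have E : \near t, t^-1 ^+ k * expR (- t^-1) = flat k t.
    near=> s; rewrite /flat ifT //; near: s; exact: lt_nbhsr.
  have dV : is_derive t 1 (fun t : R => t^-1) (- (t^-1 ^+ 2)).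
    have := @is_deriveV R id t 1 1 (_ : id t != 0) _; rewrite gt_eqF //=.
    move=> /(_ isT) H; apply: is_derive_eq (H _) _.
    by rewrite [_ *: _]mulr1 exprVn.
  have dE : is_derive t 1 (fun t : R => expR (- t^-1)) (t^-1 ^+ 2 * expR (- t^-1)).
    have dN : is_derive t 1 (fun t : R => - t^-1) (t^-1 ^+ 2).
      by have := is_deriveN dV; rewrite opprK.
    by apply: is_derive_eq (is_derive1_comp (is_derive_expR _) dN) _; rewrite mulrC.
  have dX : is_derive t 1 (fun t : R => t^-1 ^+ k) (- (k%:R * t^-1 ^+ k.+1)).
    have -> : (fun t : R => t^-1 ^+ k) = (fun t : R => t^-1) ^+ k.
      by apply/funext => u; rewrite exprfctE.
    apply: is_derive_eq (is_deriveX k dV) _.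
    rewrite /GRing.scale /=; case: (k) => [|j]; first by rewrite !mul0r oppr0.
    by rewrite mulrN -mulrA -exprD addn2.
  apply: (near_eq_is_derive (f := fun t : R => t^-1 ^+ k * expR (- t^-1)) E).
  apply: is_derive_eq (is_deriveM dX dE) _.
  by rewrite /flat t0 /GRing.scale /= !exprS; ring.
- rewrite !flat_le0 // mulr0 subr0; have [C C0 HC] := flat_bound k.+1.
  suff c : (fun h => h^-1 *: ((flat k \o shift 0) (h *: 1) - flat k 0)) @ 0^' -->
    (0 : R) by split; [apply/cvg_ex; exists 0|exact: cvg_lim].
  apply/cvgr0Pnorm_le => e e0; near=> h => /=.
  have h0 : h != 0 by near: h; exact: nbhs_dnbhs_neq.
  rewrite (flat_le0 _ (lexx 0)) subr0 addr0 [h%:A]mulr1 -flatS [_ *: _]mulrA.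
  rewrite mulVf // mul1r ger0_norm ?flat_ge0 //; apply: le_trans (HC h) _.
  rewrite mulrC -ler_pdivlMr // ltW //; near: h; apply: dnbhs0_lt.
  by rewrite divr_gt0.
Unshelve. all: by end_near. Qed.

Lemma continuous_flat k t : {for t, continuous (flat k)}.
Proof.
apply: differentiable_continuous; apply/derivable1_diffP.
by case: (is_derive_flat k t).
Qed.

Lemma smooth_at_flat (V : normedModType R) (x : V) (f : V -> R) k :
  smooth_at x f -> smooth_at x (fun y => flat k (f y)).
Proof.
move=> sf; have [U [oU Ux sU]] := smooth_at_open sf.
apply: (@open_smooth_at _ _ _ U) => //.
apply: (@smooth_alg _ _ U (fun g => exists k, g = fun y => flat k (f y))) => //.
- move=> _ y [j ->] Uy; apply: continuous_comp; first exact: (sU 0).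
  exact: continuous_flat.
- move=> _ v [j ->].
  exists (fun y => 'D_v f y * (flat j.+2 (f y) + - j%:R * flat j.+1 (f y))).
    apply: alg_mul; first exact/alg_smooth/smooth_derive.
    apply: alg_add; first by apply: alg_gen; exists j.+2.
    apply: alg_mul; first by apply: alg_smooth => l; exact: Ck_cst.
    by apply: alg_gen; exists j.+1.
  move=> y Uy; have [df _] := sU 1.
  have dl : is_derive (0 : R) 1 (fun h : R => f (h *: v + y)) ('D_v f y).
    have := @is_derive_line R V R f y v 0; rewrite scale0r addr0.
    move=> /(_ (df y v Uy)); under eq_fun do rewrite addrC; exact.
  have fy : f (0 *: v + y) = f y by rewrite scale0r add0r.
  have := @is_derive_flat j (f y); rewrite -{1}fy => dF.
  have := is_derive1_comp dF dl; rewrite mulrC mulNr => -[d1 d2].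
  split; first exact/derivable1P.
  by rewrite -d2 derive_line0.
- by apply: alg_gen; exists k.
Qed.

End Flat.

(** * Linear ordinary differential equations *)

Section Primitive.
Context {R : realType}.
Implicit Types (f F : R -> R) (r t : R).

Lemma mvt_bound F f r K (s t : R) :
  (forall u : R, `|u| < r -> is_derive u 1 F (f u)) ->
  `|s| < r -> `|t| < r ->
  (forall u, `|u - s| <= `|t - s| -> `|f u| <= K) ->
  `|F t - F s| <= K * `|t - s|.
Proof.
move=> dF sr tr fK.
have in_r (u : R) : 0 <= u <= 1 -> `|s + u *: (t - s)| < r.
  move=> /andP[u0 u1].
  rewrite (_ : s + _ = (1 - u) * s + u * t); last by rewrite /GRing.scale /=; ring.
  apply: le_lt_trans (ler_normD _ _) _.
  rewrite !normrM (ger0_norm u0) (ger0_norm (_ : 0 <= 1 - u)) ?subr_ge0 //.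
  have [->|u0'] := eqVneq u 0; first by rewrite subr0 mul1r mul0r addr0.
  rewrite (_ : r = (1 - u) * r + u * r); last by ring.
  apply: ler_ltD; first by rewrite ler_wpM2l ?subr_ge0 // ltW.
  by rewrite ltr_pM2l // lt_def u0' u0.
have dZ (u : R) : 0 <= u <= 1 -> is_derive (s + u *: (t - s)) (t - s) F
    ((t - s) * f (s + u *: (t - s))).
  move=> /in_r ur; have [d1 d2] := dF _ ur.
  have := deriveZdir (t - s) d1; rewrite d2 /GRing.scale /= mulr1.
  exact.
have [u /dZ[]|u u01] := @mvt_direction R R F s (t - s); first by [].
rewrite [s + _]addrC subrK => ->; have [_ ->] := dZ u u01.
rewrite normrM mulrC ler_wpM2r //; apply: fK.
rewrite [s + _]addrC addrK /GRing.scale /= normrM ler_piMl //.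
by case/andP: u01 => u0 u1; rewrite ger0_norm.
Qed.

Lemma zero_derive_const (f : R -> R) (r s : R) :
  (forall q : R, `|q| < r -> is_derive q 1 f 0) -> `|s| < r -> f s = f 0.
Proof.
move=> df sr.
have r0 : `|0 : R| < r by rewrite normr0; apply: le_lt_trans sr.
have bound : forall u : R, `|u - 0| <= `|s - 0| -> `|0 : R| <= 0 by move=> u _; rewrite normr0.
have := @mvt_bound f (fun=> 0) r 0 0 s df r0 sr bound.
by rewrite mul0r normr_le0 subr_eq0 => /eqP.
Qed.

(** The mean value theorem bounds the increments of [F_ n s - s * f t] by the
    variation of [f_ n], uniformly in [n]. *)
Lemma derive_uniform_limit (F_ f_ : nat -> R -> R) F f r t :
  (forall e : R, 0 < e -> exists n, forall s, `|s| < r ->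
    [/\ `|F_ n s - F s| <= e, `|f_ n s - f s| <= e &
        is_derive s 1 (F_ n) (f_ n s)]) ->
  `|t| < r -> {for t, continuous f} -> is_derive t 1 F (f t).
Proof.
move=> H tr /continuous_atP cf.
suff c : (fun h => h^-1 *: ((F \o shift t) (h *: 1) - F t)) @ 0^' --> f t.
  by split; [apply/cvg_ex; exists (f t)|exact: cvg_lim].
apply/cvgrPdist_le => e e0.
have e30 : 0 < e / 3 by rewrite divr_gt0.
have [d d0 Hd] : exists2 d : R, 0 < d & forall u, `|u - t| < d -> `|f u - f t| <= e / 3.
  have /nbhs_normP[d d0 Hd] := cf _ e30; exists d => // u ud; apply: Hd.
  by rewrite /= distrC.
near=> h.
have h0 : h != 0 by near: h; exact: nbhs_dnbhs_neq.
have hd : `|h| < d by near: h; exact: dnbhs0_lt.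
have htr : `|t + h| < r.
  have : `|h| < r - `|t| by near: h; apply: dnbhs0_lt; rewrite subr_gt0.
  by move=> hr; apply: le_lt_trans (ler_normD _ _) _; rewrite addrC -ltrBrDr.
have hd2 : `|h| + `|t| < r.
  by rewrite -ltrBrDr; near: h; apply: dnbhs0_lt; rewrite subr_gt0.
have nh : 0 < `|h| by rewrite normr_gt0.
rewrite /= [h%:A]mulr1 (addrC h) /GRing.scale /=.
suff : `|F (t + h) - F t - h * f t| <= e * `|h|.
  rewrite -ler_pdivrMr // -normfV -normrM => HH.
  rewrite distrC; apply: le_trans HH; rewrite le_eqVlt; apply/orP; left.
  by apply/eqP; congr `|_|; field.
pose e' := Num.min (e / 3) (e * `|h| / 6).
have e'0 : 0 < e' by rewrite lt_min e30 /= divr_gt0 // mulr_gt0.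
have [n Hn] := H _ e'0.
have [A1 _ _] := Hn _ htr; have [A2 _ _] := Hn _ tr.
have B : `|(F_ n (t + h) - (t + h) * f t) - (F_ n t - t * f t)| <=
    (e / 3 + e / 3) * `|t + h - t|.
  apply: (@mvt_bound (fun s => F_ n s - s * f t) (fun s => f_ n s - f t) r) => //.
    move=> u ur; have [_ _ dF] := Hn u ur.
    have dm : is_derive u 1 (fun s : R => s * f t) (f t).
      apply: is_derive_eq (is_deriveM (is_derive_id u 1) (is_derive_cst (f t) u 1)) _.
      by rewrite /GRing.scale /= mulr0 add0r mulr1.
    exact: is_deriveB.
  move=> u; rewrite [t + h]addrC addrK => uh.
  have ur : `|u| < r.
    rewrite -[u](subrK t); apply: le_lt_trans (ler_normD _ _) _.
    by apply: le_lt_trans hd2; rewrite lerD2r.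
  have [_ fn _] := Hn u ur.
  rewrite -[f_ n u - f t](subrKA (f u)); apply: le_trans (ler_normD _ _) _.
  apply: lerD; first by apply: le_trans fn _; rewrite ge_min lexx.
  by apply: Hd; exact: le_lt_trans uh hd.
rewrite [X in _ <= _ * `|X|](_ : _ = h) in B; last by ring.
rewrite (_ : _ - _ = - (F_ n (t + h) - F (t + h)) + (F_ n t - F t) +
  (F_ n (t + h) - (t + h) * f t - (F_ n t - t * f t))); last by ring.
apply: le_trans (ler_normD _ _) _.
rewrite [leRHS](_ : _ = e * `|h| / 3 + (e / 3 + e / 3) * `|h|); last by field.
apply: lerD => //; apply: le_trans (ler_normD _ _) _; rewrite normrN.
rewrite [leRHS](_ : _ = e * `|h| / 6 + e * `|h| / 6); last by field.
by apply: lerD; [apply: le_trans A1 _|apply: le_trans A2 _]; rewrite ge_min lexx orbT.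
Unshelve. all: by end_near. Qed.

Lemma is_derive_continuous F t (d : R) : is_derive t 1 F d -> {for t, continuous F}.
Proof. by move=> [dF _]; apply/differentiable_continuous/derivable1_diffP. Qed.

(** Composing with [clamp] turns functions on an interval into functions on the
    whole line. *)
Definition clamp r t : R := Num.max (- r) (Num.min t r).

Lemma continuous_clamp r : continuous (clamp r).
Proof.
move=> t; apply: (@continuous_max R R (cst (- r)) (fun t => Num.min t r)).
  exact: cst_continuous.
by apply: (@continuous_min R R id (cst r)); [exact: cvg_id|exact: cst_continuous].
Qed.

Lemma clamp_id r t : `|t| <= r -> clamp r t = t.
Proof. by rewrite ler_norml /clamp => /andP[a b]; rewrite min_l // max_r. Qed.

Lemma clamp_le r t : 0 <= r -> `|clamp r t| <= r.
Proof.
move=> r0; rewrite ler_norml /clamp le_max lexx /= ge_max ge_min lexx orbT andbT.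
by rewrite (le_trans _ r0) // oppr_le0.
Qed.

Lemma right_primitive f (a : R) : continuous f ->
  exists F, forall t : R, a < t -> is_derive t 1 F (f t).
Proof.
move=> cf.
exists (fun x => \int[lebesgue_measure]_(t in `[a, x]) f t)%R => t at'.
have intf : lebesgue_measure.-integrable `[a, t + 1] (EFin \o f).
  apply: continuous_compact_integrable; first exact: segment_compact.
  exact: continuous_subspaceT.
have tt1 : t < t + 1 by rewrite ltrDl.
have [d1 d2] := continuous_FTC1_closed tt1 intf at' (cf t).
by split; [exact: d1|rewrite -derive1E; exact: d2].
Qed.

Lemma clamped_primitive f r : 0 < r -> continuous f ->
  exists F, [/\ continuous F, F 0 = 0,
    forall t : R, `|t| < r -> is_derive t 1 F (f t) &
    forall K : R, (forall t, `|f t| <= K) -> forall t, `|F t| <= r * K].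
Proof.
move=> r0 cf; have [G dG] := right_primitive (- (r + 1)) cf.
have r1 (t : R) : `|t| <= r -> - (r + 1) < t.
  by rewrite ler_norml => /andP[tr _]; apply: lt_le_trans tr; rewrite ltrN2 ltrDl.
exists (fun t => G (clamp r t) - G 0); split.
- move=> t; apply: continuousB; last exact: cst_continuous.
  apply: continuous_comp; first exact: continuous_clamp.
  by apply: is_derive_continuous; apply/dG/r1/clamp_le/ltW.
- by rewrite clamp_id ?subrr // normr0 ltW.
- move=> t tr; have E : \near t, G t - G 0 = G (clamp r t) - G 0.
    near=> s; rewrite clamp_id // ltW //; near: s.
    have : {for t, continuous (fun s : R => `|s|)} by exact: norm_continuous.
    by move=> /(cvgr_lt `|t|); exact.
  apply: near_eq_is_derive E _.
  have d1 := dG t (r1 t (ltW tr)).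
  have := is_deriveB d1 (is_derive_cst (G 0) t 1); rewrite subr0; exact.
- move=> K fK t; have cr := clamp_le t (ltW r0).
  have K0 : 0 <= K by apply: le_trans (fK 0).
  apply: (@le_trans _ _ (K * `|clamp r t - 0|)).
    apply: (@mvt_bound G f (r + 1)) => //.
    + by move=> u; rewrite ltr_norml => /andP[u1 _]; exact: dG.
    + by rewrite normr0 addr_gt0.
    + by apply: le_lt_trans cr _; rewrite ltrDl.
  by rewrite subr0 mulrC ler_wpM2r.
Unshelve. all: by end_near. Qed.

End Primitive.

Section LinearODE.
Context {R : realType}.
Local Notation half := (2^-1 : R).

Lemma half_expS k : half ^+ k.+1 = half ^+ k / 2.
Proof. by rewrite exprSr. Qed.

Lemma half_exp_small (e : R) : 0 < e -> exists n, 2 * half ^+ n <= e.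
Proof.
move=> e0; have h1 : `|half| < 1.
  by rewrite ger0_norm ?invr_ge0 // invf_lt1 // ltr1n.
have /cvgr0Pnorm_le /(_ e e0)[N _ HN] := cvg_geometric 2 h1.
by exists N; have := HN N (leqnn N); rewrite /= ger0_norm // mulr_ge0 // exprn_ge0 // invr_ge0.
Qed.

Lemma geometric_tail (u : nat -> R) : (forall k, `|u k| <= half ^+ k) ->
  exists l, forall n, `|\sum_(k < n) u k - l| <= 2 * half ^+ n.
Proof.
move=> uk; pose S n := \sum_(k < n) u k.
have tail n m : `|S (n + m)%N - S n| <= 2 * half ^+ n - 2 * half ^+ (n + m).
  elim: m => [|m IH]; first by rewrite addn0 !subrr normr0.
  rewrite addnS /S big_ord_recr /= -/(S _) addrAC.
  apply: le_trans (ler_normD _ _) _.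
  apply: le_trans (lerD IH (uk _)) _.
  by rewrite half_expS; lra.
have cS : cvgn S.
  apply/cauchy_cvgP/cauchy_exP => e e0; have e20 : 0 < e / 2 by rewrite divr_gt0.
  have [N HN] := half_exp_small e20; exists (S N); exists N => // m /= Nm.
  have /(_ (m - N)%N) := tail N; rewrite subnKC // => H.
  rewrite -ball_normE /ball_ /= distrC; apply: le_lt_trans H _.
  have h3 : 0 <= half ^+ m by rewrite exprn_ge0 // invr_ge0.
  by lra.
exists (limn S) => n; apply/ler_addgt0Pr => e e0.
have /cvgrPdist_le /(_ e e0)[N _ HN] : S @ \oo --> limn S by [].
have h1 := HN (n + N)%N (leq_addl _ _).
have h2 := tail n N.
have h3 : 0 <= half ^+ (n + N) by rewrite exprn_ge0 // invr_ge0.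
rewrite -[_ - _](subrKA (S (n + N)%N)); apply: le_trans (ler_normD _ _) _.
rewrite [`|_ - limn S|]distrC; apply: lerD h1.
rewrite distrC; apply: le_trans h2 _; rewrite lerBlDr lerDl mulr_ge0 //.
Qed.

Variable d : nat.
Implicit Types M X Y : R -> 'M[R]_d.

Lemma mulmx_entry_le (A B : 'M[R]_d) K b i j : 0 <= K ->
  (forall i j, `|A i j| <= K) -> (forall i j, `|B i j| <= b) ->
  `|(A *m B) i j| <= d%:R * K * b.
Proof.
move=> K0 AK Bb; rewrite mxE; apply: le_trans (ler_norm_sum _ _ _) _.
apply: (@le_trans _ _ (\sum_(k < d) K * b)).
  by apply: ler_sum => k _; rewrite normrM ler_pM.
by rewrite sumr_const card_ord -mulrA mulr_natl.
Qed.

Lemma continuous_mulmx i j M X (t : R) :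
  {for t, continuous M} -> {for t, continuous X} ->
  {for t, continuous (fun s => (M s *m X s) i j)}.
Proof.
move=> /continuous_mxP cM /continuous_mxP cX.
rewrite (_ : (fun _ => _) = fun s => \sum_k M s i k * X s k j).
  by apply: continuous_at_sum => k; exact: continuousM.
by apply/funext => s; rewrite mxE.
Qed.

(** Picard iteration: the smallness of [r * (d * K)] makes the successive terms
    decrease geometrically, uniformly in [t]. *)
Lemma linear_ode_global M (r K : R) : 0 < r -> 0 <= K ->
  (forall t : R, {for t, continuous M}) -> (forall t i j, `|M t i j| <= K) ->
  r * (d%:R * K) <= half ->
  exists2 X : R -> 'M[R]_d, X 0 = 1%:M &
    forall t : R, `|t| < r -> is_derive t 1 X (M t *m X t).
Proof.
move=> r0 K0 cM MK small.
pose good (f F : R -> R) := continuous f -> [/\ continuous F, F 0 = 0,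
    forall t : R, `|t| < r -> is_derive t 1 F (f t) &
    forall K : R, (forall t, `|f t| <= K) -> forall t, `|F t| <= r * K].
have ex_prim f : exists F, good f F.
  case: (pselect (continuous f)) => [cf|ncf]; last by exists f.
  by have [F HF] := clamped_primitive r0 cf; exists F.
have [prim primP] := choice ex_prim.
pose A := fix A k : R -> 'M[R]_d := if k is k'.+1 then
  fun t => \matrix_(i, j) prim (fun s => (M s *m A k' s) i j) t else fun=> 1%:M.
have cA k (t : R) : {for t, continuous (A k)}.
  elim: k t => [|k IH] t; first exact: cst_continuous.
  apply/continuous_mxP => i j.
  rewrite (_ : (fun _ => _) = prim (fun s => (M s *m A k s) i j)).
    have [c _ _ _] := primP (fun s => (M s *m A k s) i j)
      (fun s => continuous_mulmx (cM s) (IH s)).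
    exact: c.
  by apply/funext => s; rewrite mxE.
have prA k i j := primP (fun s => (M s *m A k s) i j)
  (fun s => continuous_mulmx (cM s) (cA k s)).
have Ab k t i j : `|A k t i j| <= half ^+ k.
  elim: k t i j => [|k IH] t i j.
    by rewrite mxE expr0; case: (i == j); rewrite /= ?normr1 ?normr0.
  have [_ _ _ b] := prA k i j; rewrite /= mxE.
  apply: le_trans (b (d%:R * K * half ^+ k) _ t) _.
    by move=> s; exact: mulmx_entry_le.
  by rewrite mulrA exprS ler_wpM2r // exprn_ge0 // invr_ge0.
have [X XP] : exists X : R -> 'M[R]_d, forall t n i j,
    `|\sum_(k < n) A k t i j - X t i j| <= 2 * half ^+ n.
  have H t i j := geometric_tail (fun k => Ab k t i j).
  exists (fun t => \matrix_(i, j) sval (cid (H t i j))) => t n i j.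
  by rewrite mxE; case: (cid _).
pose S n t : 'M[R]_d := \sum_(k < n) A k t.
have SX n t i j : `|S n t i j - X t i j| <= 2 * half ^+ n.
  by rewrite /S summxE; exact: XP.
have cS n t i j : {for t, continuous (fun s => S n s i j)}.
  rewrite (_ : (fun _ => _) = fun s => \sum_(k < n) A k s i j); last first.
    by apply/funext => s; rewrite /S summxE.
  by apply: continuous_at_sum => k; move/continuous_mxP : (cA k t); exact.
have cX t : {for t, continuous X}.
  apply/continuous_mxP => i j; apply/continuous_atP => e e0.
  have e30 : 0 < e / 3 by rewrite divr_gt0.
  have [n Hn] := half_exp_small e30.
  have /continuous_atP /(_ _ e30) := cS n t i j.
  apply: filterS => s Hs.
  have h1 := le_trans (SX n s i j) Hn; have h2 := le_trans (SX n t i j) Hn.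
  move: h1 h2 Hs; rewrite !ler_norml => /andP[a1 b1] /andP[a2 b2] /andP[a3 b3].
  by apply/andP; split; lra.
exists X.
  apply/matrixP => i j; apply/eqP; rewrite -subr_eq0 -normr_le0.
  apply/ler_addgt0Pr => e e0; rewrite add0r; have [n Hn] := half_exp_small e0.
  have S0 : S n.+1 0 i j = (1%:M : 'M[R]_d) i j.
    rewrite /S summxE big_ord_recl /= big1 ?addr0 // => k _.
    by rewrite mxE; have [_ ->] := prA k i j.
  rewrite -S0 distrC; apply: le_trans (SX _ _ _ _) _; apply: le_trans Hn.
  by rewrite half_expS ler_wpM2l // ler_pdivrMr // ler_peMr ?exprn_ge0 ?invr_ge0 // ler1n.
move=> t tr; apply/is_derive_mxP => i j.
apply: (@derive_uniform_limit _ (fun n s => S n.+1 s i j)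
  (fun n s => (M s *m S n s) i j) _ (fun s => (M s *m X s) i j) r t) => //; last first.
  exact: continuous_mulmx.
move=> e e0.
have dK0 : 0 < d%:R * K + 1 by rewrite ltr_wpDl // mulr_ge0.
have e'0 : 0 < Num.min e (e / (d%:R * K + 1)) by rewrite lt_min e0 divr_gt0.
have [n] := half_exp_small e'0.
rewrite le_min => /andP[Hn1 Hn2].
exists n => s sr; split.
- apply: le_trans (SX _ _ _ _) _; apply: le_trans Hn1.
  by rewrite half_expS ler_wpM2l // ler_pdivrMr // ler_peMr ?exprn_ge0 ?invr_ge0 // ler1n.
- rewrite (_ : _ - _ = (M s *m (S n s - X s)) i j); last by rewrite mulmxBr !mxE.
  have SXs a b : `|(S n s - X s) a b| <= 2 * half ^+ n by rewrite !mxE; exact: SX.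
  apply: le_trans (mulmx_entry_le i j K0 (MK s) SXs) _.
  move: Hn2; rewrite ler_pdivlMr // => Hn2; apply: le_trans Hn2.
  rewrite mulrC ler_wpM2l ?lerDl // mulr_ge0 // exprn_ge0 // invr_ge0 //.
- suff : is_derive s 1 (S n.+1) (M s *m S n s) by move/is_derive_mxP; exact.
  rewrite (_ : S n.+1 = \sum_(k < n.+1) A k); last first.
    by apply/funext => u; rewrite fct_sumE.
  pose D (k : nat) : 'M[R]_d := if k is k'.+1 then M s *m A k' s else 0.
  rewrite (_ : M s *m S n s = \sum_(k < n.+1) D k); last first.
    by rewrite big_ord_recl add0r mulmx_sumr.
  apply: is_derive_sum => -[[|k] kn]; first exact: is_derive_cst.
  apply/is_derive_mxP => a b.
  rewrite (_ : (fun _ => _) = prim (fun s => (M s *m A k s) a b)).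
    by have [_ _ dD _] := prA k a b; exact: dD.
  by apply/funext => u; rewrite mxE.
Qed.

(** The resolvent of [X' = M X] together with its inverse, which solves the
    adjoint equation; having both makes uniqueness of solutions immediate. *)
Lemma linear_ode M (r r' K : R) : 0 < r -> r < r' -> 0 <= K ->
  (forall t : R, `|t| < r' -> {for t, continuous M}) ->
  (forall t, `|t| < r' -> forall i j, `|M t i j| <= K) ->
  r * (d%:R * K) <= half ->
  exists X Y : R -> 'M[R]_d, [/\ X 0 = 1%:M, Y 0 = 1%:M &
    forall t : R, `|t| < r -> [/\ is_derive t 1 X (M t *m X t),
      is_derive t 1 Y (- (Y t *m M t)) & Y t *m X t = 1%:M]].
Proof.
move=> r0 rr' K0 cM MK small.
have cr t : `|clamp r t| < r' by apply: le_lt_trans rr'; exact/clamp_le/ltW.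
pose N t := M (clamp r t).
have cN (t : R) : {for t, continuous N}.
  by apply: continuous_comp; [exact: continuous_clamp|exact: cM].
have [X X0 dX] := linear_ode_global r0 K0 cN (fun t => MK _ (cr t)) small.
have cNT (t : R) : {for t, continuous (fun t => - (N t)^T)}.
  apply/continuous_mxP => i j.
  rewrite (_ : (fun _ => _) = - (fun y => N y j i)).
    by apply: continuousN; move/continuous_mxP : (cN t); exact.
  by apply/funext => s; rewrite !mxE.
have [|Z Z0 dZ] := linear_ode_global r0 K0 cNT _ small.
  by move=> t i j; rewrite !mxE normrN; exact/MK/cr.
have NE t : `|t| < r -> N t = M t by move=> tr; rewrite /N clamp_id // ltW.
pose Y t := (Z t)^T.
have dY (t : R) : `|t| < r -> is_derive t 1 Y (- (Y t *m M t)).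
  move=> tr; apply/is_derive_mxP => i j.
  have /is_derive_mxP /(_ j i) := dZ t tr; rewrite NE // => H.
  rewrite (_ : (fun _ => _) = (fun s => Z s j i)); last first.
    by apply/funext => s; rewrite mxE.
  apply: is_derive_eq H _; rewrite mulNmx !mxE; congr (- _).
  by apply: eq_bigr => k _; rewrite !mxE mulrC.
exists X, Y; split; [by []|by rewrite /Y Z0 trmx1|].
move=> t tr; have dXM (s : R) : `|s| < r -> is_derive s 1 X (M s *m X s).
  by move=> sr; have := dX s sr; rewrite NE.
split; [exact: dXM|exact: dY|].
apply/matrixP => i j.
have YX (s : R) : `|s| < r -> is_derive s 1 (fun s => (Y s *m X s) i j) 0.
  move=> sr; have := is_derive_mulmx (dY s sr) (dXM s sr).
  by rewrite mulNmx mulmxA subrr => /is_derive_mxP /(_ i j); rewrite mxE.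
have YX0 : (Y 0 *m X 0) i j = (1%:M : 'M[R]_d) i j by rewrite X0 /Y Z0 trmx1 mul1mx.
by rewrite -YX0; exact: (zero_derive_const YX tr).
Qed.

End LinearODE.

(** * Charts *)

Section SmoothMatrixTools.
Context {R : realType} {V : normedModType R}.

Lemma is_derive_comp_mx m a b (f : V -> 'cV[R]_m) (g : 'cV[R]_m -> 'M[R]_(a, b))
    (x v : V) w : is_derive x v f w -> smooth_at (f x) g ->
  is_derive x v (g \o f) ('D_w g (f x)).
Proof.
move=> df sg; apply/is_derive_mxP => i j.
have sgij : smooth_at (f x) (fun y => g y i j) by move/smooth_at_mxP : sg.
rewrite -derive_mxE; last exact: smooth_at_derivable.
exact: derive_chain (smooth_at_differentiable sgij).
Qed.

Lemma smooth_at_comp_mx m a b (f : V -> 'cV[R]_m)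
    (g : 'cV[R]_m -> 'M[R]_(a, b)) x :
  smooth_at x f -> smooth_at (f x) g -> smooth_at x (g \o f).
Proof.
move=> sf /smooth_at_mxP sg; apply/smooth_at_mxP => i j.
exact: (smooth_at_comp (g := fun y => g y i j)).
Qed.

(** Linearity in the direction comes from the continuity of the partial
    derivatives, through differentiability. *)
Lemma is_derive_jacobian m a (g : 'cV[R]_m -> 'cV[R]_a) x u : smooth_at x g ->
  is_derive x u g
    ((\matrix_(i, j) 'D_(delta_mx j 0 : 'cV[R]_m) g x i 0) *m u).
Proof.
move=> sg; apply/is_derive_mxP => i j; rewrite (ord1 j) mxE.
have sgi : smooth_at x (fun y => g y i 0) by move/smooth_at_mxP : sg.
apply: is_derive_eq (deriveE_partials u (smooth_at_differentiable sgi)) _.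
apply: eq_bigr => k _; rewrite mxE mulrC derive_mxE //.
exact: smooth_at_derivable.
Qed.

End SmoothMatrixTools.

Section Charts.
Context {R : realType} {n : nat} {M : topologicalType}.
Variable S : smooth_manifold R n M.
Local Notation E := 'cV[R]_n.+1.
Local Notation e_ k := (delta_mx k 0 : E).
Implicit Types (i j k l : idx S) (x y : M) (f g : M -> R) (X Y : M -> E).

Lemma mem_img i x : dom i x -> img i (phi i x).
Proof. by exists x. Qed.

Lemma img_psi i p : img i p -> dom i (psi i p) /\ phi i (psi i p) = p.
Proof. by move=> [x dx <-]; rewrite phiK. Qed.

Lemma near_dom i x : dom i x -> \forall y \near x, dom i y.
Proof. by move=> dx; apply: open_nbhs_nbhs; split => //; exact: dom_open. Qed.

Lemma near_img i x : dom i x -> \forall p \near phi i x, img i p.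
Proof. by move=> dx; apply: open_nbhs_nbhs; split; [exact: img_open|exact: mem_img]. Qed.

Lemma near_psi i x (P : M -> Prop) : dom i x ->
  (\forall y \near x, P y) -> \forall p \near phi i x, P (psi i p).
Proof.
move=> dx Px; have := @psi_continuous _ _ _ S i _ (mem_img dx).
by rewrite /prop_for /continuous_at phiK //; apply.
Qed.

Lemma near_phi i x (P : E -> Prop) : dom i x ->
  (\forall p \near phi i x, P p) -> \forall y \near x, P (phi i y).
Proof. by move=> dx; exact: (@phi_continuous _ _ _ S i x dx). Qed.

(** The target chart comes first, so that Jacobian matrices compose as
    [jac k j *m jac j i]. *)
Definition tr j i : E -> E := phi j \o psi i.

Lemma smooth_at_tr j i x : dom i x -> dom j x -> smooth_at (phi i x) (tr j i).
Proof.
move=> di dj; have nij : \forall y \near x, dom i y /\ dom j y.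
  by apply: filterI; exact: near_dom.
apply: filterS (filterI (near_img di) (near_psi di nij)) => p [ip [dip djp]] k.
have := @transition_smooth _ _ _ S i j k => /Ck_pointwise; apply.
by exists (psi i p) => //; have [] := img_psi ip.
Qed.

Definition jac j i x : 'M[R]_n.+1 :=
  \matrix_(a, b) 'D_(e_ b) (tr j i) (phi i x) a 0.

Lemma is_derive_tr j i x u : dom i x -> dom j x ->
  is_derive (phi i x) u (tr j i) (jac j i x *m u).
Proof. by move=> di dj; apply: is_derive_jacobian; exact: smooth_at_tr. Qed.

Lemma mulmx_inj_col (A B : 'M[R]_n.+1) : (forall u : E, A *m u = B *m u) -> A = B.
Proof.
move=> AB; apply/matrixP => a b; have /matrixP/(_ a 0) := AB (e_ b).
by rewrite -!colE !mxE.
Qed.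

Lemma jac_id i x : dom i x -> jac i i x = 1%:M.
Proof.
move=> dx; apply: mulmx_inj_col => u; rewrite mul1mx.
have [_ <-] := is_derive_tr u dx dx.
rewrite (@near_eq_derive _ _ _ (tr i i) id); first exact: derive_id.
by have := near_img dx; apply: filterS => p /img_psi[].
Qed.

Lemma jac_comp k j i x : dom i x -> dom j x -> dom k x ->
  jac k j x *m jac j i x = jac k i x.
Proof.
move=> di dj dk; apply: mulmx_inj_col => u; rewrite -mulmxA.
have [_ <-] := is_derive_tr u di dk.
have dji := is_derive_tr u di dj.
have phiij : tr j i (phi i x) = phi j x by rewrite /tr /= phiK.
have skj : smooth_at (tr j i (phi i x)) (tr k j) by rewrite phiij; exact: smooth_at_tr.
have [_] := is_derive_comp_mx dji skj; rewrite phiij.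
have [_ ->] := is_derive_tr (jac j i x *m u) dj dk => <-.
apply: near_eq_derive; have := near_psi di (near_dom dj).
by apply: filterS => p djp; rewrite /tr /= phiK.
Qed.

Lemma tcoordE i x v : dom i x -> tcoord i x v = jac i (chart_at S x) x *m v.
Proof. by move=> dx; have [_ <-] := is_derive_tr v (mem_chart_at S x) dx. Qed.

Lemma tvecE i x u : dom i x -> tvec i x u = jac (chart_at S x) i x *m u.
Proof. by move=> dx; have [_ <-] := is_derive_tr u dx (mem_chart_at S x). Qed.

Lemma tcoord_change j i x v : dom i x -> dom j x ->
  tcoord j x v = jac j i x *m tcoord i x v.
Proof. by move=> di dj; rewrite !tcoordE // mulmxA jac_comp //; exact: mem_chart_at. Qed.

Lemma tcoord_tvec j i x u : dom i x -> dom j x ->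
  tcoord j x (tvec i x u) = jac j i x *m u.
Proof. by move=> di dj; rewrite tcoordE // tvecE // mulmxA jac_comp //; exact: mem_chart_at. Qed.

Lemma tvecK i x u : dom i x -> tcoord i x (tvec i x u) = u.
Proof. by move=> dx; rewrite tcoord_tvec // jac_id // mul1mx. Qed.

Lemma tcoordK i x v : dom i x -> tvec i x (tcoord i x v) = v.
Proof.
move=> dx; rewrite tvecE // tcoordE // mulmxA jac_comp //; try exact: mem_chart_at.
by rewrite jac_id ?mul1mx //; exact: mem_chart_at.
Qed.

Lemma tcoord_chart_at x v : tcoord (chart_at S x) x v = v.
Proof. by rewrite tcoordE ?jac_id ?mul1mx //; exact: mem_chart_at. Qed.

(** Smoothness near a point of [M] is tested in the distinguished chart only;
    [fsmoothP] shows that every chart gives the same notion. *)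
Definition fsmooth f x := smooth_at (phi (chart_at S x) x) (f \o psi (chart_at S x)).

Lemma smooth_at_change j i x f : dom i x -> dom j x ->
  smooth_at (phi i x) (f \o psi i) -> smooth_at (phi j x) (f \o psi j).
Proof.
move=> di dj sf; apply: (@smooth_at_near_eq _ _ _ _ ((f \o psi i) \o tr i j)).
  have := near_psi dj (near_dom di); apply: filterS => p dip.
  by rewrite /tr /= phiK.
have pij : tr i j (phi j x) = phi i x by rewrite /tr /= phiK.
by apply: smooth_at_comp; [exact: smooth_at_tr|rewrite pij].
Qed.

Lemma fsmoothP i x f : dom i x -> fsmooth f x <-> smooth_at (phi i x) (f \o psi i).
Proof. by move=> di; split; apply: smooth_at_change => //; exact: mem_chart_at. Qed.

Lemma smooth_funP f : smooth_fun S f <-> forall x, fsmooth f x.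
Proof.
split=> [sf x|sf i].
  apply: (@open_smooth_at _ _ _ (img (chart_at S x))) (sf _); first exact: img_open.
  exact/mem_img/mem_chart_at.
apply/smoothP; first exact: img_open.
by move=> p /img_psi[dp pp]; rewrite -pp; apply/fsmoothP.
Qed.

Lemma fsmooth_near_eq f g x : (\near x, f x = g x) -> fsmooth f x -> fsmooth g x.
Proof.
move=> fg; apply: smooth_at_near_eq.
by have := near_psi (mem_chart_at S x) fg; apply: filterS => p.
Qed.

Lemma fsmooth_near f x : fsmooth f x -> \forall y \near x, fsmooth f y.
Proof.
move=> sf; have cx := mem_chart_at S x.
apply: filterS (filterI (near_dom cx) (near_phi cx (smooth_at_near sf))) => y [dy sy].
by apply/fsmoothP; first exact: dy.
Qed.

Lemma fsmooth_continuous f x : fsmooth f x -> {for x, continuous f}.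
Proof.
move=> sf; have cx := mem_chart_at S x.
have c : {for x, continuous ((f \o psi (chart_at S x)) \o phi (chart_at S x))}.
  apply: continuous_comp; first exact: phi_continuous.
  exact: smooth_at_continuous.
move: c; rewrite /prop_for /continuous_at /= phiK // => c.
apply: cvg_trans c; apply: near_eq_cvg.
by have := near_dom cx; apply: filterS => y dy /=; rewrite phiK.
Qed.

Lemma fsmooth_cst c x : fsmooth (fun=> c) x.
Proof. exact: smooth_at_cst. Qed.

Lemma fsmooth_add f g x : fsmooth f x -> fsmooth g x -> fsmooth (fun y => f y + g y) x.
Proof. exact: smooth_at_add. Qed.

Lemma fsmooth_mul f g x : fsmooth f x -> fsmooth g x -> fsmooth (fun y => f y * g y) x.
Proof. exact: smooth_at_mul. Qed.

Lemma fsmooth_opp f x : fsmooth f x -> fsmooth (fun y => - f y) x.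
Proof. exact: smooth_at_opp. Qed.

Lemma fsmooth_sum (I : Type) (r : seq I) (F : I -> M -> R) x :
  (forall a, fsmooth (F a) x) -> fsmooth (fun y => \sum_(a <- r) F a y) x.
Proof. exact: smooth_at_sum. Qed.

Lemma fsmooth_prod (I : Type) (r : seq I) (F : I -> M -> R) x :
  (forall a, fsmooth (F a) x) -> fsmooth (fun y => \prod_(a <- r) F a y) x.
Proof. exact: smooth_at_prod. Qed.

Lemma fsmooth_flat (a : nat) f x : fsmooth f x -> fsmooth (fun y => flat a (f y)) x.
Proof. exact: smooth_at_flat. Qed.

Lemma fsmooth_comp i x (h : E -> R) : dom i x -> smooth_at (phi i x) h ->
  fsmooth (fun y => h (phi i y)) x.
Proof.
move=> dx sh; apply/(fsmoothP _ dx).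
apply: (@smooth_at_near_eq _ _ _ _ h) => //.
by have := near_img dx; apply: filterS => p /img_psi[_ /= ->].
Qed.

Lemma fsmooth_jac j i x a b : dom i x -> dom j x -> fsmooth (fun y => jac j i y a b) x.
Proof.
move=> di dj.
pose h p := 'D_(e_ b) (tr j i) p a 0.
rewrite (_ : (fun _ => _) = fun y => h (phi i y)); last first.
  by apply/funext => y; rewrite mxE.
apply: fsmooth_comp => //.
by have /smooth_at_mxP := smooth_at_derive (e_ b) (smooth_at_tr di dj); exact.
Qed.

Definition vsmooth X x :=
  forall a, fsmooth (fun y => tcoord (chart_at S x) y (X y) a 0) x.

Lemma vsmooth_change j i x X : dom i x -> dom j x ->
  (forall a, fsmooth (fun y => tcoord i y (X y) a 0) x) ->
  forall a, fsmooth (fun y => tcoord j y (X y) a 0) x.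
Proof.
move=> di dj sX a.
apply: (@fsmooth_near_eq (fun y => \sum_b jac j i y a b * tcoord i y (X y) b 0)).
  apply: filterS (filterI (near_dom di) (near_dom dj)) => y [diy djy].
  by rewrite (tcoord_change _ diy djy) mxE.
by apply: fsmooth_sum => b; apply: fsmooth_mul => //; exact: fsmooth_jac.
Qed.

Lemma vsmoothP i x X : dom i x ->
  vsmooth X x <-> forall a, fsmooth (fun y => tcoord i y (X y) a 0) x.
Proof. by move=> dx; split; apply: vsmooth_change => //; exact: mem_chart_at. Qed.

Lemma smooth_vfieldP X : smooth_vfield S X <-> forall x, vsmooth X x.
Proof.
split=> [sX x a|sX i].
  have cx := mem_chart_at S x; apply/(fsmoothP _ cx).
  have := @open_smooth_at _ _ _ (img (chart_at S x)) _ _ (@img_open _ _ _ S (chart_at S x)) (mem_img cx)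
    (sX (chart_at S x)).
  by move/smooth_at_mxP => /(_ a 0).
apply/smoothP; first exact: img_open.
move=> p /img_psi[dp pp]; rewrite -pp; apply/smooth_at_mxP => a b; rewrite (ord1 b).
by have /(vsmoothP _ dp)/(_ a)/(fsmoothP _ dp) := sX (psi i p).
Qed.

Lemma vsmooth_near_eq X Y x : (\near x, X x = Y x) -> vsmooth X x -> vsmooth Y x.
Proof.
move=> XY sX a; apply: fsmooth_near_eq (sX a).
by apply: filterS XY => y ->.
Qed.

Lemma vsmooth_near X x : vsmooth X x -> \forall y \near x, vsmooth X y.
Proof.
move=> sX; have cx := mem_chart_at S x.
have : \forall y \near x, forall a, fsmooth (fun y => tcoord (chart_at S x) y (X y) a 0) y.
  by apply: near_all => a; apply: fsmooth_near; exact: sX.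
by apply: filterS2 (near_dom cx) => y dy sy; apply/vsmoothP; first exact: dy.
Qed.

Lemma vsmooth_scale f X x : fsmooth f x -> vsmooth X x -> vsmooth (fun y => f y *: X y) x.
Proof.
move=> sf sX a.
apply: (@fsmooth_near_eq (fun y => f y * tcoord (chart_at S x) y (X y) a 0)).
  have := near_dom (mem_chart_at S x); apply: filterS => y dy.
  by rewrite !(tcoordE _ dy) -scalemxAr !mxE.
exact: fsmooth_mul.
Qed.

Lemma vsmooth_add X Y x : vsmooth X x -> vsmooth Y x -> vsmooth (fun y => X y + Y y) x.
Proof.
move=> sX sY a.
apply: (@fsmooth_near_eq (fun y => tcoord (chart_at S x) y (X y) a 0 +
    tcoord (chart_at S x) y (Y y) a 0)).
  have := near_dom (mem_chart_at S x); apply: filterS => y dy.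
  by rewrite !(tcoordE _ dy) mulmxDr [in RHS]mxE.
exact: fsmooth_add.
Qed.

Lemma vsmooth_zero x : vsmooth (fun=> 0) x.
Proof.
move=> a; apply: (@fsmooth_near_eq (fun=> 0)); last exact: fsmooth_cst.
have := near_dom (mem_chart_at S x); apply: filterS => y dy.
by rewrite (tcoordE _ dy) mulmx0 mxE.
Qed.

Lemma vsmooth_tvec i x (F : M -> E) : dom i x ->
  (forall a, fsmooth (fun y => F y a 0) x) -> vsmooth (fun y => tvec i y (F y)) x.
Proof.
move=> dx sF; apply/(vsmoothP _ dx) => a; apply: fsmooth_near_eq (sF a).
by have := near_dom dx; apply: filterS => y dy; rewrite tvecK.
Qed.

Lemma lie_funE i x X f : dom i x -> fsmooth f x ->
  lie_fun S X f x = 'D_(tcoord i x (X x)) (f \o psi i) (phi i x).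
Proof.
move=> dx sf; rewrite /lie_fun; set c := chart_at S x.
have cx : dom c x := mem_chart_at S x.
have dt := is_derive_tr (X x) cx dx.
have pic : tr i c (phi c x) = phi i x by rewrite /tr /= phiK.
have sfi : differentiable (f \o psi i) (tr i c (phi c x)).
  by rewrite pic; apply: smooth_at_differentiable; apply/fsmoothP.
have [_] := derive_chain dt sfi; rewrite pic tcoordE // => <-.
apply: near_eq_derive; have := near_psi cx (near_dom dx).
by apply: filterS => p dip; rewrite /tr /= phiK.
Qed.

End Charts.

(** * Bump functions *)

Section Bump.
Context {R : realType} {n : nat} {M : topologicalType}.
Variable S : smooth_manifold R n M.
Local Notation E := 'cV[R]_n.+1.
Implicit Types (i : idx S) (x y : M) (f : M -> R) (X Y : M -> E).

Lemma cube_compact m (p : 'cV[R]_m) (r : R) :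
  compact [set q : 'cV[R]_m | forall k, `|q k 0 - p k 0| <= r].
Proof.
pose A := [set v : 'rV[R]_m | forall k, `[(p k 0 - r), (p k 0 + r)]%classic (v 0 k)].
have cA : compact A.
  exact: (rV_compact (A := fun k => `[(p k 0 - r), (p k 0 + r)]%classic)
    (fun k => @segment_compact _ _ _)).
have -> : [set q : 'cV[R]_m | forall k, `|q k 0 - p k 0| <= r] =
    (@trmx R 1 m) @` A.
  apply/seteqP; split=> [q Hq|_ [v Av <-] k] /=.
    exists q^T; last exact: trmxK.
    by move=> k; rewrite /= mxE in_itv /= -ler_distl.
  by have := Av k; rewrite /= in_itv /= mxE -ler_distl.
apply: continuous_compact => //; apply: continuous_subspaceT => v.
apply/continuous_mxP => a b.
rewrite (_ : (fun _ => _) = fun y : 'rV[R]_m => y b a).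
  exact: coord_continuous.
by apply/funext => y; rewrite mxE.
Qed.

Section EuclideanBump.
Variables (p : E) (r : R).
Hypothesis r0 : 0 < r.
Let r42 : r / 4 < r / 2.
Proof. by move: r0; lra. Qed.
Let s (q : E) := \sum_k (q k 0 - p k 0) ^+ 2.
Let bumpA q := flat 0 (r / 2 - s q).
Let bumpB q := flat 0 (s q - r / 4).

(** A plateau on [R^(n+1)] : [1] where the squared distance to [p] is at most
    [r / 4], and [0] where it is at least [r / 2]. *)
Definition plateau q := bumpA q / (bumpA q + bumpB q).

Let bump_den q : 0 < bumpA q + bumpB q.
Proof.
case: (ltP (s q) (r / 2)) => h.
  by rewrite ltr_pwDl ?flat_ge0 // flat_gt0 // subr_gt0.
rewrite addrC ltr_pwDl ?flat_ge0 // flat_gt0 // subr_gt0.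
exact: lt_le_trans h.
Qed.

Lemma plateau_ge0 q : 0 <= plateau q.
Proof. by rewrite divr_ge0 ?flat_ge0 // ltW // bump_den. Qed.

Lemma plateau_far (q : E) k : r <= (q k 0 - p k 0) ^+ 2 -> plateau q = 0.
Proof.
move=> h; rewrite /plateau /bumpA flat_le0 ?mul0r // subr_le0.
apply: (@le_trans _ _ r); first by move: (r0); lra.
apply: le_trans h _; rewrite /s (bigD1 k) //= lerDl sumr_ge0 // => l _.
exact: sqr_ge0.
Qed.

Let smooth_s q : smooth_at q s.
Proof.
apply: smooth_at_sum => k; apply: smooth_at_exp.
apply: smooth_at_add; last exact: smooth_at_cst.
by have /smooth_at_mxP := smooth_at_id q; exact.
Qed.

Lemma plateau_near : \forall q \near p, plateau q = 1.
Proof.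
have sp : s p = 0 by rewrite /s big1 // => k _; rewrite subrr expr0n.
have : \forall q \near p, s q < r / 4.
  have := smooth_at_continuous (smooth_s p).
  by rewrite /prop_for /continuous_at sp => /(cvgr_lt 0); apply; rewrite divr_gt0.
apply: filterS => q sq; rewrite /plateau /bumpB flat_le0 ?addr0; last by rewrite subr_le0 ltW.
by rewrite divff // gt_eqF // flat_gt0 // subr_gt0; exact: lt_trans sq r42.
Qed.

Lemma smooth_plateau q : smooth_at q plateau.
Proof.
have sA : smooth_at q bumpA.
  by apply: smooth_at_flat; apply: smooth_at_add; [exact: smooth_at_cst|exact: smooth_at_opp].
have sB : smooth_at q bumpB.
  by apply: smooth_at_flat; apply: smooth_at_add; [|exact: smooth_at_cst].
apply: smooth_at_mul => //; apply: smooth_at_inv; first exact: smooth_at_add.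
by rewrite gt_eqF // bump_den.
Qed.

End EuclideanBump.

(** A plateau in a chart, extended by [0].  The support is the image of a
    compact cube, which is closed because [M] is Hausdorff: without this the
    extension could fail to be smooth. *)
Lemma bump_function x (P : M -> Prop) : (\forall y \near x, P y) ->
  exists chi : M -> R, [/\ smooth_fun S chi, forall y, 0 <= chi y,
    \forall y \near x, chi y = 1 & forall y, P y \/ \forall z \near y, chi z = 0].
Proof.
move=> Px; pose c := chart_at S x; have cx : dom c x := mem_chart_at S x.
pose p := phi c x.
have [r r0 Hr] := near_radius (filterI (near_img cx) (near_psi cx Px)).
have r20 : 0 < r / 2 by rewrite divr_gt0.
pose C := [set q : E | forall k, `|q k 0 - p k 0| <= r / 2].
have CP q : C q -> img c q /\ P (psi c q).
  move=> Cq; apply: Hr; apply: (@le_lt_trans _ _ (r / 2)).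
    by apply: normc_leP => [|k]; [exact: ltW|rewrite !mxE; exact: Cq].
  by rewrite ltr_pdivrMr // ltr_pMr // ltr1n.
pose K := psi c @` C.
have closedK : closed K.
  apply: compact_closed; first exact: (mfd_hausdorff S).
  apply: continuous_compact; last exact: cube_compact.
  apply: continuous_in_subspaceT => q; rewrite inE => /CP[iq _].
  exact: psi_continuous.
pose h := plateau p ((r / 2) ^+ 2).
pose chi y := if `[< K y >] then h (phi c y) else 0.
have r2 : 0 < (r / 2) ^+ 2 by rewrite exprn_gt0.
have chiE z : dom c z -> chi z = h (phi c z).
  move=> dz; rewrite /chi; case: asboolP => // nK.
  have [k Hk] : exists k, ~ `|phi c z k 0 - p k 0| <= r / 2.
    apply/existsNP => H; apply: nK; exists (phi c z) => //; exact: phiK.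
  rewrite /h (@plateau_far _ _ _ _ k) //; move/negP : Hk; rewrite -ltNge => Hk.
  by rewrite -[X in _ <= X]real_normK ?num_real // lerXn2r ?nnegrE // ltW.
have chi0 z : ~ K z -> \forall y \near z, chi y = 0.
  move=> nK; have : \forall y \near z, ~ K y.
    by apply: open_nbhs_nbhs; split => //; exact: closed_openC.
  by apply: filterS => y; rewrite /chi => nKy; case: asboolP.
have KP z : K z -> dom c z /\ P z.
  by move=> [q /CP[iq Pq] <-]; split => //; have [] := img_psi iq.
exists chi; split.
- apply/smooth_funP => y; case: (pselect (K y)) => [/KP[dy _]|nK].
    apply: (@fsmooth_near_eq _ _ _ _ (fun y => h (phi c y))).
      by have := near_dom dy; apply: filterS => z dz; rewrite chiE.
    by apply: fsmooth_comp => //; exact: smooth_plateau.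
  apply: (@fsmooth_near_eq _ _ _ _ (fun=> 0)); last exact: fsmooth_cst.
  by apply: filterS (chi0 y nK) => z ->.
- by move=> y; rewrite /chi; case: asboolP => // _; exact: plateau_ge0.
- have := near_phi cx (plateau_near p r2); apply: filterS2 (near_dom cx) => y dy.
  by rewrite chiE.
- by move=> y; case: (pselect (K y)) => [/KP[]|/chi0]; [left|right].
Qed.

Lemma extend_function x f : fsmooth S f x ->
  exists2 g, smooth_fun S g & \forall y \near x, g y = f y.
Proof.
move=> /fsmooth_near sf; have [chi [schi _ chi1 chi0]] := bump_function sf.
exists (fun y => chi y * f y).
  apply/smooth_funP => y; have [sfy|zy] := chi0 y.
    by apply: fsmooth_mul => //; move/smooth_funP : schi; exact.
  apply: (@fsmooth_near_eq _ _ _ _ (fun=> 0)); last exact: fsmooth_cst.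
  by apply: filterS zy => z ->; rewrite mul0r.
by apply: filterS chi1 => y ->; rewrite mul1r.
Qed.

Lemma extend_field x X : vsmooth S X x ->
  exists2 Y, smooth_vfield S Y & \forall y \near x, Y y = X y.
Proof.
move=> /vsmooth_near sX; have [chi [schi _ chi1 chi0]] := bump_function sX.
exists (fun y => chi y *: X y).
  apply/smooth_vfieldP => y; have [sXy|zy] := chi0 y.
    by apply: vsmooth_scale => //; move/smooth_funP : schi; exact.
  apply: (@vsmooth_near_eq _ _ _ _ (fun=> 0)); last exact: vsmooth_zero.
  by apply: filterS zy => z ->; rewrite scale0r.
by apply: filterS chi1 => y ->; rewrite scale1r.
Qed.

(** A connection acts on global fields only; these are the test fields used to
    read off its action at a point. *)
Lemma extend_constant i x (u : E) : dom i x ->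
  exists2 X, smooth_vfield S X & \forall y \near x, X y = tvec i y u.
Proof.
move=> dx; apply: extend_field; apply: (vsmooth_tvec (F := fun=> u)) => // a.
exact: fsmooth_cst.
Qed.

End Bump.

(** * Christoffel symbols *)

Section Christoffel.
Context {R : realType} {n : nat} {M : topologicalType}.
Variables (S : smooth_manifold R n M) (D : connection S).
Local Notation E := 'cV[R]_n.+1.
Local Notation e_ k := (delta_mx k 0 : E).
Implicit Types (i : idx S) (x y : M) (f : M -> R) (X Y : M -> E).

(** Multiply both fields by a bump function equal to [1] near [x]: they become
    equal everywhere, and the Leibniz rule compares the derivatives at [x]. *)
Lemma nabla_localr X Y Y' x :
  smooth_vfield S X -> smooth_vfield S Y -> smooth_vfield S Y' ->
  (\forall y \near x, Y y = Y' y) -> D X Y x = D X Y' x.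
Proof.
move=> sX sY sY' YY'; have [chi [schi _ chi1 chi0]] := bump_function S YY'.
have E1 : (fun y => chi y *: Y y) = (fun y => chi y *: Y' y).
  apply/funext => y; have [->|/nbhs_singleton ->] := chi0 y => //.
  by rewrite !scale0r.
have := nablaZr D schi sX sY x; rewrite E1 (nablaZr D schi sX sY' x).
rewrite (nbhs_singleton YY') (nbhs_singleton chi1) !scale1r.
by move/addrI.
Qed.

Lemma nabla_locall X X' Y x :
  smooth_vfield S X -> smooth_vfield S X' -> smooth_vfield S Y ->
  (\forall y \near x, X y = X' y) -> D X Y x = D X' Y x.
Proof.
move=> sX sX' sY XX'; have [chi [schi _ chi1 chi0]] := bump_function S XX'.
have E1 : (fun y => chi y *: X y) = (fun y => chi y *: X' y).
  apply/funext => y; have [->|/nbhs_singleton ->] := chi0 y => //.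
  by rewrite !scale0r.
have := nablaZl D schi sX sY x; rewrite E1 (nablaZl D schi sX' sY x).
by rewrite (nbhs_singleton chi1) !scale1r.
Qed.

Lemma smooth_vfield_scale f X : smooth_fun S f -> smooth_vfield S X ->
  smooth_vfield S (fun y => f y *: X y).
Proof.
move=> /smooth_funP sf /smooth_vfieldP sX; apply/smooth_vfieldP => x.
exact: vsmooth_scale (sf x) (sX x).
Qed.

Lemma smooth_vfield_lincomb (I : Type) (r : seq I) (F : I -> M -> R) (Z : I -> M -> E) :
  (forall a, smooth_fun S (F a)) -> (forall a, smooth_vfield S (Z a)) ->
  smooth_vfield S (fun y => \sum_(a <- r) F a y *: Z a y).
Proof.
move=> sF sZ; apply/smooth_vfieldP => x; elim: r => [|a r IH].
  rewrite (_ : (fun _ => _) = fun=> 0); first exact: vsmooth_zero.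
  by apply/funext => y; rewrite big_nil.
rewrite (_ : (fun _ => _) = fun y => F a y *: Z a y + \sum_(a <- r) F a y *: Z a y).
  apply: vsmooth_add IH; apply: vsmooth_scale.
    by move/smooth_funP : (sF a) => /(_ x).
  by move/smooth_vfieldP : (sZ a) => /(_ x).
by apply/funext => y; rewrite big_cons.
Qed.

Lemma smooth_fun0 : smooth_fun S (fun=> 0 : R).
Proof. by apply/smooth_funP => x; exact: fsmooth_cst. Qed.

Lemma nabla0r X x : smooth_vfield S X -> D X (fun=> 0) x = 0.
Proof.
move=> sX; have s0 : smooth_vfield S (fun=> 0 : E).
  by apply/smooth_vfieldP => y; exact: vsmooth_zero.
have := nablaZr D smooth_fun0 sX s0 x.
by rewrite (_ : (fun y => 0 *: 0) = fun=> 0 : E) ?scale0r ?scaler0 ?addr0 //;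
  apply/funext => y; rewrite scaler0.
Qed.

Lemma nabla0l Y x : smooth_vfield S Y -> D (fun=> 0) Y x = 0.
Proof.
move=> sY; have s0 : smooth_vfield S (fun=> 0 : E).
  by apply/smooth_vfieldP => y; exact: vsmooth_zero.
have := nablaZl D smooth_fun0 s0 sY x.
by rewrite (_ : (fun y => 0 *: 0) = fun=> 0 : E) ?scale0r //;
  apply/funext => y; rewrite scaler0.
Qed.

Lemma nabla_suml (I : Type) (r : seq I) (F : I -> M -> R) (Z : I -> M -> E) Y x :
  (forall a, smooth_fun S (F a)) -> (forall a, smooth_vfield S (Z a)) ->
  smooth_vfield S Y ->
  D (fun y => \sum_(a <- r) F a y *: Z a y) Y x = \sum_(a <- r) F a x *: D (Z a) Y x.
Proof.
move=> sF sZ sY; elim: r => [|a r IH].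
  rewrite (_ : (fun _ => _) = fun=> 0); first by rewrite big_nil nabla0l.
  by apply/funext => y; rewrite big_nil.
rewrite (_ : (fun _ => _) = fun y => F a y *: Z a y + \sum_(a <- r) F a y *: Z a y).
  by rewrite big_cons (nablaDl D (smooth_vfield_scale (sF a) (sZ a))
    (smooth_vfield_lincomb r sF sZ) sY) IH (nablaZl D (sF a) (sZ a) sY).
by apply/funext => y; rewrite big_cons.
Qed.

Lemma nabla_sumr (I : Type) (r : seq I) (F : I -> M -> R) (Z : I -> M -> E) X x :
  (forall a, smooth_fun S (F a)) -> (forall a, smooth_vfield S (Z a)) ->
  smooth_vfield S X ->
  D X (fun y => \sum_(a <- r) F a y *: Z a y) x =
  \sum_(a <- r) (lie_fun S X (F a) x *: Z a x + F a x *: D X (Z a) x).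
Proof.
move=> sF sZ sX; elim: r => [|a r IH].
  rewrite (_ : (fun _ => _) = fun=> 0); first by rewrite big_nil nabla0r.
  by apply/funext => y; rewrite big_nil.
rewrite (_ : (fun _ => _) = fun y => F a y *: Z a y + \sum_(a <- r) F a y *: Z a y).
  by rewrite big_cons (nablaDr D sX (smooth_vfield_scale (sF a) (sZ a))
    (smooth_vfield_lincomb r sF sZ)) IH (nablaZr D (sF a) sX (sZ a)).
by apply/funext => y; rewrite big_cons.
Qed.

End Christoffel.

Section ChristoffelMatrix.
Context {R : realType} {n : nat} {M : topologicalType}.
Variables (S : smooth_manifold R n M) (D : connection S).
Local Notation E := 'cV[R]_n.+1.
Local Notation e_ k := (delta_mx k 0 : E).
Implicit Types (i j : idx S) (x y : M) (f : M -> R) (X Y : M -> E) (u v w : E).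

Lemma cV_sum_delta (v : E) : v = \sum_k v k 0 *: e_ k.
Proof.
apply/matrixP => a b; rewrite (ord1 b) summxE (bigD1 a) //= big1.
  by rewrite !mxE !eqxx mulr1 addr0.
by move=> k ka; rewrite !mxE eq_sym (negbTE ka) mulr0.
Qed.

Lemma tcoordD i x u v : dom i x -> tcoord i x (u + v) = tcoord i x u + tcoord i x v.
Proof. by move=> dx; rewrite !tcoordE // mulmxDr. Qed.

Lemma tcoordZ i x (a : R) v : dom i x -> tcoord i x (a *: v) = a *: tcoord i x v.
Proof. by move=> dx; rewrite !tcoordE // scalemxAr. Qed.

Lemma tcoord_sum i x (I : Type) (r : seq I) (F : I -> E) : dom i x ->
  tcoord i x (\sum_(a <- r) F a) = \sum_(a <- r) tcoord i x (F a).
Proof.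
move=> dx; rewrite tcoordE // mulmx_sumr.
by apply: eq_bigr => a _; rewrite tcoordE.
Qed.

Lemma vsmooth_coord i x X : dom i x -> vsmooth S X x ->
  smooth_at (phi i x) (fun q => tcoord i (psi i q) (X (psi i q))).
Proof.
move=> dx /(vsmoothP _ dx) sX; apply/smooth_at_mxP => a b; rewrite (ord1 b).
by move/(fsmoothP _ dx) : (sX a).
Qed.

Lemma frame_exists : exists F : idx S -> M -> 'I_n.+1 -> M -> E,
  forall i x k, dom i x -> smooth_vfield S (F i x k) /\
    \forall y \near x, F i x k y = tvec i y (e_ k).
Proof.
have H (a : idx S * M * 'I_n.+1) : exists X, dom a.1.1 a.1.2 ->
    smooth_vfield S X /\ \forall y \near a.1.2, X y = tvec a.1.1 y (e_ a.2).
  case: (pselect (dom a.1.1 a.1.2)) => [dx|ndx]; last by exists (fun=> 0).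
  by have [X sX EX] := extend_constant (e_ a.2) dx; exists X.
have [F FP] := choice H.
by exists (fun i x k => F (i, x, k)) => i x k dx; exact: (FP (i, x, k)).
Qed.

(** The coordinate fields of the chart [i] near [x], extended to all of [M] so
    that the connection can be applied to them. *)
Definition frame := sval (cid frame_exists).

Lemma smooth_frame i x k : dom i x -> smooth_vfield S (frame i x k).
Proof. by move=> dx; have [] := svalP (cid frame_exists) i x k dx. Qed.

Lemma frameE i x k : dom i x -> \forall y \near x, frame i x k y = tvec i y (e_ k).
Proof. by move=> dx; have [] := svalP (cid frame_exists) i x k dx. Qed.

(** The matrix of [v |-> Gamma(u, v)] at [x] in the chart [i]. *)
Definition Gam i x u : 'M[R]_n.+1 := \matrix_(a, k)
  \sum_l u l 0 * tcoord i x (D (frame i x l) (frame i x k) x) a 0.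

Lemma GamZ i x (a : R) u : Gam i x (a *: u) = a *: Gam i x u.
Proof.
apply/matrixP => b k; rewrite !mxE mulr_sumr; apply: eq_bigr => l _.
by rewrite mxE mulrA.
Qed.

Lemma Gam_mul i x u v : Gam i x u *m v =
  \sum_k \sum_l (v k 0 * u l 0) *: tcoord i x (D (frame i x l) (frame i x k) x).
Proof.
apply/matrixP => a b; rewrite (ord1 b) mxE summxE; apply: eq_bigr => k _.
rewrite mxE mulr_suml summxE; apply: eq_bigr => l _; rewrite mxE.
by rewrite mulrC mulrA.
Qed.

(** The coefficients are extended to all of [M], as the Leibniz rule is
    available for globally smooth functions only. *)
Lemma frame_decomposition i x X : dom i x -> smooth_vfield S X ->
  exists F : 'I_n.+1 -> M -> R, [/\ forall k, smooth_fun S (F k),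
    forall k, \forall y \near x, F k y = tcoord i y (X y) k 0 &
    \forall y \near x, X y = \sum_k F k y *: frame i x k y].
Proof.
move=> dx sX; have /(vsmoothP _ dx) sXx := (smooth_vfieldP S X).1 sX x.
have H k : exists g, smooth_fun S g /\
    \forall y \near x, g y = tcoord i y (X y) k 0.
  by have [g sg Eg] := extend_function (sXx k); exists g.
have [F FP] := choice H; exists F; split.
- by move=> k; case: (FP k).
- by move=> k; case: (FP k).
have H1 : \forall y \near x, forall k, F k y = tcoord i y (X y) k 0.
  by apply: near_all => k; case: (FP k).
have H2 : \forall y \near x, forall k, frame i x k y = tvec i y (e_ k).
  by apply: near_all => k; exact: frameE.
apply: filterS (filterI (near_dom dx) (filterI H1 H2)) => y [dy [E1 E2]].
rewrite -[LHS](tcoordK _ dy) [in LHS](cV_sum_delta (tcoord i y (X y))).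
rewrite tvecE // mulmx_sumr; apply: eq_bigr => k _.
by rewrite E1 E2 -scalemxAr tvecE.
Qed.

(** By locality [Y] may be replaced by its expansion in the frame, to which the
    Leibniz rule applies; tensoriality in [X] is proved in the same way. *)
Theorem nablaE i x X Y : dom i x -> smooth_vfield S X -> smooth_vfield S Y ->
  tcoord i x (D X Y x) =
  'D_(tcoord i x (X x)) (fun q => tcoord i (psi i q) (Y (psi i q))) (phi i x) +
  Gam i x (tcoord i x (X x)) *m tcoord i x (Y x).
Proof.
move=> dx sX sY.
have [F [sF EF XF]] := frame_decomposition dx sX.
have [G [sG EG YG]] := frame_decomposition dx sY.
have sfr k := smooth_frame k dx.
rewrite (nabla_localr D sX sY (smooth_vfield_lincomb _ sG sfr) YG).
rewrite (nabla_sumr D _ _ sG sfr sX) tcoord_sum // Gam_mul.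
rewrite [X in _ = X + _]cV_sum_delta -big_split /=; apply: eq_bigr => k _.
rewrite tcoordD // !tcoordZ //; congr (_ *: _ + _).
- have sGk := (smooth_funP S (G k)).1 (sG k) x.
  rewrite (lie_funE _ dx sGk) -derive_mxE.
    by apply: near_eq_derive; exact: (near_psi dx (EG k)).
  apply: smooth_at_derivable; apply: vsmooth_coord => //.
  by move/smooth_vfieldP : sY; exact.
- by rewrite (nbhs_singleton (frameE k dx)) tvecK.
- rewrite (nabla_locall D sX (smooth_vfield_lincomb _ sF sfr) (sfr k) XF).
  rewrite (nabla_suml D _ _ sF sfr (sfr k)) tcoord_sum // scaler_sumr.
  apply: eq_bigr => l _; rewrite tcoordZ // scalerA.
  by rewrite (nbhs_singleton (EG k)) (nbhs_singleton (EF l)).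
Qed.

Lemma fsmooth_Gam i x u a b : dom i x -> fsmooth S (fun y => Gam i y u a b) x.
Proof.
move=> dx.
apply: (@fsmooth_near_eq _ _ _ _ (fun y => \sum_l u l 0 *
    tcoord i y (D (frame i x l) (frame i x b) y) a 0)).
  have H : \forall y \near x, forall k, \forall z \near y, frame i x k z = tvec i z (e_ k).
    by apply: near_all => k; apply: nbhs_interior; exact: frameE.
  apply: filterS (filterI (near_dom dx) H) => y [dy Hy].
  rewrite mxE; apply: eq_bigr => l _; congr (_ * tcoord i y _ a 0).
  have EF k : \forall z \near y, frame i x k z = frame i y k z.
    by apply: filterS (filterI (Hy k) (frameE k dy)) => z [-> ->].
  rewrite (nabla_locall D (smooth_frame l dx) (smooth_frame l dy) (smooth_frame b dx) (EF l)).
  exact: (nabla_localr D (smooth_frame l dy) (smooth_frame b dx) (smooth_frame b dy) (EF b)).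
apply: fsmooth_sum => l; apply: fsmooth_mul; first exact: fsmooth_cst.
have /smooth_vfieldP := nabla_smooth D (smooth_frame l dx) (smooth_frame b dx).
by move=> /(_ x) /(vsmoothP _ dx).
Qed.

Lemma christoffelE i x u v w : dom i x ->
  christoffel D i x u v w <-> w = Gam i x u *m v.
Proof.
have const0 Y y z : dom i y -> (\forall z \near y, tcoord i z (Y z) = v) ->
    'D_z (fun q => tcoord i (psi i q) (Y (psi i q))) (phi i y) = 0.
  move=> dy Yv; rewrite (@near_eq_derive _ _ _ _ (cst v)); last exact: (near_psi dy Yv).
  exact: derive_cst.
move=> dx; split=> [[X [Y [sX sY Xu Yv <-]]]|->].
  by rewrite nablaE // (const0 Y) // add0r Xu (nbhs_singleton Yv).
have [X sX EX] := extend_constant u dx; have [Y sY EY] := extend_constant v dx.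
have Yv : \forall y \near x, tcoord i y (Y y) = v.
  by apply: filterS (filterI (near_dom dx) EY) => y [dy ->]; rewrite tvecK.
have Xu : tcoord i x (X x) = u by rewrite (nbhs_singleton EX) tvecK.
exists X, Y; split=> //.
by rewrite nablaE // (const0 Y) // add0r Xu (nbhs_singleton Yv).
Qed.

End ChristoffelMatrix.

Section Curves.
Context {R : realType} {n : nat} {M : topologicalType}.
Variables (S : smooth_manifold R n M) (D : connection S).
Local Notation E := 'cV[R]_n.+1.
Implicit Types (i j : idx S) (x y : M) (f : M -> R) (X Y : M -> E) (u v w : E).
Implicit Types (t s : R) (gamma : R -> M) (V : R -> E).

Lemma near_curve gamma t (P : M -> Prop) : {for t, continuous gamma} ->
  (\forall y \near gamma t, P y) -> \forall s \near t, P (gamma s).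
Proof. by move=> cg; exact: cg. Qed.

Lemma is_derive_curve_mx i gamma t a b (F : M -> 'M[R]_(a, b)) c :
  {for t, continuous gamma} -> dom i (gamma t) ->
  is_derive t 1 (phi i \o gamma) c ->
  smooth_at (phi i (gamma t)) (F \o psi i) ->
  is_derive t 1 (F \o gamma) ('D_c (F \o psi i) (phi i (gamma t))).
Proof.
move=> cg dx dc sF.
apply: near_eq_is_derive (is_derive_comp_mx dc sF).
by apply: filterS (near_curve cg (near_dom dx)) => s ds /=; rewrite phiK.
Qed.

Lemma is_derive_curve_change i j gamma t c :
  {for t, continuous gamma} -> dom i (gamma t) -> dom j (gamma t) ->
  is_derive t 1 (phi i \o gamma) c ->
  is_derive t 1 (phi j \o gamma) (jac j i (gamma t) *m c).
Proof.
move=> cg di dj dc; have [_ <-] := is_derive_tr c di dj.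
exact: (is_derive_curve_mx (F := phi j) cg di dc (smooth_at_tr di dj)).
Qed.

(** Let [Y] be any smooth field with [Y (gamma t) = V t].  In every chart, the
    equation of parallel transport says that the derivative of [V - Y] at [t] is
    [- nabla_(gamma') Y]; as [V - Y] vanishes at [t], that derivative is a
    tangent vector, and the equation does not depend on the chart. *)
Lemma parallel_change i j gamma V t c :
  {for t, continuous gamma} -> dom i (gamma t) -> dom j (gamma t) ->
  is_derive t 1 (phi i \o gamma) c ->
  is_derive t 1 (fun s => tcoord i (gamma s) (V s))
    (- (Gam D i (gamma t) c *m tcoord i (gamma t) (V t))) ->
  is_derive t 1 (fun s => tcoord j (gamma s) (V s))
    (- (Gam D j (gamma t) (jac j i (gamma t) *m c) *m tcoord j (gamma t) (V t))).
Proof.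
move=> cg di dj dc dV; set x := gamma t.
pose vj := tcoord j x (V t).
have [X sX EX] := extend_constant c di; have [Y sY EY] := extend_constant vj dj.
have Xi : tcoord i x (X x) = c by rewrite (nbhs_singleton EX) tvecK.
have Xj : tcoord j x (X x) = jac j i x *m c by rewrite (tcoord_change _ di dj) Xi.
have Yj : \forall y \near x, tcoord j y (Y y) = vj.
  by apply: filterS (filterI (near_dom dj) EY) => y [dy ->]; rewrite tvecK.
have YV : Y x = V t.
  by rewrite -(tcoordK (Y x) dj) (nbhs_singleton Yj) /vj tcoordK.
pose Yi := fun y => tcoord i y (Y y).
have sYi : smooth_at (phi i x) (Yi \o psi i).
  by apply: vsmooth_coord => //; move/smooth_vfieldP : sY; exact.
have dYi := is_derive_curve_mx cg di dc sYi.
have NE : tcoord i x (D X Y x) =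
    'D_c (Yi \o psi i) (phi i x) + Gam D i x c *m tcoord i x (V t).
  by rewrite (nablaE D di sX sY) Xi YV.
have NEj : tcoord j x (D X Y x) = Gam D j x (jac j i x *m c) *m vj.
  have /christoffelE <- // : christoffel D j x (jac j i x *m c) vj (tcoord j x (D X Y x)).
  by exists X, Y.
pose z s := tcoord i (gamma s) (V s) - Yi (gamma s).
have dz : is_derive t 1 z (- tcoord i x (D X Y x)).
  by apply: is_derive_eq (is_deriveB dV dYi) _; rewrite NE opprD addrC.
have dJ : exists J', is_derive t 1 (fun s => jac j i (gamma s)) J'.
  eexists; apply: (is_derive_curve_mx (F := fun y => jac j i y) cg di dc).
  by apply/smooth_at_mxP => a b; have /(fsmoothP _ di) := fsmooth_jac a b di dj.
have [J' dJ'] := dJ.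
have := is_derive_mulmx dJ' dz.
have z0 : z t = 0 by rewrite /z /Yi -/x YV subrr.
rewrite z0 mulmx0 addr0 mulmxN -(tcoord_change _ di dj) NEj => dJz.
have d1 : is_derive t 1 (fun s => jac j i (gamma s) *m z s + vj)
    (- (Gam D j x (jac j i x *m c) *m vj)).
  by have := is_deriveD dJz (is_derive_cst vj t 1); rewrite addr0.
apply: near_eq_is_derive d1.
have H : \forall y \near x, dom i y /\ dom j y /\ tcoord j y (Y y) = vj.
  exact: filterI (near_dom di) (filterI (near_dom dj) Yj).
apply: filterS (near_curve cg H) => s [dis [djs Ys]].
by rewrite /z mulmxBr -!(tcoord_change _ dis djs) Ys subrK.
Qed.

End Curves.

(** * Parallel transport along short segments *)

Section Segments.
Context {R : realType} {n : nat} {M : topologicalType}.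
Variables (S : smooth_manifold R n M) (D : connection S).
Local Notation E := 'cV[R]_n.+1.
Local Notation e_ k := (delta_mx k 0 : E).
Implicit Types (i j : idx S) (x y : M) (p q u v w : E) (t s r : R).

Lemma Gam_delta i x u a b :
  Gam D i x u a b = \sum_l u l 0 * Gam D i x (e_ l) a b.
Proof.
rewrite mxE; apply: eq_bigr => l _; rewrite mxE (bigD1 l) //= big1.
  by rewrite !mxE !eqxx mul1r addr0.
by move=> k kl; rewrite mxE (negbTE kl) mul0r.
Qed.

Lemma Gam_bounded i x : dom i x -> exists2 K : R, 0 < K &
  \forall q \near phi i x, img i q /\
    forall lab : 'I_n.+1 * 'I_n.+1 * 'I_n.+1,
      `|Gam D i (psi i q) (e_ lab.1.1) lab.1.2 lab.2| <= K.
Proof.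
move=> dx; pose f (l a b : 'I_n.+1) q := Gam D i (psi i q) (e_ l) a b.
pose K0 := \sum_l \sum_a \sum_b `|f l a b (phi i x)| + 1.
have cf (ab : 'I_n.+1 * 'I_n.+1 * 'I_n.+1) :
    \forall q \near phi i x, `|f ab.1.1 ab.1.2 ab.2 q| <= K0.
  case: ab => [[l a] b] /=.
  have sf : smooth_at (phi i x) (f l a b).
    by have /(fsmoothP _ dx) := fsmooth_Gam D (e_ l) a b dx.
  have /continuous_atP /(_ 1 ltr01) := smooth_at_continuous sf.
  apply: filterS => q fq.
  rewrite -[f l a b q](subrK (f l a b (phi i x))).
  apply: le_trans (ler_normD _ _) _; rewrite addrC /K0; apply: lerD fq.
  rewrite (bigD1 l) //= (bigD1 a) //= (bigD1 b) //= -!addrA lerDl.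
  by rewrite !addr_ge0 // ?sumr_ge0 // => *; rewrite ?sumr_ge0 // => *; rewrite ?sumr_ge0.
have K00 : 0 < K0.
  rewrite ltr_wpDl // sumr_ge0 // => l _; rewrite sumr_ge0 // => a _.
  by rewrite sumr_ge0.
by exists K0 => //; exact: (filterI (near_img dx) (near_all cf)).
Qed.

(** The condition on [K] is the smallness required by [linear_ode] on
    [|t| < 2]; the bound [3] leaves room around that interval. *)
Definition short i p u := exists2 K : R, 0 <= K &
  4 * (n.+1%:R * K) <= 1 /\ forall t, `|t| < 3 ->
    img i (p + t *: u) /\ forall a b, `|Gam D i (psi i (p + t *: u)) u a b| <= K.

Lemma near_short i x : dom i x -> exists2 r, 0 < r &
  forall p u, `|p - phi i x| < r -> `|u| < 2 * r -> short i p u.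
Proof.
move=> dx; have [K0 K00 /near_radius[r0 r00 Hr]] := Gam_bounded dx.
pose L := n.+1%:R * K0; have L0 : 0 < L by rewrite mulr_gt0.
(* The segment stays within [r + 3 * (2 * r) = 7 * r] of [phi i x]. *)
pose r := Num.min (r0 / 7) (8 * (n.+1%:R * L))^-1.
have rpos : 0 < r by rewrite lt_min divr_gt0 //= invr_gt0 !mulr_gt0.
exists r => // p u pr ur; exists (L * (2 * r)); first by rewrite !mulr_ge0 // ltW.
split.
  have : r <= (8 * (n.+1%:R * L))^-1 by rewrite ge_min lexx orbT.
  rewrite -[X in _ <= X]div1r ler_pdivlMr ?mulr_gt0 // => h.
  by rewrite (_ : 4 * _ = r * (8 * (n.+1%:R * L))) //; ring.
move=> t t3.
have /Hr[ip fp] : `|p + t *: u - phi i x| < r0.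
  rewrite addrAC; apply: le_lt_trans (ler_normD _ _) _; rewrite normrZ.
  have tu : `|t| * `|u| <= 3 * (2 * r) by rewrite ler_pM // ltW.
  have : r * 7 <= r0 by rewrite -ler_pdivlMr // ge_min lexx.
  by move: pr tu; lra.
split => // a b; rewrite Gam_delta; apply: le_trans (ler_norm_sum _ _ _) _.
apply: (@le_trans _ _ (\sum_(l < n.+1) (2 * r) * K0)).
  apply: ler_sum => l _; rewrite normrM ler_pM //.
    by apply: le_trans (normc_le u l) _; exact: ltW.
  exact: (fp (l, a, b)).
rewrite sumr_const card_ord -[_ *+ n.+1]mulr_natl /L le_eqVlt; apply/orP; left.
by apply/eqP; ring.
Qed.

Lemma smooth_at_affine (p w : E) s : smooth_at s (fun s : R => p + s *: w).
Proof.
apply/smooth_at_mxP => a b.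
rewrite (_ : (fun _ => _) = fun s => p a b + s * w a b); last first.
  by apply/funext => s'; rewrite !mxE.
apply: smooth_at_add; first exact: smooth_at_cst.
by apply: smooth_at_mul; [exact: smooth_at_id|exact: smooth_at_cst].
Qed.

Lemma is_derive_affine (p w : E) s : is_derive s 1 (fun s : R => p + s *: w) w.
Proof.
apply/is_derive_mxP => a b.
rewrite (_ : (fun _ => _) = cst (p a b) + (w a b \*: id)); last first.
  by apply/funext => s'; rewrite !mxE /GRing.scale /= mulrC.
apply: is_derive_eq (is_deriveD (is_derive_cst _ _ _) (is_deriveZ _ (is_derive_id s 1))) _.
by rewrite add0r /GRing.scale /= mulr1.
Qed.

Lemma is_derive_rescale d (X : R -> 'M[R]_d) (tau s : R) X' :
  is_derive (s * tau) 1 X X' -> is_derive s 1 (fun s => X (s * tau)) (tau *: X').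
Proof.
move=> /is_derive_mxP dX; apply/is_derive_mxP => a b.
have dl : is_derive s 1 (fun s : R => s * tau) tau.
  apply: is_derive_eq (is_deriveM (is_derive_id s 1) (is_derive_cst tau s 1)) _.
  by rewrite /GRing.scale /= mulr0 add0r mulr1.
have := @is_derive1_comp R (fun s => X s a b) (fun s => s * tau) s _ _ (dX a b) dl.
by rewrite mxE mulrC.
Qed.

(** In the chart, parallel transport along a segment is the resolvent [X] of a
    linear equation; the inverse [Y] is recorded since it carries forms along.  The
    transport to time [tau] is taken along the segment reparametrized by the
    unit interval; [tau] may be negative, so that two-sided derivatives at [p] can be
    computed from it. *)
Theorem segment_transport i p u : short i p u ->
  exists X Y : R -> 'M[R]_n.+1, [/\ X 0 = 1%:M, Y 0 = 1%:M,
    forall t, `|t| < 2 ->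
      [/\ is_derive t 1 X (- (Gam D i (psi i (p + t *: u)) u *m X t)),
          is_derive t 1 Y (Y t *m Gam D i (psi i (p + t *: u)) u) &
          Y t *m X t = 1%:M] &
    forall tau, `|tau| <= 1 ->
      let y := psi i (p + tau *: u) in
      transport D (psi i p) y
        (jac (chart_at S y) i y *m X tau *m jac i (chart_at S (psi i p)) (psi i p))].
Proof.
move=> [K K0 [small inK]].
pose N t := - Gam D i (psi i (p + t *: u)) u.
have cN t : `|t| < 3 -> {for t, continuous N}.
  move=> t3; have [/img_psi[dy py] _] := inK t t3.
  apply/continuous_mxP => a b.
  rewrite (_ : (fun _ => _) = - ((fun q => Gam D i (psi i q) u a b) \o
      (fun t : R => p + t *: u))); last by apply/funext => s; rewrite /N mxE.
  apply: continuousN; apply: continuous_comp.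
    by apply: smooth_at_continuous; exact: smooth_at_affine.
  apply: smooth_at_continuous; rewrite -py.
  by have /(fsmoothP _ dy) := fsmooth_Gam D u a b dy.
have NK t : `|t| < 3 -> forall a b, `|N t a b| <= K.
  by move=> t3 a b; rewrite mxE normrN; have [_] := inK t t3; exact.
have K2 : 2 * (n.+1%:R * K) <= 2^-1 by move: small; lra.
have h23 : (2 : R) < 3 by rewrite ltr_nat.
have [X [Y [X0 Y0 XY]]] := linear_ode (ltr0n _ 2) h23 K0 cN NK K2.
exists X, Y; split => //.
  move=> t t2; have [dX dY YX] := XY t t2; split => //.
    by apply: is_derive_eq dX _; rewrite /N mulNmx.
  by apply: is_derive_eq dY _; rewrite /N mulmxN opprK.
move=> tau tau1 y.
pose gamma s := psi i (p + s *: (tau *: u)).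
have st s : `|s| < 2 -> `|s * tau| < 2.
  by move=> s2; rewrite normrM; apply: le_lt_trans s2; rewrite ler_piMr.
have gE s : gamma s = psi i (p + (s * tau) *: u) by rewrite /gamma scalerA.
have gin s : `|s| < 2 -> dom i (gamma s) /\ phi i (gamma s) = p + s *: (tau *: u).
  move=> s2; rewrite /gamma scalerA; apply: img_psi; apply: (inK _ _).1.
  by apply: lt_trans h23; exact: st.
have near2 s : `|s| < 2 -> \forall s' \near s, `|s'| < 2.
  move=> s2; have : {for s, continuous (fun s : R => `|s|)} by exact: norm_continuous.
  by move=> /(cvgr_lt `|s|); exact.
have cg s : `|s| < 2 -> {for s, continuous gamma}.
  move=> s2; have [dg pg] := gin s s2; apply: continuous_comp.
    by apply: smooth_at_continuous; exact: smooth_at_affine.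
  by rewrite -pg; apply: psi_continuous; exact: mem_img.
have dphi s : `|s| < 2 -> is_derive s 1 (phi i \o gamma) (tau *: u).
  move=> s2; apply: near_eq_is_derive (is_derive_affine p (tau *: u) s).
  by apply: filterS (near2 s s2) => s' s'2; have [_ /= ->] := gin s' s'2.
have in2 s : `]-2, 2[%classic s -> `|s| < 2.
  by rewrite /= in_itv /= ltr_norml.
have sg : smooth_curve S `]-2, 2[ gamma.
  split=> [s /in2 s2|j k]; first exact: cg.
  apply/Ck_pointwise => s [/in2 s2 djs]; have [dg pg] := gin s s2.
  have sj : smooth_at s (tr j i \o (fun s => p + s *: (tau *: u))).
    apply: smooth_at_comp_mx; first exact: smooth_at_affine.
    by rewrite -pg; exact: smooth_at_tr.
  by have := nbhs_singleton sj; exact.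
have g0 : gamma 0 = psi i p by rewrite /gamma scale0r addr0.
have g1 : gamma 1 = y by rewrite /gamma scale1r.
have h1 : (-2 : R) < 0 by rewrite oppr_lt0.
have h2 : (1 : R) < 2 by rewrite ltr1n.
rewrite -g0 -g1; apply: (transport_smooth h1 h2 sg) => v.
pose v0 := tcoord i (gamma 0) v.
pose V s := tvec i (gamma s) (X (s * tau) *m v0).
have d0 : dom i (gamma 0) by have [] := gin 0 _; rewrite ?normr0.
have d1 : dom i (gamma 1) by have [] := gin 1 _; rewrite ?normr1.
exists V; split; last 2 first.
- by rewrite /V mul0r X0 mul1mx tcoordK.
- by rewrite /V /v0 mul1r tvecE // tcoordE // !mulmxA.
move=> s j /in2 s2 djs; have [dg pg] := gin s s2.
have dV : is_derive s 1 (fun s => tcoord i (gamma s) (V s))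
    (- (Gam D i (gamma s) (tau *: u) *m tcoord i (gamma s) (V s))).
  have [dX _ _] := XY _ (st s s2).
  have := is_derive_mulmx (is_derive_rescale dX) (is_derive_cst v0 s 1).
  rewrite mulmx0 add0r => dXv.
  have E1 : \forall s' \near s, X (s' * tau) *m v0 = tcoord i (gamma s') (V s').
    by apply: filterS (near2 s s2) => s' s'2; rewrite /V tvecK //; have [] := gin s' s'2.
  rewrite -(nbhs_singleton E1) GamZ gE.
  apply: is_derive_eq (near_eq_is_derive E1 dXv) _.
  by rewrite /N mulNmx scalerN mulNmx -scalemxAl -scalemxAl mulmxA.
have dphij := is_derive_curve_change (cg s s2) dg djs (dphi s s2).
exists (Gam D j (gamma s) (jac j i (gamma s) *m (tau *: u)) *m tcoord j (gamma s) (V s)).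
  by apply/christoffelE => //; case: dphij => _ ->.
exact: parallel_change (cg s s2) dg djs (dphi s s2) dV.
Qed.

Lemma near_transport x : exists2 U, nbhs x U &
  forall y z, U y -> U z -> exists A, transport D y z A.
Proof.
have cx := mem_chart_at S x; set i := chart_at S x in cx.
have [r r0 Hr] := near_short cx.
have nU : \forall q \near phi i x, `|q - phi i x| < r by exact: (radius_near r0).
exists [set y | dom i y /\ `|phi i y - phi i x| < r].
  exact: filterI (near_dom cx) (near_phi cx nU).
move=> y z [dy yr] [dz zr].
have zy : `|phi i z - phi i y| < 2 * r.
  rewrite -[phi i z - _](subrKA (phi i x)); apply: le_lt_trans (ler_normD _ _) _.
  by rewrite [`|phi i x - _|]distrC mulr_natl mulr2n ltrD.
have [X [Y [_ _ _ T]]] := segment_transport (Hr _ _ yr zy).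
have := T 1; rewrite normr1 lexx => /(_ isT); rewrite scale1r [phi i y + _]addrC subrK.
rewrite !phiK // => T1; by eexists; exact: T1.
Qed.

End Segments.

(** * Conformal maps of a degenerate form *)

Section ConformalGroup.
Context {R : realType} {n : nat}.
Implicit Types (p : nat).

Definition Jpq p : 'M[R]_(1 + n) := block_mx 0 0 0 (Ipq p).

Lemma trmx_Ipq p : (Ipq p : 'M[R]_n)^T = Ipq p.
Proof. exact: tr_diag_mx. Qed.

Lemma Ipq_sqr p : (Ipq p : 'M[R]_n) *m Ipq p = 1%:M.
Proof.
rewrite /Ipq mulmx_diag -diag_const_mx; congr diag_mx.
by apply/rowP => i; rewrite !mxE; case: ifP => _; rewrite ?mulr1 // mulrNN mulr1.
Qed.

Lemma Ipq_unit p : (Ipq p : 'M[R]_n) \in unitmx.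
Proof. by have [] := mulmx1_unit (Ipq_sqr p). Qed.

Lemma trmx_Jpq p : (Jpq p)^T = Jpq p.
Proof. by rewrite /Jpq tr_block_mx !trmx0 trmx_Ipq. Qed.

Lemma rank_Jpq p : \rank (Jpq p) = n.
Proof. by rewrite /Jpq rank_diag_block_mx mxrank0 mxrank_unit // Ipq_unit. Qed.

(** The factor [lambda] may be negative, but the form is scaled by its
    square. *)
Lemma weyl_group_conformal p (A : 'M[R]_(1 + n)) : weyl_group p A ->
  A \in unitmx /\ exists2 c : R, 0 < c & A^T *m Jpq p *m A = c *: Jpq p.
Proof.
move=> [al [la [B [C [al0 la0 HC ->]]]]].
have uC : C \in unitmx.
  have H : (Ipq p *m C^T *m Ipq p) *m C = 1%:M.
    by rewrite -!mulmxA [C^T *m _]mulmxA HC Ipq_sqr.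
  by have [] := mulmx1_unit H.
split.
  rewrite unitmxE det_ublock det_scalar1 detZ unitrM unitfE al0 /=.
  by rewrite unitrM unitrX ?unitfE //= -unitfE -unitmxE.
exists (la ^+ 2); first by rewrite exprn_even_gt0.
rewrite tr_block_mx trmx0 linearZ /= /Jpq !mulmx_block.
rewrite !(mul0mx, mulmx0, addr0, add0r).
rewrite scale_block_mx !scaler0; congr block_mx.
by rewrite -!scalemxAl -scalemxAr scalerA HC expr2.
Qed.

(** A conformal endomorphism preserves the radical, hence is block triangular,
    and acts on the quotient by a multiple of an isometry. *)
Lemma conformal_weyl_group p (A : 'M[R]_(1 + n)) (c : R) : A \in unitmx -> 0 < c ->
  A^T *m Jpq p *m A = c *: Jpq p -> weyl_group p A.
Proof.
move=> uA c0; rewrite -(submxK A).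
set a := ulsubmx A; set b := ursubmx A; set e := dlsubmx A; set L := drsubmx A.
rewrite tr_block_mx /Jpq !mulmx_block !(mul0mx, mulmx0, addr0, add0r).
rewrite scale_block_mx !scaler0.
move=> /eq_block_mx[_ _ Le LL].
have uL : L \in unitmx.
  have H : (c^-1 *: (Ipq p *m L^T *m Ipq p)) *m L = 1%:M.
    rewrite -scalemxAl -!mulmxA [L^T *m _]mulmxA LL -scalemxAr Ipq_sqr scalerA.
    by rewrite mulVf ?scale1r // gt_eqF.
  by have [] := mulmx1_unit H.
have e0 : e = 0.
  have : (Ipq p *m invmx L^T) *m (L^T *m Ipq p *m e) = 0 by rewrite Le mulmx0.
  by rewrite -!mulmxA (mulmxA (invmx _)) mulVmx ?unitmx_tr // mul1mx mulmxA Ipq_sqr mul1mx.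
have a0 : a 0 0 != 0.
  move: uA; rewrite -(submxK A) -/a -/b -/e -/L e0 unitmxE det_ublock unitrM.
  by move=> /andP[+ _]; rewrite det_mx11 unitfE.
pose la := Num.sqrt c; have la0 : la != 0 by rewrite gt_eqF // sqrtr_gt0.
exists (a 0 0), la, b^T, (la^-1 *: L); split=> //.
  have tZ : (la^-1 *: L)^T = la^-1 *: L^T by rewrite linearZ.
  rewrite /in_Opq tZ -!scalemxAl -scalemxAr scalerA LL scalerA.
  by rewrite -invfM -expr2 sqr_sqrtr ?ltW // mulVf ?scale1r // gt_eqF.
by rewrite trmxK scalerA divff // scale1r e0 -mx11_scalar.
Qed.

End ConformalGroup.

(** * Locally finite families of bump functions *)

Section Partition.
Context {R : realType} {n : nat} {M : topologicalType}.
Variable S : smooth_manifold R n M.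
Implicit Types (x y : M).

(** For each member of a countable base choose, if there is one, a bump function
    that is positive on it.  The functions are indexed by the codes of the base,
    with the zero function at the other indices. *)
Lemma countable_bumps (x0 : M) : exists (c : nat -> idx S) (f : nat -> M -> R),
  [/\ forall k, smooth_fun S (f k), forall k y, 0 <= f k y,
    forall k y, dom (c k) y \/ \forall z \near y, f k z = 0 &
    forall y, exists k, 0 < f k y].
Proof.
have [B /countable_injP[code code_inj] [_ Bbase]] := mfd_second_countable S.
pose good (a : idx S * (M -> R)) := [/\ smooth_fun S a.2, forall y, 0 <= a.2 y &
  forall y, dom a.1 y \/ \forall z \near y, a.2 z = 0].
pose covers k (a : idx S * (M -> R)) := exists2 W, B W &
  code W = k /\ W `<=` [set y | 0 < a.2 y].
have H k : exists a, good a /\ forall b, good b -> covers k b -> covers k a.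
  case: (pselect (exists2 a, good a & covers k a)) => [[a ga ca]|nk].
    by exists a.
  exists (chart_at S x0, fun=> 0); split.
    split=> //=; last by move=> y; right; near=> z.
    exact: smooth_fun0.
  by move=> b gb cb; case: nk; exists b.
have [a Ha] := choice H.
exists (fun k => (a k).1), (fun k => (a k).2); split.
- by move=> k; have [[]] := Ha k.
- by move=> k; have [[]] := Ha k.
- by move=> k; have [[]] := Ha k.
move=> y; have [chi [schi chi0 chi1 chiz]] := bump_function S (near_dom (mem_chart_at S y)).
have gchi : good (chart_at S y, chi) by [].
have npos : \forall z \near y, 0 < chi z by apply: filterS chi1 => z ->.
have [W [BW Wy] Wpos] := Bbase y _ npos.
have cchi : covers (code W) (chart_at S y, chi) by exists W.
have [_ /(_ _ gchi cchi)[W' BW' [cW' W'pos]]] := Ha (code W).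
exists (code W); apply: W'pos.
suff -> : W' = W by [].
by apply: code_inj => //; rewrite inE.
Unshelve. all: by end_near. Qed.

(** Cutting [f k] off where some earlier [f j] exceeds [1 / (k + 1)] makes the
    family locally finite: near a point where [f m > d], only the indices up to
    [max m (1 / d)] survive. *)
Theorem locally_finite_bumps (x0 : M) : exists (c : nat -> idx S) (chi : nat -> M -> R),
  [/\ forall k, smooth_fun S (chi k), forall k y, 0 <= chi k y,
    forall k y, dom (c k) y \/ \forall z \near y, chi k z = 0,
    forall y, exists k, 0 < chi k y &
    forall y, exists N, \forall z \near y, forall k, (N <= k)%N -> chi k z = 0].
Proof.
have [c [f [sf f0 fdom fpos]]] := countable_bumps x0.
pose chi k y := f k y * \prod_(j < k) flat 0 ((k.+1%:R)^-1 - f j y).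
exists c, chi; split.
- move=> k; apply/smooth_funP => x; apply: fsmooth_mul.
    by move/smooth_funP : (sf k).
  apply: fsmooth_prod => j; apply: fsmooth_flat; apply: fsmooth_add.
    exact: fsmooth_cst.
  by apply: fsmooth_opp; move/smooth_funP : (sf j).
- by move=> k y; rewrite mulr_ge0 // prodr_ge0 // => j _; exact: flat_ge0.
- move=> k y; have [dy|fz] := fdom k y; [by left|right].
  by apply: filterS fz => z fz; rewrite /chi fz mul0r.
- move=> y; have ex : exists k, 0 < f k y by exact: fpos.
  exists (ex_minn ex); case: ex_minnP => k fk kmin.
  rewrite /chi mulr_gt0 // prodr_gt0 // => j _; apply: flat_gt0.
  suff -> : f j y = 0 by rewrite subr0 invr_gt0.
  apply/eqP; apply: contraT => fj; have : 0 < f j y by rewrite lt_def fj f0.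
  by move=> /kmin; rewrite leqNgt ltn_ord.
- move=> y; have [m fm] := fpos y.
  pose N := maxn m.+1 (Num.trunc ((f m y / 2)^-1)).+1.
  exists N.
  have cf : {for y, continuous (f m)}.
    by apply: fsmooth_continuous; move/smooth_funP : (sf m).
  have : \forall z \near y, f m y / 2 < f m z.
    move: cf => /(cvgr_gt (f m y)); apply.
    by rewrite ltr_pdivrMr // ltr_pMr // ltr1n.
  apply: filterS => z fz k; rewrite geq_max => /andP[mk tk].
  rewrite /chi (bigD1 (Ordinal mk)) //= flat_le0 ?mul0r ?mulr0 // subr_le0.
  apply: le_trans (ltW fz).
  rewrite -[X in _ <= X]invrK lef_pV2 ?posrE ?invr_gt0 ?divr_gt0 //.
  have := truncnS_gt ((f m y / 2)^-1) => h; apply: ltW; apply: lt_le_trans h _.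
  by rewrite ler_nat ltnW.
Qed.

End Partition.

(** * Covariant derivatives of bilinear forms *)

Section GramMatrices.
Context {R : realType} {n : nat} {M : topologicalType}.
Variables (S : smooth_manifold R n M) (D : connection S).
Local Notation E := 'cV[R]_n.+1.
Local Notation e_ k := (delta_mx k 0 : E).
Implicit Types (i j : idx S) (x y : M) (f : M -> R) (X Y Z : M -> E) (u v w : E).
Implicit Types (G H : 'M[R]_n.+1) (g : M -> 'M[R]_n.+1).

(** The Gram matrix, in the chart [i], of a bilinear form on [T_x M]. *)
Definition gram i x G : 'M[R]_n.+1 :=
  (jac (chart_at S x) i x)^T *m G *m jac (chart_at S x) i x.

Lemma gram_change i j x G : dom i x -> dom j x ->
  gram j x G = (jac i j x)^T *m gram i x G *m jac i j x.
Proof.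
move=> di dj; have E1 := jac_comp dj di (mem_chart_at S x).
by rewrite /gram -E1 trmx_mul !mulmxA.
Qed.

Lemma gram_chart_at x G : gram (chart_at S x) x G = G.
Proof. by rewrite /gram jac_id ?trmx1 ?mul1mx ?mulmx1 //; exact: mem_chart_at. Qed.

Lemma gramZ i x (c : R) G : gram i x (c *: G) = c *: gram i x G.
Proof. by rewrite /gram -scalemxAr -scalemxAl. Qed.

Lemma gram_sum i x (I : Type) (r : seq I) (F : I -> 'M[R]_n.+1) :
  gram i x (\sum_(a <- r) F a) = \sum_(a <- r) gram i x (F a).
Proof. by rewrite /gram mulmx_sumr mulmx_suml. Qed.

Lemma gram_tcoord i x G u v : dom i x ->
  u^T *m G *m v = (tcoord i x u)^T *m gram i x G *m tcoord i x v.
Proof.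
move=> dx; rewrite -[u in LHS](tcoordK u dx) -[v in LHS](tcoordK v dx).
by rewrite !(tvecE _ dx) trmx_mul /gram !mulmxA.
Qed.

Lemma delta_mulmx_delta H a b : ((e_ a)^T *m H *m e_ b) 0 0 = H a b.
Proof. by rewrite trmx_delta -rowE -colE !mxE. Qed.

Lemma smooth_form2P g : smooth_form2 S g <->
  forall i x a b, dom i x -> fsmooth S (fun y => gram i y (g y) a b) x.
Proof.
have gE i y u v : dom i y ->
    form2 g (fun x => tvec i x u) (fun x => tvec i x v) y = (u^T *m gram i y (g y) *m v) 0 0.
  by move=> dy; rewrite /form2 (gram_tcoord _ _ _ dy) !tvecK.
split=> [sg i x a b dx|sg i u v].
  apply/(fsmoothP _ dx).
  have := @open_smooth_at _ _ _ (img i) _ _ (@img_open _ _ _ S i) (mem_img dx)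
    (sg i (e_ a) (e_ b)).
  apply: smooth_at_near_eq; have := near_psi dx (near_dom dx).
  by apply: filterS => q dq /=; rewrite gE // delta_mulmx_delta.
apply/smoothP; first exact: img_open.
move=> q /img_psi[dq qq]; rewrite -qq; apply/(fsmoothP _ dq).
apply: (@fsmooth_near_eq _ _ _ _ (fun y => \sum_b \sum_a u a 0 * gram i y (g y) a b * v b 0)).
  have := near_dom dq; apply: filterS => y dy; rewrite gE // mxE.
  apply: eq_bigr => b _; rewrite mxE mulr_suml; apply: eq_bigr => a _.
  by rewrite [u^T _ _]mxE.
apply: fsmooth_sum => b; apply: fsmooth_sum => a; apply: fsmooth_mul; last exact: fsmooth_cst.
by apply: fsmooth_mul; [exact: fsmooth_cst|exact: sg].
Qed.

Lemma smooth_gram g i x : smooth_form2 S g -> dom i x ->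
  smooth_at (phi i x) (fun q => gram i (psi i q) (g (psi i q))).
Proof.
move=> /smooth_form2P sg dx; apply/smooth_at_mxP => a b.
by have /(fsmoothP _ dx) := sg i x a b dx.
Qed.

Lemma leibniz_form d (y z y' z' : 'cV[R]_d) (H H' T : 'M[R]_d) :
  y^T *m H *m z' + (y^T *m H' + y'^T *m H) *m z - (y' + T *m y)^T *m H *m z -
    y^T *m H *m (z' + T *m z) = y^T *m (H' - (T^T *m H + H *m T)) *m z.
Proof.
rewrite linearD /= trmx_mul !(mulmxDl, mulmxDr, mulmxBl, mulmxBr, mulmxN, mulNmx) !mulmxA.
move: (y^T *m H *m z') (y^T *m H' *m z) (y'^T *m H *m z) => t1 t2 t3.
move: (y^T *m T^T *m H *m z) (y^T *m H *m T *m z) => t4 t5.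
by apply/matrixP => a b; rewrite !mxE; ring.
Qed.

(** [nabla_u] acts on Gram matrices as [D_u - defect u]. *)
Definition defect i x u H := (Gam D i x u)^T *m H + H *m Gam D i x u.

Lemma defectZ i x (c : R) u H : defect i x (c *: u) H = c *: defect i x u H.
Proof.
have tZ : (c *: Gam D i x u)^T = c *: (Gam D i x u)^T by rewrite linearZ.
by rewrite /defect GamZ tZ -scalemxAl -scalemxAr scalerDr.
Qed.

Lemma defectZr i x (c : R) u H : defect i x u (c *: H) = c *: defect i x u H.
Proof. by rewrite /defect -scalemxAl -scalemxAr scalerDr. Qed.

Lemma defect_delta i x u H : defect i x u H = \sum_k u k 0 *: defect i x (e_ k) H.
Proof.
have GE : Gam D i x u = \sum_k u k 0 *: Gam D i x (e_ k).
  apply/matrixP => a b; rewrite Gam_delta summxE; apply: eq_bigr => k _.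
  by rewrite [RHS]mxE.
rewrite /defect GE linear_sum /= mulmx_suml mulmx_sumr -big_split /=.
apply: eq_bigr => k _.
have tZ : (u k 0 *: Gam D i x (e_ k))^T = u k 0 *: (Gam D i x (e_ k))^T by rewrite linearZ.
by rewrite tZ -scalemxAl -scalemxAr scalerDr.
Qed.

(** In the chart [g (Y, Z)] is the product [y^T H z]; by the Leibniz rule the
    derivatives of [y] and [z] cancel against those in [nabla Y] and [nabla Z]. *)
Lemma nabla_gram g i x X Y Z : smooth_form2 S g -> dom i x ->
  smooth_vfield S X -> smooth_vfield S Y -> smooth_vfield S Z ->
  lie_fun S X (form2 g Y Z) x - form2 g (D X Y) Z x - form2 g Y (D X Z) x =
  ((tcoord i x (Y x))^T *m ('D_(tcoord i x (X x))
      (fun q => gram i (psi i q) (g (psi i q))) (phi i x) -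
    defect i x (tcoord i x (X x)) (gram i x (g x))) *m tcoord i x (Z x)) 0 0.
Proof.
move=> sg dx sX sY sZ; set u := tcoord i x (X x).
pose h q := gram i (psi i q) (g (psi i q)).
pose y q := tcoord i (psi i q) (Y (psi i q)).
pose z q := tcoord i (psi i q) (Z (psi i q)).
have sh : smooth_at (phi i x) h := smooth_gram sg dx.
have sy : smooth_at (phi i x) y.
  by apply: vsmooth_coord => //; move/smooth_vfieldP : sY; exact.
have sz : smooth_at (phi i x) z.
  by apply: vsmooth_coord => //; move/smooth_vfieldP : sZ; exact.
have hx : h (phi i x) = gram i x (g x) by rewrite /h phiK.
have yx : y (phi i x) = tcoord i x (Y x) by rewrite /y phiK.
have zx : z (phi i x) = tcoord i x (Z x) by rewrite /z phiK.
have fE : \forall q \near phi i x,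
    ((y q)^T *m h q *m z q) 0 0 = (form2 g Y Z \o psi i) q.
  have := near_psi dx (near_dom dx); apply: filterS => q dq /=.
  by rewrite /form2 (gram_tcoord (g (psi i q)) (Y (psi i q)) (Z (psi i q)) dq).
have sf : fsmooth S (form2 g Y Z) x.
  apply/(fsmoothP _ dx); apply: smooth_at_near_eq fE _.
  rewrite (_ : (fun _ => _) = fun q => \sum_b (\sum_a y q a 0 * h q a b) * z q b 0).
    apply: smooth_at_sum => b; apply: smooth_at_mul.
      apply: smooth_at_sum => a; apply: smooth_at_mul.
        by move/smooth_at_mxP : sy; exact.
      by move/smooth_at_mxP : sh; exact.
    by move/smooth_at_mxP : sz; exact.
  apply/funext => q; rewrite mxE; apply: eq_bigr => b _; rewrite mxE.
  by congr (_ * _); apply: eq_bigr => a _; rewrite mxE.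
rewrite (lie_funE _ dx sf) -/u.
have dy := smooth_at_is_derive u sy; have dz := smooth_at_is_derive u sz.
have dh := smooth_at_is_derive u sh.
have := is_derive_mulmx (is_derive_mulmx (is_derive_trmx dy) dh) dz.
move=> /is_derive_mxP /(_ 0 0) dF; have [_ ->] := near_eq_is_derive fE dF.
rewrite hx yx zx /form2.
rewrite (gram_tcoord (g x) (D X Y x) (Z x) dx) (gram_tcoord (g x) (Y x) (D X Z x) dx).
rewrite (nablaE D dx sX sY) (nablaE D dx sX sZ) -/u -/y -/z.
set y0 := tcoord i x (Y x); set z0 := tcoord i x (Z x); set H := gram i x (g x).
set y' := 'D_u y _; set z' := 'D_u z _; set h' := 'D_u h _.
set Gu := Gam D i x u.
have sub00 (A B C : 'M[R]_1) : A 0 0 - B 0 0 - C 0 0 = (A - B - C) 0 0.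
  by rewrite !mxE.
by rewrite sub00 leibniz_form.
Qed.

(** The equation of a Weyl connection is tested on fields with constant
    components in the chart. *)
Lemma weyl_gram g (theta : M -> 'rV[R]_n.+1) : smooth_form2 S g ->
  (forall X Y Z, smooth_vfield S X -> smooth_vfield S Y -> smooth_vfield S Z ->
    forall x, lie_fun S X (form2 g Y Z) x - form2 g (D X Y) Z x - form2 g Y (D X Z) x =
      form1 theta X x * form2 g Y Z x) ->
  forall i x u, dom i x -> 'D_u (fun q => gram i (psi i q) (g (psi i q))) (phi i x) =
    defect i x u (gram i x (g x)) + (theta x *m tvec i x u) 0 0 *: gram i x (g x).
Proof.
move=> sg W i x u dx; apply/matrixP => a b.
have [X sX EX] := extend_constant u dx; have [Y sY EY] := extend_constant (e_ a) dx.
have [Z sZ EZ] := extend_constant (e_ b) dx.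
have := W X Y Z sX sY sZ x; rewrite (nabla_gram sg dx sX sY sZ) /form1 /form2.
rewrite (gram_tcoord (g x) (Y x) (Z x) dx).
rewrite (nbhs_singleton EX) (nbhs_singleton EY) (nbhs_singleton EZ).
rewrite (tvecK u dx) (tvecK (e_ a) dx) (tvecK (e_ b) dx).
rewrite !(delta_mulmx_delta _ a b) [LHS]mxE [X in _ + X]mxE.
move=> /eqP; rewrite subr_eq => /eqP e.
rewrite [RHS]mxE [X in _ = _ + X]mxE [RHS]addrC; exact: e.
Qed.

End GramMatrices.

(** * Normalized matrices *)

Section FrobeniusProduct.
Context {R : realType} {d : nat}.
Implicit Types (A B H : 'M[R]_d) (c : R).

Definition ip A B : R := \sum_a \sum_b A a b * B a b.

Lemma ipZl c A B : ip (c *: A) B = c * ip A B.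
Proof.
rewrite /ip mulr_sumr; apply: eq_bigr => a _; rewrite mulr_sumr.
by apply: eq_bigr => b _; rewrite mxE mulrA.
Qed.

Lemma ipC A B : ip A B = ip B A.
Proof. by apply: eq_bigr => a _; apply: eq_bigr => b _; rewrite mulrC. Qed.

Lemma ipZr c A B : ip A (c *: B) = c * ip A B.
Proof. by rewrite ipC ipZl ipC. Qed.

Lemma ipDl A A' B : ip (A + A') B = ip A B + ip A' B.
Proof.
rewrite /ip -big_split /=; apply: eq_bigr => a _; rewrite -big_split /=.
by apply: eq_bigr => b _; rewrite mxE mulrDl.
Qed.

Lemma ip_sumr (I : Type) (r : seq I) (F : I -> 'M[R]_d) B :
  ip (\sum_(k <- r) F k) B = \sum_(k <- r) ip (F k) B.
Proof.
elim: r => [|k r IH]; last by rewrite !big_cons ipDl IH.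
by rewrite !big_nil /ip big1 // => a _; rewrite big1 // => b _; rewrite mxE mul0r.
Qed.

Lemma ip_ge0 A : 0 <= ip A A.
Proof. by apply: sumr_ge0 => a _; apply: sumr_ge0 => b _; rewrite -expr2 sqr_ge0. Qed.

Lemma sqr_entry_le A a b : A a b ^+ 2 <= ip A A.
Proof.
rewrite /ip (bigD1 a) //= (bigD1 b) //= -addrA -expr2 lerDl.
by rewrite addr_ge0 // sumr_ge0 // => k _; rewrite ?sumr_ge0 // => *; rewrite -expr2 sqr_ge0.
Qed.

Lemma ip_gt0 A : A != 0 -> 0 < ip A A.
Proof.
move=> A0; rewrite lt_def ip_ge0 andbT; apply: contra_neq A0 => ipA.
apply/matrixP => a b; rewrite mxE; apply/eqP; rewrite -sqrf_eq0 eq_le sqr_ge0 andbT.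
by rewrite -ipA sqr_entry_le.
Qed.

Lemma entry_le1 A a b : ip A A = 1 -> `|A a b| <= 1.
Proof.
move=> A1; rewrite -(@ler_pXn2r _ 2) ?nnegrE // expr1n real_normK ?num_real //.
by rewrite -A1 sqr_entry_le.
Qed.

Definition normalize A := (Num.sqrt (ip A A))^-1 *: A.

Lemma normalizeZ c A : 0 < c -> normalize (c *: A) = normalize A.
Proof.
move=> c0; rewrite /normalize ipZl ipZr scalerA mulrA -expr2 sqrtrM ?sqr_ge0 //.
by rewrite sqrtr_sqr gtr0_norm // invfM mulrAC mulVf ?mul1r // gt_eqF.
Qed.

Lemma ip_normalize A : A != 0 -> ip (normalize A) (normalize A) = 1.
Proof.
move=> /ip_gt0 A0; rewrite ipZl ipZr mulrA -invfM -expr2 sqr_sqrtr ?ltW //.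
by rewrite mulVf // gt_eqF.
Qed.

Lemma is_derive_ip (V : normedModType R) (F G : V -> 'M[R]_d) x v F' G' :
  is_derive x v F F' -> is_derive x v G G' ->
  is_derive x v (fun y => ip (F y) (G y)) (ip F' (G x) + ip (F x) G').
Proof.
move=> /is_derive_mxP dF /is_derive_mxP dG.
rewrite (_ : (fun _ => _) = \sum_a \sum_b (fun y => F y a b * G y a b)); last first.
  apply/funext => y; rewrite fct_sumE; apply: eq_bigr => a _.
  by rewrite fct_sumE.
have H a b : is_derive x v (fun y => F y a b * G y a b)
    (F' a b * G x a b + F x a b * G' a b).
  have := is_deriveM (dF a b) (dG a b).
  rewrite /GRing.scale /= [G x a b * _]mulrC addrC; exact.
have H2 a : is_derive x v (\sum_b (fun y => F y a b * G y a b))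
    (\sum_b (F' a b * G x a b + F x a b * G' a b)) by exact: is_derive_sum.
apply: is_derive_eq (is_derive_sum H2) _.
by rewrite /ip -big_split /=; apply: eq_bigr => a _; rewrite big_split.
Qed.

(** Differentiating the normalization at a matrix of norm [1] projects
    orthogonally to it. *)
Lemma is_derive_normalize (N : R -> 'M[R]_d) (t : R) N' : ip (N t) (N t) = 1 ->
  is_derive t 1 N N' ->
  is_derive t 1 (fun s => normalize (N s)) (N' - ip N' (N t) *: N t).
Proof.
move=> N1 dN; pose q s := ip (N s) (N s).
have dq : is_derive t 1 q (2 * ip N' (N t)).
  by apply: is_derive_eq (is_derive_ip dN dN) _; rewrite [ip (N t) _]ipC mulr_natl mulr2n.
have q1 : q t = 1 by [].
have dsq : is_derive (q t) 1 Num.sqrt (2^-1).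
  by apply: is_derive_eq (is_derive1_sqrt _) _; rewrite q1 ?sqrtr1 ?mulr1.
have dr := is_derive1_comp dsq dq.
have dr0 : (Num.sqrt \o q) t != 0 by rewrite /= q1 sqrtr1 oner_neq0.
have dV := is_deriveV dr0 dr.
have {}dV : is_derive t 1 (fun s => (Num.sqrt (q s))^-1) (- ip N' (N t)).
  apply: is_derive_eq dV _; rewrite /= q1 sqrtr1 expr1n invr1 /GRing.scale /=.
  by rewrite mulN1r mulrA mulVf ?mul1r // pnatr_eq0.
move/is_derive_mxP : dN => dN; apply/is_derive_mxP => a b.
rewrite (_ : (fun _ => _) = (fun s => (Num.sqrt (q s))^-1 * N s a b)); last first.
  by apply/funext => s; rewrite mxE.
apply: is_derive_eq (is_deriveM dV (dN a b)) _.
by rewrite q1 sqrtr1 invr1 scale1r !mxE /GRing.scale /= mulrN [N t a b * _]mulrC.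
Qed.

End FrobeniusProduct.

(** * Forms whose covariant derivatives are multiples of them *)

Section Proportional.
Context {R : realType} {n : nat} {M : topologicalType}.
Variables (S : smooth_manifold R n M) (D : connection S).
Local Notation E := 'cV[R]_n.+1.
Local Notation e_ k := (delta_mx k 0 : E).
Implicit Types (i j : idx S) (x y : M) (u v w : E).
Lemma gram_eq0 i x G : dom i x -> gram i x G = 0 -> G = 0.
Proof.
move=> dx G00; have := gram_change G dx (mem_chart_at S x).
by rewrite gram_chart_at G00 mulmx0 mul0mx.
Qed.

Variable g : M -> 'M[R]_n.+1.
Hypothesis sg : smooth_form2 S g.
Hypothesis g0 : forall x, g x != 0.
Let h i q := gram i (psi i q) (g (psi i q)).
Let H i x := gram i x (g x).
Let dH i x u := 'D_u (h i) (phi i x) - defect D i x u (H i x).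
Hypothesis proportional : forall i x u, dom i x -> exists k : R, dH i x u = k *: H i x.

Let H0 i x : dom i x -> H i x != 0.
Proof. by move=> dx; apply: contra_neq (g0 x); exact: gram_eq0. Qed.

Let factor i x u := ip (dH i x u) (H i x) / ip (H i x) (H i x).

Lemma factorE i x u : dom i x -> dH i x u = factor i x u *: H i x.
Proof.
move=> dx; have [k E0] := proportional u dx.
have N := gt_eqF (ip_gt0 (H0 dx)).
by rewrite /factor E0 ipZl mulfK ?N.
Qed.

Lemma nabla_factor i x X Y Z : dom i x ->
  smooth_vfield S X -> smooth_vfield S Y -> smooth_vfield S Z ->
  lie_fun S X (form2 g Y Z) x - form2 g (D X Y) Z x - form2 g Y (D X Z) x =
  factor i x (tcoord i x (X x)) * form2 g Y Z x.
Proof.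
move=> dx sX sY sZ; rewrite (nabla_gram D sg dx sX sY sZ).
have := factorE (tcoord i x (X x)) dx; rewrite /dH => ->.
by rewrite -scalemxAr -scalemxAl mxE /form2 (gram_tcoord (g x) (Y x) (Z x) dx).
Qed.

Lemma factor_change i j x u : dom i x -> dom j x ->
  factor i x u = factor j x (tcoord j x (tvec i x u)).
Proof.
move=> di dj.
have [a [b ab]] : exists a b, H i x a b != 0.
  apply: contrapT => N; move/eqP: (H0 di); apply; apply/matrixP => a b; rewrite [RHS]mxE.
  by apply/eqP; apply: contrapT => ab; apply: N; exists a, b; apply/negP.
have [X sX EX] := extend_constant u di; have [Y sY EY] := extend_constant (e_ a) di.
have [Z sZ EZ] := extend_constant (e_ b) di.
have YZ : form2 g Y Z x = H i x a b.
  rewrite /form2 (gram_tcoord (g x) (Y x) (Z x) di).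
  rewrite (nbhs_singleton EY) (nbhs_singleton EZ).
  by rewrite (tvecK (e_ a) di) (tvecK (e_ b) di) (delta_mulmx_delta _ a b).
have := nabla_factor di sX sY sZ; rewrite (nabla_factor dj sX sY sZ) YZ.
rewrite (nbhs_singleton EX) (tvecK u di) => ff; symmetry; exact: mulIf ab _ _ ff.
Qed.

Lemma factor_linear i x u : dom i x -> factor i x u = \sum_k u k 0 * factor i x (e_ k).
Proof.
move=> dx.
have hs : smooth_at (phi i x) (h i) := smooth_gram sg dx.
have dE : dH i x u = \sum_k u k 0 *: dH i x (e_ k).
  rewrite /dH (defect_delta D i x u).
  have -> : 'D_u (h i) (phi i x) = \sum_k u k 0 *: 'D_(e_ k) (h i) (phi i x).
    apply/matrixP => a b; rewrite -(derive_mxE a b (@smooth_at_derivable _ _ _ _ u _ hs)).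
    have sab : smooth_at (phi i x) (fun q => h i q a b) by move/smooth_at_mxP : hs; exact.
    have [_ ->] := deriveE_partials u (smooth_at_differentiable sab).
    rewrite summxE; apply: eq_bigr => k _.
    by rewrite [RHS]mxE -(derive_mxE a b (@smooth_at_derivable _ _ _ _ (e_ k) _ hs)).
  rewrite -sumrB; apply: eq_bigr => k _; by rewrite scalerBr.
rewrite /factor dE ip_sumr mulr_suml; apply: eq_bigr => k _.
by rewrite ipZl mulrA.
Qed.

(** In each chart the factor of proportionality is [ip (dH u) H / ip H H], which
    is smooth and linear in [u].  Testing on fields [Y], [Z] with
    [g (Y, Z) != 0] shows that it is the same in all charts, so that it is a
    1-form. *)
Theorem proportional_weyl : weyl_connection D g.
Proof.
pose theta x : 'rV[R]_n.+1 := \row_k factor (chart_at S x) x (e_ k).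
have thE i x u : dom i x -> (theta x *m tvec i x u) 0 0 = factor i x u.
  move=> dx; have dc := mem_chart_at S x; rewrite (factor_change u dx dc).
  rewrite tcoord_chart_at (factor_linear _ dc) mxE; apply: eq_bigr => k _.
  by rewrite mxE mulrC.
exists theta.
  move=> i u; apply/smoothP; first exact: img_open.
  move=> q /img_psi[dq qq]; rewrite -qq; set x := psi i q in dq *.
  have hs : smooth_at (phi i x) (h i) := smooth_gram sg dq.
  pose num q' := ip ('D_u (h i) q' - ((Gam D i (psi i q') u)^T *m h i q' +
    h i q' *m Gam D i (psi i q') u)) (h i q').
  apply: (@smooth_at_near_eq _ _ _ _ (fun q' => num q' * (ip (h i q') (h i q'))^-1)).
    have := near_img dq; apply: filterS => q' /img_psi[dq' qq'].
    have E1 : form1 theta (fun y => tvec i y u) (psi i q') = factor i (psi i q') u := thE _ _ _ dq'.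
    rewrite E1 /factor /dH /H /num /h /defect qq'; reflexivity.
  have hab a b : smooth_at (phi i x) (fun q' => h i q' a b).
    by move/smooth_at_mxP : hs; exact.
  have Gab a b : smooth_at (phi i x) (fun q' => Gam D i (psi i q') u a b).
    by have /(fsmoothP _ dq) := fsmooth_Gam D u a b dq.
  have dab a b : smooth_at (phi i x) (fun q' => 'D_u (h i) q' a b).
    by have /smooth_at_mxP := smooth_at_derive u hs; exact.
  apply: smooth_at_mul.
    apply: smooth_at_sum => a; apply: smooth_at_sum => b; apply: smooth_at_mul => //.
    rewrite (_ : (fun _ => _) = fun q' => 'D_u (h i) q' a b -
      (\sum_k Gam D i (psi i q') u k a * h i q' k b +
       \sum_k h i q' a k * Gam D i (psi i q') u k b)); last first.
      apply/funext => q'; rewrite [LHS]mxE [X in _ + X]mxE [X in - X]mxE.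
      congr (_ - (_ + _)); rewrite [LHS]mxE //.
      by apply: eq_bigr => k _; rewrite [_^T _ _]mxE.
    apply: smooth_at_add => //; apply: smooth_at_opp; apply: smooth_at_add;
      by apply: smooth_at_sum => k; apply: smooth_at_mul.
  apply: smooth_at_inv.
    by apply: smooth_at_sum => a; apply: smooth_at_sum => b; apply: smooth_at_mul.
  have := ip_gt0 (H0 dq); rewrite /H /h phiK // => /lt0r_neq0; exact.
move=> X Y Z sX sY sZ x; have dc := mem_chart_at S x.
rewrite (nabla_factor dc sX sY sZ) /form1 -(thE _ _ (tcoord (chart_at S x) x (X x)) dc).
by rewrite (tcoordK (X x) dc).
Qed.

End Proportional.

(** * The ray of forms defined by the holonomy *)

Section Rays.
Context {R : realType} {n : nat} {M : topologicalType}.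
Variables (S : smooth_manifold R n M) (D : connection S).
Variables (p : nat) (x0 : M) (P : 'M[R]_n.+1).
Hypothesis connM : connected [set: M].
Hypothesis uP : P \in unitmx.
Hypothesis hol : forall A, holonomy D x0 A -> weyl_group p (invmx P *m A *m P).
Local Notation E := 'cV[R]_n.+1.
Local Notation e_ k := (delta_mx k 0 : E).
Implicit Types (i j : idx S) (x y : M) (u v w : E) (A B C G H : 'M[R]_n.+1).

(** The set of such points is open and closed, as nearby points are joined by
    segments in both directions. *)
Lemma reachable y : (exists A, transport D x0 y A) /\ (exists A, transport D y x0 A).
Proof.
pose B := [set y | (exists A, transport D x0 y A) /\ (exists A, transport D y x0 A)].
have step (U : set M) (z w : M) :
    (forall y z, U y -> U z -> exists A, transport D y z A) ->
    U z -> U w -> B z -> B w.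
  move=> T Uz Uw [[A TA] [C TC]]; have [A' TA'] := T z w Uz Uw.
  have [C' TC'] := T w z Uw Uz.
  by split; [exists (A' *m A)|exists (C *m C')]; apply: transport_concat; eassumption.
have oB : open B.
  rewrite openE => z Bz; have [U nU T] := near_transport D z.
  have Uz := nbhs_singleton nU.
  by apply: filterS nU => w Uw; exact: (step U z w).
have cB : closed B.
  move=> z clz; have [U nU T] := near_transport D z.
  have [w [Bw Uw]] := clz U nU.
  by apply: (step U w z) => //; exact: nbhs_singleton nU.
have Bx0 : B x0.
  have [U nU T] := near_transport D x0; have Ux := nbhs_singleton nU.
  by have [A TA] := T x0 x0 Ux Ux; split; exists A.
suff BT : B = [set: M] by have : [set: M] y; [by []|rewrite -BT].
apply: connM; first by exists x0.
  by exists B => //; rewrite setTI.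
by exists B => //; rewrite setTI.
Qed.

Definition G0 : 'M[R]_n.+1 := (invmx P)^T *m Jpq p *m invmx P.

Lemma holonomy_conformal A : transport D x0 x0 A ->
  A \in unitmx /\ exists2 c : R, 0 < c & A^T *m G0 *m A = c *: G0.
Proof.
move=> /hol /weyl_group_conformal [uB [c c0 Bc]].
set B := invmx P *m A *m P in uB Bc.
have AE : A = P *m B *m invmx P by rewrite /B !mulmxA mulmxV // mul1mx mulmxK.
have {}uB : (B : 'M[R]_n.+1) \in unitmx := uB.
have {}Bc : B^T *m (Jpq p : 'M[R]_n.+1) *m B = c *: (Jpq p : 'M[R]_n.+1) := Bc.
clearbody B.
split; first by rewrite AE !unitmx_mul uP uB unitmx_inv uP.
exists c => //; rewrite AE !trmx_mul /G0.
have PP : P^T *m (invmx P)^T = 1%:M by rewrite -trmx_mul mulVmx // trmx1.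
have -> : (invmx P)^T *m (B^T *m P^T) *m ((invmx P)^T *m Jpq p *m invmx P) *m
    (P *m B *m invmx P) = (invmx P)^T *m (B^T *m (P^T *m (invmx P)^T) *m Jpq p *m
    (invmx P *m P) *m B) *m invmx P by rewrite !mulmxA.
by rewrite PP mulVmx // !mulmx1 Bc -scalemxAr -scalemxAl.
Qed.

(** Any transport is part of a loop at [x0], and the holonomy consists of
    invertible matrices. *)
Lemma transport_unit x y A : transport D x y A -> A \in unitmx.
Proof.
move=> TA; have [[B TB] _] := reachable x; have [_ [C TC]] := reachable y.
have [u _] := holonomy_conformal (transport_concat (transport_concat TB TA) TC).
by move: u; rewrite !unitmx_mul => /and3P[].
Qed.

(** The forms on [T_x M] carried to multiples of [G0] by parallel transport to
    [x0]: the holonomy assumption makes them one ray. *)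
Definition in_ray x G := exists C (c : R),
  [/\ transport D x x0 C, 0 < c & G = c *: (C^T *m G0 *m C)].

Lemma ray_exists x : exists G, in_ray x G.
Proof. by have [_ [C TC]] := reachable x; exists (1 *: (C^T *m G0 *m C)), C, 1. Qed.

Lemma ray_scale x G (c : R) : 0 < c -> in_ray x G -> in_ray x (c *: G).
Proof.
by move=> c0 [C [d [TC d0 ->]]]; exists C, (c * d); rewrite scalerA mulr_gt0.
Qed.

(** Two transports from [x] to [x0] differ by a loop at [x0], which multiplies
    [G0] by a positive number. *)
Lemma ray_unique x G G' : in_ray x G -> in_ray x G' -> exists2 c : R, 0 < c & G' = c *: G.
Proof.
move=> [C [c [TC c0 GE]]] [C' [c' [TC' c'0 GE']]].
have [[A TA] _] := reachable x; have uA := transport_unit TA.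
have pull B (b : R) : transport D x x0 B -> 0 < b -> exists2 d : R, 0 < d &
    A^T *m (b *: (B^T *m G0 *m B)) *m A = d *: G0.
  move=> TB b0; have [_ [d d0 Bd]] := holonomy_conformal (transport_concat TA TB).
  exists (b * d); first exact: mulr_gt0.
  by rewrite -scalemxAr -scalemxAl -scalerA -Bd trmx_mul !mulmxA.
have [d d0 Ed] := pull _ _ TC c0; have [d' d'0 Ed'] := pull _ _ TC' c'0.
exists (d' / d); first exact: divr_gt0.
rewrite -GE in Ed; rewrite -GE' in Ed'.
have uAT : A^T \in unitmx by rewrite unitmx_tr.
rewrite -[LHS](mulKmx uAT) -[A^T *m G'](mulmxK uA) Ed'.
rewrite -[G in RHS](mulKmx uAT) -[A^T *m G in RHS](mulmxK uA) Ed.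
by rewrite -!scalemxAl -!scalemxAr scalerA divfK // gt_eqF.
Qed.

(** Invariance under transport is what forces the covariant derivative of a
    section of the rays to be proportional to it. *)
Lemma ray_transport x y A G : transport D x y A -> in_ray y G -> in_ray x (A^T *m G *m A).
Proof.
move=> TA [C [c [TC c0 ->]]]; exists (C *m A), c; split=> //.
  exact: transport_concat TC.
by rewrite -scalemxAr -scalemxAl trmx_mul !mulmxA.
Qed.

Lemma ray_signature x G : in_ray x G -> G^T = G /\ has_signature p G.
Proof.
move=> [C [c [TC c0 GE]]]; have uC := transport_unit TC; split.
  by rewrite GE linearZ /= !trmx_mul !trmxK trmx_Jpq !mulmxA.
pose s := (Num.sqrt c)^-1.
exists (s *: (invmx C *m P)).
  rewrite unitmxZ ?unitmx_mul ?unitmx_inv ?uC //.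
  by rewrite unitfE invr_eq0 gt_eqF // sqrtr_gt0.
have tZ : (s *: (invmx C *m P))^T = s *: (P^T *m (invmx C)^T).
  by rewrite linearZ /= trmx_mul.
rewrite tZ GE -!(scalemxAl, scalemxAr) !scalerA.
have -> : s * s * c = 1.
  by rewrite /s -invfM -expr2 sqr_sqrtr ?ltW // mulVf // gt_eqF.
have CC : (invmx C)^T *m C^T = 1%:M by rewrite -trmx_mul mulmxV // trmx1.
have PP : P^T *m (invmx P)^T = 1%:M by rewrite -trmx_mul mulVmx // trmx1.
rewrite scale1r /G0.
have -> : P^T *m (invmx C)^T *m (C^T *m ((invmx P)^T *m Jpq p *m invmx P) *m C) *m
    (invmx C *m P) = P^T *m ((invmx C)^T *m C^T) *m (invmx P)^T *m Jpq p *m invmx P *m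
    (C *m invmx C) *m P by rewrite !mulmxA.
by rewrite CC mulmxV // !mulmx1 PP mul1mx -mulmxA mulVmx // mulmx1.
Qed.

Lemma signature_rank (G : 'M[R]_n.+1) : has_signature p G -> \rank G = n.
Proof.
move=> [Q uQ QG].
have : \rank (Q^T *m (G : 'M[R]_(1 + n)) *m Q) = n by rewrite QG; exact: rank_Jpq.
by rewrite mxrankMfree ?row_free_unit // eqmxMfull ?row_full_unit ?unitmx_tr.
Qed.

Definition ray_form x := sval (cid (ray_exists x)).

Lemma ray_formP x : in_ray x (ray_form x).
Proof. exact: svalP (cid (ray_exists x)). Qed.

Definition chart_ray i x H := exists2 G, in_ray x G & H = gram i x G.

(** Normalizing picks one representative of the ray, hence a function whose
    derivatives can be computed; it depends on the chart. *)
Definition unit_form i x := normalize (gram i x (ray_form x)).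

Lemma chart_ray_normalize i x H : chart_ray i x H -> normalize H = unit_form i x.
Proof.
move=> [G rG ->]; have [c c0 ->] := ray_unique (ray_formP x) rG.
by rewrite gramZ normalizeZ.
Qed.

Lemma ray_neq0 x G : (0 < n)%N -> in_ray x G -> G != 0.
Proof.
move=> n0 /ray_signature[_ /signature_rank rG]; apply: contraTneq n0 => G00.
by rewrite -rG G00 mxrank0.
Qed.

Lemma gram_ray_neq0 i x G : (0 < n)%N -> dom i x -> in_ray x G -> gram i x G != 0.
Proof.
move=> n0 dx /(ray_neq0 n0); apply: contra_neq; exact: gram_eq0.
Qed.

Lemma ip_unit_form i x : (0 < n)%N -> dom i x -> ip (unit_form i x) (unit_form i x) = 1.
Proof. by move=> n0 dx; apply: ip_normalize; apply: gram_ray_neq0 => //; exact: ray_formP. Qed.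

Lemma unit_form_scale i x G : (0 < n)%N -> dom i x -> in_ray x G ->
  gram i x G = ip (gram i x G) (unit_form i x) *: unit_form i x.
Proof.
move=> n0 dx rG.
have <- := chart_ray_normalize (ex_intro2 _ _ G rG (erefl (gram i x G))).
have G1 := gram_ray_neq0 n0 dx rG; have G2 := ip_gt0 G1.
rewrite /normalize ipZr scalerA mulrAC -invfM -expr2 sqr_sqrtr ?ltW //.
by rewrite mulVf ?scale1r // gt_eqF.
Qed.

Lemma pull_back_conjugate (Jx Kx X Jy G : 'M[R]_n.+1) : Kx *m Jx = 1%:M ->
  Jx^T *m ((Jy *m X *m Kx)^T *m G *m (Jy *m X *m Kx)) *m Jx =
  X^T *m (Jy^T *m G *m Jy) *m X.
Proof.
move=> KJ; have KJT : Jx^T *m Kx^T = 1%:M by rewrite -trmx_mul KJ trmx1.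
by rewrite !trmx_mul !mulmxA KJT mul1mx -!mulmxA KJ mulmx1.
Qed.

Lemma chart_ray_pull i x y X H : dom i x -> dom i y ->
  transport D x y (jac (chart_at S y) i y *m X *m jac i (chart_at S x) x) ->
  chart_ray i y H -> chart_ray i x (X^T *m H *m X).
Proof.
move=> dx dy T [G rG ->]; eexists; first exact: ray_transport T rG.
rewrite /gram pull_back_conjugate // jac_comp ?jac_id //; exact: mem_chart_at.
Qed.

(** Along a segment [phi x + t u], the pull-back of [H] by the inverse transport
    [Y t] lies in the ray, so [unit_form] is its normalization; the derivative at
    [t = 0] of the pull-back is [defect u H], and normalizing projects it
    orthogonally to [H]. *)
Theorem unit_form_derive i x u : (0 < n)%N -> dom i x ->
  is_derive (phi i x) u (fun q => unit_form i (psi i q))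
    (defect D i x u (unit_form i x) -
     ip (defect D i x u (unit_form i x)) (unit_form i x) *: unit_form i x).
Proof.
move=> n0 dx; set H := unit_form i x.
have [r r0 Hr] := near_short D dx.
(* Transport is available along short vectors only: [eps *: u] is short, and
   the derivative is rescaled at the end. *)
pose eps := r / (`|u| + 1).
have u1 : 0 < `|u| + 1 by rewrite ltr_wpDl.
have e0 : 0 < eps by rewrite divr_gt0.
have sh : short D i (phi i x) (eps *: u).
  apply: Hr; first by rewrite subrr normr0.
  rewrite normrZ gtr0_norm // /eps mulrAC ltr_pdivrMr //.
  by apply: ltr_pM => //; [exact: ltW| |]; rewrite ?ltrDl // ltr_pMl // ltr1n.
have [X [Y [X0 Y0 XY T]]] := segment_transport sh.
have [K _ [_ inK]] := sh.
rewrite phiK // in T.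
have key : \forall t \near (0 : R),
    normalize ((Y t)^T *m H *m Y t) = unit_form i (psi i (phi i x + t *: (eps *: u))).
  have : \forall t \near (0 : R), `|t| < 1 by apply: nbhs0_lt.
  apply: filterS => t t1.
  have t3 : `|t| < 3 by apply: lt_trans t1 _; rewrite ltr1n.
  have t2 : `|t| < 2 by apply: lt_trans t1 _; rewrite ltr1n.
  have [it _] := inK t t3; have [dy _] := img_psi it.
  set y := psi i _ in dy *.
  have Ty := T t (ltW t1).
  have [_ _ YX] := XY t t2.
  have XYt : X t *m Y t = 1%:M by exact: mulmx1C.
  have rH : chart_ray i y (gram i y (ray_form y)) by exists (ray_form y) => //; exact: ray_formP.
  have [G rG EG] := chart_ray_pull dx dy Ty rH.
  have [c c0 Gc] := ray_unique rG (ray_formP x).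
  have HE : H = normalize (gram i x (ray_form x)) by [].
  have [d d0 Hd] : exists2 d : R, 0 < d & H = d *: gram i x G.
    exists ((Num.sqrt (ip (gram i x (ray_form x)) (gram i x (ray_form x))))^-1 * c).
      rewrite mulr_gt0 // invr_gt0 sqrtr_gt0 ip_gt0 //.
      by apply: gram_ray_neq0 => //; exact: ray_formP.
    by rewrite HE /normalize {3}Gc gramZ scalerA.
  have -> : (Y t)^T *m H *m Y t = d *: gram i y (ray_form y).
    rewrite Hd -EG -scalemxAr -scalemxAl; congr (_ *: _).
    have XYT : (Y t)^T *m (X t)^T = 1%:M by rewrite -trmx_mul XYt trmx1.
    by move: (gram i y _) => Q; rewrite !mulmxA XYT mul1mx -mulmxA XYt mulmx1.
  exact: (normalizeZ _ d0).
have N0 : (Y 0)^T *m H *m Y 0 = H by rewrite Y0 trmx1 mul1mx mulmx1.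
have n02 : `|0 : R| < 2 by rewrite normr0.
have [_ dY _] := XY 0 n02.
rewrite Y0 mul1mx scale0r addr0 phiK // in dY.
have dN : is_derive (0 : R) 1 (fun s => (Y s)^T *m H *m Y s) (eps *: defect D i x u H).
  apply: is_derive_eq (is_derive_mulmx
    (is_derive_mulmx (is_derive_trmx dY) (is_derive_cst H (0 : R) 1)) dY) _.
  by rewrite /= Y0 trmx1 !mul1mx !mulmx1 add0r -defectZ /defect addrC.
have N1 : ip ((Y 0)^T *m H *m Y 0) ((Y 0)^T *m H *m Y 0) = 1.
  by rewrite N0; exact: ip_unit_form.
have := near_eq_is_derive key (is_derive_normalize N1 dN).
rewrite N0 => dl.
have [d1 d2] := is_derive_of_line (f := fun q => unit_form i (psi i q))
  (x := phi i x) (v := eps *: u) dl.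
have dE := deriveZdir eps^-1 d1.
have eN : eps != 0 by rewrite gt_eqF.
have epsK (W : lmodType R) (w : W) : eps^-1 *: (eps *: w) = w.
  by rewrite scalerA (mulVf eN) scale1r.
rewrite epsK d2 in dE; apply: is_derive_eq dE _.
by rewrite ipZl -[_ *: H]scalerA -scalerBr epsK.
Qed.

(** The derivatives of [unit_form] are polynomial in its entries: it is
    Lipschitz since its norm is bounded, hence continuous, and then smooth by
    bootstrapping. *)
Theorem smooth_unit_form i x a b : (0 < n)%N -> dom i x ->
  fsmooth S (fun y => unit_form i y a b) x.
Proof.
move=> n0 dx; apply/(fsmoothP _ dx).
pose f (ab : 'I_n.+1 * 'I_n.+1) q := unit_form i (psi i q) ab.1 ab.2.
have df q u ab : img i q -> is_derive q u (f ab)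
    ((defect D i (psi i q) u (unit_form i (psi i q)) -
     ip (defect D i (psi i q) u (unit_form i (psi i q))) (unit_form i (psi i q))
       *: unit_form i (psi i q)) ab.1 ab.2).
  move=> /img_psi[dq qq]; have /is_derive_mxP := unit_form_derive u n0 dq.
  by rewrite qq; exact.
have entry1 q ab : img i q -> `|f ab q| <= 1.
  by move=> /img_psi[dq _]; apply: entry_le1; exact: ip_unit_form.
have cf q ab : img i q -> {for q, continuous (f ab)}.
  move=> /img_psi[dq qq]; have [K K0 HK] := Gam_bounded D dq; rewrite qq in HK.
  pose K1 := n.+1%:R * K * 1 + n.+1%:R * 1 * K.
  pose K2 := \sum_(a < n.+1) \sum_(b < n.+1) K1 * 1.
  have K10 : 0 <= K1 by rewrite addr_ge0 // !mulr_ge0 // ltW.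
  apply: (@continuous_of_bounded_partials _ _ _ _ (K1 + K2 * 1)).
  apply: filterS HK => q' [iq' HK] k; have [d1 d2] := df q' (e_ k) ab iq'.
  split => //; rewrite d2.
  set H := unit_form i (psi i q'); set T := defect D i _ _ H.
  have H1 c d : `|H c d| <= 1 by exact: (entry1 q' (c, d)).
  have G1 c d : `|Gam D i (psi i q') (e_ k) c d| <= K by exact: (HK (k, c, d)).
  have T1 c d : `|T c d| <= K1.
    rewrite /T /defect [X in `|X|]mxE; apply: le_trans (ler_normD _ _) _; apply: lerD.
      apply: mulmx_entry_le; [exact: ltW| |exact: H1].
      by move=> c' d'; rewrite [_^T _ _]mxE.
    by apply: mulmx_entry_le.
  rewrite [X in `|X|]mxE [X in _ + X]mxE [X in - X]mxE.
  apply: le_trans (ler_normB _ _) _.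
  apply: lerD => //; rewrite normrM ler_pM //.
  apply: le_trans (ler_norm_sum _ _ _) _; apply: ler_sum => c _.
  apply: le_trans (ler_norm_sum _ _ _) _; apply: ler_sum => d _.
  by rewrite normrM ler_pM.
apply: (@open_smooth_at _ _ _ (img i)) => //; [exact: img_open|exact: mem_img|].
apply: (@smooth_alg _ _ (img i) (fun h => exists ab, h = f ab)); first exact: img_open.
- by move=> _ q [ab ->]; exact: cf.
- move=> _ u [ab ->]; pose gm (c d : 'I_n.+1) q := Gam D i (psi i q) u c d.
  have sg c d : alg (img i) (fun h => exists ab, h = f ab) (gm c d).
    apply: alg_smooth; apply/smoothP; first exact: img_open.
    move=> q /img_psi[dq qq]; rewrite -qq.
    by have /(fsmoothP _ dq) := fsmooth_Gam D u c d dq.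
  have sf ab' : alg (img i) (fun h => exists ab, h = f ab) (f ab').
    by apply: alg_gen; exists ab'.
  pose df' (c d : 'I_n.+1) q :=
    \sum_k gm k c q * f (k, d) q + \sum_k f (c, k) q * gm k d q.
  have sd c d : alg (img i) (fun h => exists ab, h = f ab) (df' c d).
    by apply: alg_add; apply: alg_sum => k; apply: alg_mul.
  exists (fun q => df' ab.1 ab.2 q + -1 * (\sum_c \sum_d df' c d q * f (c, d) q) * f ab q).
    apply: alg_add => //; apply: alg_mul => //; apply: alg_mul.
      by apply: alg_smooth => k; exact: Ck_cst.
    by apply: alg_sum => c; apply: alg_sum => d; apply: alg_mul.
  move=> q iq; apply: is_derive_eq (df q u ab iq) _.
  have dE c d : defect D i (psi i q) u (unit_form i (psi i q)) c d = df' c d q.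
    rewrite /defect [LHS]mxE; congr (_ + _); rewrite [LHS]mxE; apply: eq_bigr => k _ //.
    by rewrite [_^T _ _]mxE.
  rewrite [LHS]mxE [X in _ + X]mxE [X in - X]mxE dE mulN1r mulNr; congr (_ - _ * _).
  by apply: eq_bigr => c _; apply: eq_bigr => d _; rewrite dE.
- by apply: alg_gen; exists (a, b).
Qed.

(** The unit representatives of the ray in the charts of a locally finite cover
    are summed with bump functions: the ray being convex, the sum stays in it. *)
Theorem smooth_ray_metric : (0 < n)%N ->
  exists2 g : M -> 'M[R]_n.+1, smooth_form2 S g & forall x, in_ray x (g x).
Proof.
move=> n0; have [c [chi [schi chi0 chidom chipos chifin]]] := locally_finite_bumps S x0.
pose s k x := (Num.sqrt (ip (gram (c k) x (ray_form x)) (gram (c k) x (ray_form x))))^-1.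
have sE k x : unit_form (c k) x = gram (c k) x (s k x *: ray_form x) by rewrite gramZ.
have s0 k x : 0 <= s k x by rewrite invr_ge0 sqrtr_ge0.
have spos k x : dom (c k) x -> 0 < s k x.
  move=> dx; rewrite invr_gt0 sqrtr_gt0 ip_gt0 //.
  by apply: gram_ray_neq0 => //; exact: ray_formP.
pose N x := sval (cid (chifin x)).
have NP x : \forall z \near x, forall k, (N x <= k)%N -> chi k z = 0 := svalP (cid (chifin x)).
pose g x := \sum_(k < N x) chi k x *: (s k x *: ray_form x).
have gE x m : (forall k, (m <= k)%N -> chi k x = 0) ->
    g x = \sum_(k < m) chi k x *: (s k x *: ray_form x).
  move=> mx; pose t k := chi k x *: (s k x *: ray_form x).
  have ext a b : (a <= b)%N -> (forall k, (a <= k)%N -> chi k x = 0) ->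
      \sum_(k < a) t k = \sum_(k < b) t k.
    move=> ab ax; rewrite (big_ord_widen _ t ab) [RHS](bigID (fun k : 'I_b => (k < a)%N)) /=.
    rewrite [X in _ = _ + X]big1 ?addr0 // => k; rewrite -leqNgt => ak.
    by rewrite /t ax // scale0r.
  have Nx := nbhs_singleton (NP x).
  rewrite /g -/t; have [le|/ltnW le] := leqP (N x) m; first exact: ext.
  by symmetry; exact: ext.
exists g; last first.
  move=> x; have [k ck] := chipos x.
  have -> : g x = (\sum_(k < N x) chi k x * s k x) *: ray_form x.
    by rewrite scaler_suml; apply: eq_bigr => l _; rewrite scalerA.
  apply: ray_scale; last exact: ray_formP.
  have kN : (k < N x)%N.
    rewrite ltnNge; apply/negP => /(nbhs_singleton (NP x)) ck0.
    by rewrite ck0 ltxx in ck.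
  rewrite (bigD1 (Ordinal kN)) //= ltr_pwDl //.
    apply: mulr_gt0 => //; apply: spos; have [//|/nbhs_singleton ck0] := chidom k x.
    by rewrite ck0 ltxx in ck.
  by apply: sumr_ge0 => l _; exact: mulr_ge0.
apply/smooth_form2P => i x a b dx.
apply: (@fsmooth_near_eq _ _ _ _ (fun y => \sum_(k < N x)
    chi k y * gram i y (s k y *: ray_form y) a b)).
  apply: filterS (NP x) => y Ny; rewrite (gE y (N x) Ny) gram_sum summxE.
  by apply: eq_bigr => k _; rewrite (gramZ i y (chi k y)) [RHS]mxE.
apply: fsmooth_sum => k; have [dk|zk] := chidom k x; last first.
  apply: (@fsmooth_near_eq _ _ _ _ (fun=> 0)); last exact: fsmooth_cst.
  by apply: filterS zk => y zy; rewrite zy mul0r.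
apply: fsmooth_mul; first by move/smooth_funP : (schi k).
pose U y a' b' := unit_form (c k) y a' b'.
apply: (@fsmooth_near_eq _ _ _ _ (fun y => \sum_q (\sum_r jac (c k) i y r a * U y r q) *
    jac (c k) i y q b)).
  have near2 : \forall y \near x, dom (c k) y /\ dom i y.
    by apply: filterI; exact: near_dom.
  apply: filterS near2 => y [dky diy].
  rewrite (gram_change (s k y *: ray_form y) dky diy) -sE [RHS]mxE.
  apply: eq_bigr => q _; rewrite [X in _ = X * _]mxE; congr (_ * _).
  by apply: eq_bigr => r _; rewrite [_^T _ _]mxE.
apply: fsmooth_sum => q; apply: fsmooth_mul; last exact: fsmooth_jac.
apply: fsmooth_sum => r; apply: fsmooth_mul; first exact: fsmooth_jac.
exact: smooth_unit_form.
Qed.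

(** The form is a multiple of [unit_form], whose covariant derivatives are
    proportional to it. *)
Theorem ray_metric_weyl (g : M -> 'M[R]_n.+1) : (0 < n)%N -> smooth_form2 S g ->
  (forall x, in_ray x (g x)) -> weyl_connection D g.
Proof.
move=> n0 sg rg; apply: proportional_weyl => // [x|i x u dx].
  exact: ray_neq0 n0 (rg x).
pose h q := gram i (psi i q) (g (psi i q)).
pose U q := unit_form i (psi i q).
pose s q := ip (h q) (U q).
have hs : smooth_at (phi i x) h := smooth_gram sg dx.
have dh := smooth_at_is_derive u hs.
have dU := unit_form_derive u n0 dx; rewrite -/U in dU.
have ds := is_derive_ip dh dU.
have hE : \forall q \near phi i x, s q *: U q = h q.
  have := near_img dx; apply: filterS => q /img_psi[dq _].
  by symmetry; exact: unit_form_scale.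
have /is_derive_mxP dsU := dU.
set N := unit_form i x in dU ds dsU.
set t := ip (defect D i x u N) N in dU ds dsU.
set s' := _ + _ in ds.
have hx : h (phi i x) = gram i x (g x) by rewrite /h phiK.
have Ux : U (phi i x) = N by rewrite /U phiK.
have sN : s (phi i x) *: N = gram i x (g x) by rewrite -hx -Ux; exact: (nbhs_singleton hE).
have s0 : s (phi i x) != 0.
  apply: contraTneq (gram_ray_neq0 n0 dx (rg x)) => s0.
  by rewrite -sN s0 scale0r eqxx.
have dsN : is_derive (phi i x) u (fun q => s q *: U q)
    (s' *: N + s (phi i x) *: (defect D i x u N - t *: N)).
  apply/is_derive_mxP => a b.
  rewrite (_ : (fun _ => _) = s * (fun q => U q a b)); last first.
    by apply/funext => q; rewrite mxE.
  apply: is_derive_eq (is_deriveM ds (dsU a b)) _.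
  rewrite Ux [RHS]mxE [X in _ = X + _]mxE [X in _ = _ + X]mxE addrC.
  have -> : ip (h (phi i x)) N = s (phi i x) by rewrite -Ux.
  by rewrite [N a b *: s']mulrC; reflexivity.
have [_ dhE] := near_eq_is_derive hE dsN.
exists (s' / s (phi i x) - t); rewrite dhE -sN (defectZr D i x (s (phi i x)) u N).
move: (s (phi i x)) s0 (defect D i x u N) => c c0 T.
clearbody t s' N; apply/matrixP => a b; rewrite !mxE.
by field.
Qed.

End Rays.

(** * From the holonomy group to the metric *)

Section FromHolonomy.
Context {R : realType} {M : topologicalType}.

(** The zero form cannot be normalized, hence the separate treatment of
    dimension [1], where it is the metric. *)
Lemma zero_metric (S : smooth_manifold R 0 M) (D : connection S) p :
  exists g : M -> 'M[R]_1, degenerate_metric S p g /\ weyl_connection D g.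
Proof.
have f0 (X Y : M -> 'cV[R]_1) : form2 (fun=> 0) X Y = fun=> 0.
  by apply/funext => x; rewrite /form2 mulmx0 mul0mx mxE.
exists (fun=> 0); split; first split.
- move=> i u v k; rewrite f0; exact: Ck_cst.
- by move=> x; rewrite trmx0.
- by move=> x; rewrite mxrank0.
- move=> x; exists 1%:M; first exact: unitmx1.
  rewrite mulmx0 mul0mx -[LHS]block_mx0; congr block_mx; apply/matrixP => a b.
  - by case: a.
exists (fun=> 0).
  have t0 (X : M -> 'cV[R]_1) : form1 (fun=> 0) X = fun=> 0.
    by apply/funext => x; rewrite /form1 mul0mx mxE.
  move=> i u k; rewrite t0; exact: Ck_cst.
move=> X Y Z _ _ _ x; rewrite !f0 mulr0 !subr0 /lie_fun.
exact: derive_cst.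
Qed.

Theorem holonomy_weyl n (S : smooth_manifold R n M) (D : connection S) p (x0 : M)
    (P : 'M[R]_n.+1) : connected [set: M] -> P \in unitmx ->
  (forall A, holonomy D x0 A -> weyl_group p (invmx P *m A *m P)) ->
  exists g : M -> 'M[R]_n.+1, degenerate_metric S p g /\ weyl_connection D g.
Proof.
case: n S D P => [|n] S D P connM uP hol; first exact: zero_metric.
have n0 : (0 < n.+1)%N by [].
have [g sg rg] := smooth_ray_metric connM uP hol n0.
have sgn x := ray_signature connM uP hol (rg x).
have wg := ray_metric_weyl connM uP hol n0 sg rg.
exists g; split; last exact: wg.
split=> // x; have [gT gs] := sgn x => //; exact: signature_rank gs.
Qed.

End FromHolonomy.

(** * Parallel transport scales a Weyl metric *)

Lemma continuous_atM (R : realType) (f h : R -> R) (t : R) : {for t, continuous f} -> {for t, continuous h} ->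
  {for t, continuous (fun s => f s * h s)}.
Proof. by move=> cf ch; exact: (continuousM cf ch). Qed.

Lemma near_bounded (R : realType) (f : R -> R) (t : R) : {for t, continuous f} ->
  \forall s \near t, `|f s| <= `|f t| + 1.
Proof.
move=> /continuous_atP/(_ 1 ltr01); apply: filterS => s; move: (f s) (f t) => p q pq.
by rewrite -[p](subrK q) addrC (le_trans (ler_normD _ _)) // lerD2l.
Qed.

Lemma shift_derive (R : realType) (W : normedModType R) (f : R -> W) (t s : R) d :
  is_derive (t + s) 1 f d -> is_derive s 1 (fun q => f (t + q)) d.
Proof.
move=> [df <-]; have := @is_derive_line _ _ _ f t 1 s.
by rewrite /GRing.scale /= !mulr1 => /(_ df); under eq_fun do rewrite mulr1.
Qed.

Section CurveVelocities.
Context {R : realType} {n : nat} {M : topologicalType}.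
Variables (S : smooth_manifold R n M) (D : connection S).
Local Notation E := 'cV[R]_n.+1.
Local Notation e_ k := (delta_mx k 0 : E).
Implicit Types (i j : idx S) (x y : M) (u v w : E) (t s : R) (V W : R -> E).
Variables (a b : R) (gamma : R -> M).
Hypothesis sgamma : smooth_curve S `]a, b[ gamma.

Let vel i t : E := 'D_1 (phi i \o gamma) t.

Lemma curve_continuous t : a < t < b -> {for t, continuous gamma}.
Proof. by move=> tab; apply: (sgamma.1); rewrite /= in_itv. Qed.

Lemma near_itv t : a < t < b -> \forall s \near t, a < s < b.
Proof.
move=> /andP[ta tb]; near=> s; apply/andP; split; near: s.
  exact: lt_nbhsr.
exact: lt_nbhsl.
Unshelve. all: by end_near. Qed.

Lemma near_curve_dom i t : a < t < b -> dom i (gamma t) ->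
  \forall s \near t, a < s < b /\ dom i (gamma s).
Proof.
move=> tab dt; apply: filterI; first exact: near_itv.
exact: near_curve (curve_continuous tab) (near_dom dt).
Qed.

Lemma smooth_at_curve i t : a < t < b -> dom i (gamma t) -> smooth_at t (phi i \o gamma).
Proof.
move=> tab dt; apply: filterS (near_curve_dom tab dt) => s [sab ds] k.
have /Ck_pointwise := sgamma.2 i k; apply.
by split => //=; rewrite in_itv.
Qed.

Lemma is_derive_vel i t : a < t < b -> dom i (gamma t) ->
  is_derive t 1 (phi i \o gamma) (vel i t).
Proof. by move=> tab dt; exact/smooth_at_is_derive/smooth_at_curve. Qed.

Lemma vel_continuous i t k : a < t < b -> dom i (gamma t) ->
  {for t, continuous (fun s => vel i s k 0)}.
Proof.
move=> tab dt; have /continuous_mxP := smooth_at_continuous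
  (smooth_at_derive (1 : R) (smooth_at_curve tab dt)); exact.
Qed.

Lemma vel_change i j t : a < t < b -> dom i (gamma t) -> dom j (gamma t) ->
  vel j t = jac j i (gamma t) *m vel i t.
Proof.
move=> tab di dj.
have := is_derive_curve_change (curve_continuous tab) di dj (is_derive_vel tab di).
by move=> [].
Qed.

Lemma curve_fun_continuous (f : M -> R) t : a < t < b -> fsmooth S f (gamma t) ->
  {for t, continuous (f \o gamma)}.
Proof.
move=> tab sf; apply: continuous_comp; first exact: curve_continuous.
exact: fsmooth_continuous sf.
Qed.

Lemma Gam_curve_continuous i t k l : a < t < b -> dom i (gamma t) ->
  {for t, continuous (fun s => Gam D i (gamma s) (vel i s) k l)}.
Proof.
move=> tab dt.
rewrite (_ : (fun _ => _) = fun s =>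
    \sum_m vel i s m 0 * Gam D i (gamma s) (e_ m) k l); last first.
  by apply/funext => s; exact: Gam_delta.
apply: continuous_at_sum => m; apply: continuous_atM; first exact: vel_continuous.
have := curve_fun_continuous tab (fsmooth_Gam D (e_ m) k l dt); exact.
Qed.

Lemma parallel_derive V i t : parallel D `]a, b[ gamma V -> a < t < b -> dom i (gamma t) ->
  is_derive t 1 (fun s => tcoord i (gamma s) (V s))
    (- (Gam D i (gamma t) (vel i t) *m tcoord i (gamma t) (V t))).
Proof.
move=> pV tab dt; have tJ : `]a, b[%classic t by rewrite /= in_itv.
have [w /(christoffelE D _ _ _ dt) -> dV] := pV t i tJ dt; exact: dV.
Qed.

(** In a chart a parallel field solves a linear equation, so it is carried by an
    invertible resolvent. *)
Lemma parallel_zero_near V t : parallel D `]a, b[ gamma V -> a < t < b ->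
  \forall s \near t, (V s == 0) = (V t == 0).
Proof.
move=> pV tab; set i := chart_at S (gamma t).
have dt : dom i (gamma t) by exact: mem_chart_at.
pose Mx s := - Gam D i (gamma (t + s)) (vel i (t + s)).
have cM k l s : a < t + s < b -> dom i (gamma (t + s)) ->
    {for s, continuous (fun q => Mx q k l)}.
  move=> sab ds.
  rewrite (_ : (fun _ => _) =
    fun q => - ((fun q' => Gam D i (gamma q') (vel i q') k l) \o (fun q => t + q)) q); last first.
    by apply/funext => q; rewrite mxE.
  apply: continuousN; apply: continuous_comp; last exact: Gam_curve_continuous.
  by apply: cvgD; [exact: cvg_cst|exact: cvg_id].
have near0 : \forall s \near (0 : R), (a < t + s < b /\ dom i (gamma (t + s))) /\
    forall kl : 'I_n.+1 * 'I_n.+1, `|Mx s kl.1 kl.2| <= `|Mx 0 kl.1 kl.2| + 1.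
  apply: filterI.
    have c0 : {for (0 : R), continuous (fun q : R => t + q)}.
      by apply: cvgD; [exact: cvg_cst|exact: cvg_id].
    apply: (c0 (fun q => a < q < b /\ dom i (gamma q))); rewrite addr0.
    exact: near_curve_dom.
  apply: (@near_all _ _ (0 : R) (fun (kl : 'I_n.+1 * 'I_n.+1) s =>
    `|Mx s kl.1 kl.2| <= `|Mx 0 kl.1 kl.2| + 1)) => -[k l] /=.
  have a0 : a < t + 0 < b by rewrite addr0.
  have d0 : dom i (gamma (t + 0)) by rewrite addr0.
  exact: near_bounded (cM k l 0 a0 d0).
have [r' r'0 Hr'] : exists2 r' : R, 0 < r' & forall s, `|s| < r' ->
    (a < t + s < b /\ dom i (gamma (t + s))) /\
    forall kl : 'I_n.+1 * 'I_n.+1, `|Mx s kl.1 kl.2| <= `|Mx 0 kl.1 kl.2| + 1.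
  have /nbhs_ballP[e /= e0 He] := near0; exists e => // s se; apply: He.
  by rewrite /ball /= sub0r normrN.
pose K := \sum_k \sum_l (`|Mx 0 k l| + 1).
have K0 : 0 <= K by apply: sumr_ge0 => k _; apply: sumr_ge0 => l _; rewrite addr_ge0.
(* The second bound is the smallness required by [linear_ode]; [+ 1] avoids a
   division by [0]. *)
pose r := Num.min (r' / 2) (2^-1 / (n.+1%:R * K + 1)).
have d1 : 0 < n.+1%:R * K + 1 by rewrite ltr_wpDl // mulr_ge0.
have r0 : 0 < r by rewrite lt_min !divr_gt0 // invr_gt0.
have rr' : r < r' by rewrite gt_min ltr_pdivrMr // ltr_pMr // ltr1n.
have rK : r * (n.+1%:R * K) <= 2^-1.
  apply: (@le_trans _ _ (2^-1 / (n.+1%:R * K + 1) * (n.+1%:R * K))).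
    apply: ler_wpM2r; first by rewrite mulr_ge0.
    by rewrite /r ge_min lexx orbT.
  by rewrite mulrAC ler_pdivrMr // ler_wpM2l ?invr_ge0 // lerDl.
have MK s : `|s| < r' -> forall k l, `|Mx s k l| <= K.
  move=> /Hr'[_ H] k l; apply: le_trans (H (k, l)) _.
  rewrite /K (bigD1 k) //= (bigD1 l) //= -addrA lerDl addr_ge0 //.
    by apply: sumr_ge0 => l' _; rewrite addr_ge0.
  by apply: sumr_ge0 => k' _; apply: sumr_ge0 => l' _; rewrite addr_ge0.
have cMx s : `|s| < r' -> {for s, continuous Mx}.
  by move=> /Hr'[[sab ds] _]; apply/continuous_mxP => k l; exact: cM.
have [X [Y [X0 Y0 XY]]] := linear_ode r0 rr' K0 cMx MK rK.
pose v s := tcoord i (gamma (t + s)) (V (t + s)).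
have dv s : `|s| < r -> is_derive s 1 v (Mx s *m v s).
  move=> sr; have [[sab ds] _] := Hr' s (lt_trans sr rr').
  have dV := parallel_derive pV sab ds.
  have := shift_derive dV; rewrite /Mx mulNmx; exact.
have Yv s : `|s| < r -> Y s *m v s = v 0.
  move=> sr; apply/matrixP => k l; rewrite -[v 0]mul1mx -Y0.
  apply: (zero_derive_const (f := fun q => (Y q *m v q) k l)) sr => q qr.
  have [_ dY _] := XY q qr.
  have /is_derive_mxP/(_ k l) := is_derive_mulmx dY (dv q qr).
  by rewrite mulmxA mulNmx subrr mxE.
have vX s : `|s| < r -> v s = X s *m v 0.
  move=> sr; have [_ _ YX] := XY s sr.
  by rewrite -(Yv s sr) mulmxA (mulmx1C YX) mul1mx.
have tc0 y w : dom i y -> (w == 0) = (tcoord i y w == 0).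
  move=> dy; apply/eqP/eqP => [->|w0]; last first.
    by rewrite -(tcoordK w dy) w0 (tvecE _ dy) mulmx0.
  by rewrite (tcoordE _ dy) mulmx0.
have ballr : \forall s \near t, `|s - t| < r.
  by apply/nbhs_ballP; exists r => // s; rewrite /ball /= distrC.
apply: filterS ballr => s sr; have [[_ ds] _] := Hr' _ (lt_trans sr rr').
have ts : t + (s - t) = s by rewrite addrC subrK.
rewrite ts in ds; rewrite (tc0 _ (V s) ds) (tc0 _ (V t) dt).
have -> : tcoord i (gamma s) (V s) = v (s - t) by rewrite /v ts.
have -> : tcoord i (gamma t) (V t) = v 0 by rewrite /v addr0.
apply/eqP/eqP => [v0|v0]; last by rewrite (vX _ sr) v0 mulmx0.
by rewrite -(Yv _ sr) v0 mulmx0.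
Qed.

Lemma itv_point t : a < 0 -> 1 < b -> 0 <= t <= 1 -> a < t < b.
Proof. by move=> a0 b1 /andP[t0 t1]; rewrite (lt_le_trans a0) // (le_lt_trans t1). Qed.

(** The indicator function of the zeros is locally constant, so its derivative
    vanishes. *)
Lemma parallel_zero V : a < 0 -> 1 < b -> parallel D `]a, b[ gamma V ->
  V 1 = 0 -> V 0 = 0.
Proof.
move=> a0 b1 pV V1; pose f t : R := (V t == 0)%:R.
have df t : 0 <= t <= 1 -> is_derive t 1 f 0.
  move=> t01; have tab := itv_point a0 b1 t01.
  have near_f : \forall s \near t, f t = f s.
    by apply: filterS (parallel_zero_near pV tab) => s; rewrite /f => ->.
  exact: near_eq_is_derive near_f (is_derive_cst _ _ _).
have := @mvt_direction R R f 0 1; case => [t t01|t t01].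
  by rewrite add0r /GRing.scale /= mulr1; have [] := df t t01.
rewrite !add0r /GRing.scale /= mulr1; have [_ ->] := df t t01.
rewrite /f V1 eqxx => /eqP; rewrite subr_eq0 => /eqP.
by case: eqP => // _ /eqP; rewrite oner_eq0.
Qed.

Section AlongMetric.
Variables (g : M -> 'M[R]_n.+1) (theta : M -> 'rV[R]_n.+1).
Hypothesis sg : smooth_form2 S g.
Hypothesis stheta : smooth_form1 S theta.
Hypothesis weyl : forall i x u, dom i x ->
  'D_u (fun q => gram i (psi i q) (g (psi i q))) (phi i x) =
  defect D i x u (gram i x (g x)) + (theta x *m tvec i x u) 0 0 *: gram i x (g x).

Let rate t : R :=
  let c := chart_at S (gamma t) in (theta (gamma t) *m tvec c (gamma t) (vel c t)) 0 0.

Let rateE i t : a < t < b -> dom i (gamma t) ->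
  rate t = (theta (gamma t) *m tvec i (gamma t) (vel i t)) 0 0.
Proof.
move=> tab dt; have dc := mem_chart_at S (gamma t).
rewrite /rate (vel_change tab dt dc); congr ((_ *m _) 0 0).
by rewrite -(tcoord_tvec _ dt dc) (tcoordK _ dc).
Qed.

Let rate_continuous t : a < t < b -> {for t, continuous rate}.
Proof.
move=> tab; set i := chart_at S (gamma t); have dt : dom i (gamma t) := mem_chart_at S _.
pose th k y := form1 theta (fun z => tvec i z (e_ k)) y.
have sth k : fsmooth S (th k) (gamma t).
  by apply/(fsmoothP _ dt); exact: (@open_smooth_at _ _ _ (img i) _ _
    (@img_open _ _ _ S i) (mem_img dt) (stheta i (e_ k))).
have near_rate : \forall s \near t, rate s = \sum_k vel i s k 0 * (th k \o gamma) s.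
  apply: filterS (near_curve_dom tab dt) => s [sab ds].
  rewrite (rateE sab ds) (tvecE _ ds) mulmxA mxE; apply: eq_bigr => k _.
  have thE : (th k \o gamma) s = (theta (gamma s) *m jac (chart_at S (gamma s)) i (gamma s)) 0 k.
    by rewrite /th /= /form1 (tvecE _ ds) mulmxA -colE mxE.
  by rewrite thE mulrC.
have cs : {for t, continuous (fun s => \sum_k vel i s k 0 * (th k \o gamma) s)}.
  apply: continuous_at_sum => k; apply: continuous_atM; first exact: vel_continuous.
  exact: curve_fun_continuous.
have rt := nbhs_singleton near_rate.
apply/continuous_atP => e e0; move/continuous_atP : cs => /(_ e e0).
by apply: filterS2 near_rate => s -> ; rewrite rt.
Qed.

(** This scalar equation is the same for all pairs of parallel fields. *)
Let product_derive V W t : parallel D `]a, b[ gamma V -> parallel D `]a, b[ gamma W ->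
  a < t < b -> is_derive t 1 (fun s => ((V s)^T *m g (gamma s) *m W s) 0 0)
    (rate t * ((V t)^T *m g (gamma t) *m W t) 0 0).
Proof.
move=> pV pW tab; set i := chart_at S (gamma t).
have dt : dom i (gamma t) := mem_chart_at S _.
have dV := parallel_derive pV tab dt; have dW := parallel_derive pW tab dt.
have sh : smooth_at (phi i (gamma t)) ((fun y => gram i y (g y)) \o psi i) := smooth_gram sg dt.
have dH := is_derive_curve_mx (curve_continuous tab) dt (is_derive_vel tab dt) sh.
have := is_derive_mulmx (is_derive_mulmx (is_derive_trmx dV) dH) dW.
move=> /is_derive_mxP/(_ 0 0) dF.
have near_f : \forall s \near t, ((tcoord i (gamma s) (V s))^T *m gram i (gamma s) (g (gamma s))
    *m tcoord i (gamma s) (W s)) 0 0 = ((V s)^T *m g (gamma s) *m W s) 0 0.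
  apply: filterS (near_curve_dom tab dt) => s [_ ds].
  by rewrite -(gram_tcoord (g (gamma s)) (V s) (W s) ds).
apply: is_derive_eq (near_eq_is_derive near_f dF) _.
rewrite (rateE tab dt) (gram_tcoord (g (gamma t)) (V t) (W t) dt).
have wl : 'D_(vel i t) ((fun y => gram i y (g y)) \o psi i) (phi i (gamma t)) =
    defect D i (gamma t) (vel i t) (gram i (gamma t) (g (gamma t))) +
    (theta (gamma t) *m tvec i (gamma t) (vel i t)) 0 0 *: gram i (gamma t) (g (gamma t)).
  exact: (weyl (vel i t) dt).
rewrite wl /defect /=.
move: (tcoord i (gamma t) (V t)) (tcoord i (gamma t) (W t)) => y z.
move: (gram i (gamma t) (g (gamma t))) (Gam D i (gamma t) (vel i t)) => H T.
move: ((theta (gamma t) *m _) 0 0) => r.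
set H' := _ + r *: H.
have := leibniz_form y z (- (T *m y)) (- (T *m z)) H H' T.
rewrite !addNr trmx0 !mul0mx !mulmx0 !subr0 => ->.
by rewrite /H' addrAC subrr add0r -scalemxAr -scalemxAl mxE.
Qed.

(** With [F] a primitive of [rate], the product of two parallel fields is a
    constant times [exp F]. *)
Lemma transport_scales_metric (A : 'M[R]_n.+1) : a < 0 -> 1 < b ->
  (forall v : E, exists V, [/\ parallel D `]a, b[ gamma V, V 0 = v & V 1 = A *m v]) ->
  exists2 c : R, 0 < c & A^T *m g (gamma 1) *m A = c *: g (gamma 0).
Proof.
move=> a0 b1 HA.
(* [rate] is continuous on ]a, b[ only; [cl] retracts the line to a closed
   interval inside it that contains [0, 1] in its interior. *)
pose cl t : R := Num.max (a / 2) (Num.min t ((1 + b) / 2)).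
have b2 : 1 < (1 + b) / 2 < b.
  by apply/andP; split; lra.
have a2 : a < a / 2 < 0.
  by apply/andP; split; lra.
have clab t : a < cl t < b.
  move: a2 b2 => /andP[a21 a22] /andP[b21 b22].
  rewrite /cl lt_max a21 /= gt_max (lt_trans a22) /= ?(lt_trans ltr01) //.
  by rewrite gt_min b22 orbT.
have cl_id t : 0 <= t <= 1 -> \forall s \near t, cl s = s.
  move=> /andP[t0 t1]; move: a2 b2 => /andP[_ a22] /andP[b21 _].
  have n1 : \forall s \near t, a / 2 < s by apply: lt_nbhsr; exact: lt_le_trans t0.
  have n2 : \forall s \near t, s < (1 + b) / 2 by apply: lt_nbhsl; exact: le_lt_trans b21.
  apply: filterS2 n1 n2 => s s1 s2.
  by rewrite /cl min_l ?ltW // max_r // ltW.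
have ccl : continuous cl.
  move=> t; apply: (continuous_comp (f := fun t => Num.min t ((1 + b) / 2))
    (g := fun t => Num.max (a / 2) t)).
    by apply: continuous_min; [exact: cvg_id|exact: cvg_cst].
  by apply: continuous_max; [exact: cvg_cst|exact: cvg_id].
have cr : continuous (rate \o cl).
  move=> t; apply: continuous_comp; first exact: ccl.
  exact: rate_continuous (clab t).
have [F dF] := right_primitive (-1) cr.
exists (expR (F 1 - F 0)); first exact: expR_gt0.
apply/matrixP => k l.
have [V [pV V0 V1]] := HA (e_ k); have [W [pW W0 W1]] := HA (e_ l).
pose f t := ((V t)^T *m g (gamma t) *m W t) 0 0.
have df t : 0 <= t <= 1 -> is_derive t 1 (fun s => f s * expR (- F s)) 0.
  move=> t01; have tab := itv_point a0 b1 t01.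
  have d1 := product_derive pV pW tab; rewrite -/f -/(f t) in d1.
  have tm : -1 < t by case/andP: t01 => t0 _; apply: lt_le_trans t0; rewrite ltrN10.
  have d2 := is_deriveN (dF t tm).
  have d3 : is_derive t 1 (fun s => expR (- F s)) (- rate t * expR (- F t)).
    have dE : is_derive ((fun s => - F s) t) 1 expR (expR (- F t)) := is_derive_expR (- F t).
    have := @is_derive1_comp _ expR (- F) t _ _ dE d2.
    rewrite /= (nbhs_singleton (cl_id t t01)) mulrC; exact.
  apply: is_derive_eq (is_deriveM d1 d3) _.
  rewrite /GRing.scale /=; move: (f t) (rate t) (expR _) => x y z; ring.
have := @mvt_direction R R (fun s => f s * expR (- F s)) 0 1; case => [t t01|t t01].
  by rewrite add0r /GRing.scale /= mulr1; have [] := df t t01.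
rewrite !add0r /GRing.scale /= mulr1; have [_ ->] := df t t01 => /eqP.
rewrite subr_eq0 => /eqP f01.
have f1 : f 1 = expR (F 1 - F 0) * f 0.
  rewrite expRD [X in _ = X]mulrAC -mulrA -f01 mulrC -mulrA [expR (- F 1) * _]mulrC.
  by rewrite expRxMexpNx_1 mulr1.
have -> : (A^T *m g (gamma 1) *m A) k l = f 1.
  by rewrite /f V1 W1 trmx_mul -!mulmxA -(delta_mulmx_delta _ k l) !mulmxA.
by rewrite f1 [RHS]mxE /f V0 W0 (delta_mulmx_delta _ k l).
Qed.

End AlongMetric.

End CurveVelocities.

(** * From the metric to the holonomy group *)

Section ToHolonomy.
Context {R : realType} {n : nat} {M : topologicalType}.
Variables (S : smooth_manifold R n M) (D : connection S).
Local Notation E := 'cV[R]_n.+1.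

Lemma mulmx_ker_unit (A : 'M[R]_n.+1) : (forall v : E, A *m v = 0 -> v = 0) -> A \in unitmx.
Proof.
move=> kerA; rewrite -unitmx_tr -row_free_unit -kermx_eq0; apply/eqP/row_matrixP => i.
rewrite row0; apply: trmx_inj; rewrite trmx0; apply: kerA.
by apply: trmx_inj; rewrite trmx_mul trmxK trmx0 -row_mul mulmx_ker row0.
Qed.

(** Piecewise smooth curves reduce to smooth ones, as both the conformal factors
    and the invertible matrices multiply. *)
Theorem transport_conformal (g : M -> 'M[R]_n.+1) x y A :
  smooth_form2 S g -> weyl_connection D g -> transport D x y A ->
  A \in unitmx /\ exists2 c : R, 0 < c & A^T *m g y *m A = c *: g x.
Proof.
move=> sg [theta stheta W0] TA; have W := weyl_gram sg W0.
elim: TA=> [a b gamma {}A a0 b1 sgam HA|{}x {}y z {}A B _ [uA [c c0 Ac]] _ [uB [d d0 Bd]]].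
  split; last exact: (transport_scales_metric sgam sg stheta W a0 b1 HA).
  apply: mulmx_ker_unit => v Av; have [V [pV V0 V1]] := HA v.
  by rewrite -V0; apply: (parallel_zero sgam a0 b1 pV); rewrite V1.
split; first by rewrite unitmx_mul uB.
exists (d * c); first exact: mulr_gt0.
have -> : (B *m A)^T *m g z *m (B *m A) = A^T *m (B^T *m g z *m B) *m A.
  by rewrite trmx_mul !mulmxA.
by rewrite Bd -scalemxAr -scalemxAl Ac scalerA.
Qed.

(** In a basis adapted to [g x0] the holonomy preserves [Jpq p] up to positive
    factors. *)
Theorem weyl_holonomy p (g : M -> 'M[R]_n.+1) (x0 : M) :
  degenerate_metric S p g -> weyl_connection D g ->
  exists2 P : 'M[R]_n.+1, P \in unitmx &
    forall A, holonomy D x0 A -> weyl_group p (invmx P *m A *m P).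
Proof.
move=> mg wg; have [P uP PG] := degmetric_signature mg x0; exists P => // A TA.
have [uA [c c0 Ac]] := transport_conformal (degmetric_smooth mg) wg TA.
apply: (@conformal_weyl_group _ _ _ _ c) => //.
  by rewrite !unitmx_mul uA uP unitmx_inv uP.
rewrite -[Jpq p]/(block_mx 0 0 0 (Ipq p)) -PG.
have -> : (invmx P *m A *m P)^T *m (P^T *m (g x0 : 'M[R]_(1 + n)) *m P) *m (invmx P *m A *m P) =
    P^T *m (A^T *m ((P *m invmx P)^T *m g x0 *m (P *m invmx P)) *m A) *m P.
  by rewrite !trmx_mul !mulmxA.
rewrite mulmxV // trmx1 mul1mx mulmx1 Ac -scalemxAr -scalemxAl; reflexivity.
Qed.

End ToHolonomy.

Theorem theorem6p1 (R : realType) (n p : nat) (hp : (p <= n)%N)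
    (M : topologicalType) (S : smooth_manifold R n M)
    (hM : connected [set: M])
    (D : connection S) (hD : torsion_free D) (x0 : M) :
  (exists g : M -> 'M[R]_n.+1,
      degenerate_metric S p g /\ weyl_connection D g) <->
  (exists2 P : 'M[R]_n.+1, P \in unitmx &
     forall A, holonomy D x0 A -> weyl_group p (invmx P *m A *m P)).
Proof.
split=> [[g [mg wg]]|[P uP hol]]; first exact: weyl_holonomy mg wg.
exact: holonomy_weyl hM uP hol.
Qed.
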